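(* Let $\Pi^+=\{\zeta=xe_1+ye_2: x\in\mathbb{R},\ y>0\}\subset\mu$, whose boundary $\{xe_1:x\in\mathbb{R}\}$ is identified with $\mathbb{R}$. Let each function $u_l:\mathbb{R}\to\mathbb{R}$, $l\in\{1,4\}$, have a finite limit $u_l(\infty)=\lim_{|t|\to\infty}u_l(t)$ and satisfy the Dini conditions $$\int_0^1\frac{\omega_{\mathbb{R}}(u_l,\eta)}{\eta}\,d\eta<\infty,\qquad \int_0^1\frac{\omega_{\mathbb{R},\infty}(u_l,\eta)}{\eta}\,d\eta<\infty .$$ Then the general solution of the (1-4)-problem for the half-plane $\Pi^+$ with data $u_1,u_4$ is expressed by the formula $$\Phi(\zeta)=S_{\Pi^+}[u_1](\zeta)\,e_1+S_{\Pi^+}[u_4](\zeta)\,ie_2+a_1\,ie_1+a_2\,e_2,\qquad \zeta\in\Pi^+,$$ (with boundary values on $\partial\Pi^+$ given by continuous extension), where $$S_{\Pi^+}[u_l](\zeta)=\frac{1}{\pi i}\int_{-\infty}^{+\infty}\frac{u_l(t)(1+t\zeta)}{t^2+1}\,(t-\zeta)^{-1}\,dt,\qquad \zeta\in\Pi^+,\ l\in\{1,4\},$$ and $a_1,a_2$ are any real constants.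
   Context: Let $\mathbb{B}$ be the commutative associative algebra over $\mathbb{C}$ with basis $\{e_1,e_2\}$, where $e_1=1$ is the unit and $e_2^2=e_1+2ie_2$ ($i$ is the imaginary complex unit, acting as a scalar). The norm is $\|z_1e_1+z_2e_2\|=\sqrt{|z_1|^2+|z_2|^2}$, $z_1,z_2\in\mathbb{C}$. The biharmonic plane is $\mu=\{xe_1+ye_2:x,y\in\mathbb{R}\}$. Any function $\Phi$ with values in $\mathbb{B}$ is written $\Phi=U_1e_1+U_2\,ie_1+U_3e_2+U_4\,ie_2$ with real-valued components $U_1,\dots,U_4$ depending on $(x,y)$, where $\zeta=xe_1+ye_2$. A function $\Phi:D_\zeta\to\mathbb{B}$ on a domain $D_\zeta\subset\mu$ is monogenic in $D_\zeta$ if for every $\zeta\in D_\zeta$ the limit $\Phi'(\zeta)=\lim_{h\to0,\,h\in\mu}(\Phi(\zeta+h)-\Phi(\zeta))h^{-1}$ exists. (1-4)-problem for $\Pi^+$: given $u_1,u_4:\mathbb{R}\to\mathbb{R}$, find a continuous function $\Phi:\overline{\Pi^+}\to\mathbb{B}$, monogenic in $\Pi^+$, having a limit $\Phi(\infty)\in\mathbb{B}$ as $\|\zeta\|\to\infty$, $\zeta\in\Pi^+$, and satisfying $U_1=u_1$, $U_4=u_4$ on $\partial\Pi^+=\mathbb{R}$. ''General solution'' means that the set of all solutions is exactly the family given by the formula as the constants $a_1,a_2$ range over $\mathbb{R}$. For $u:\mathbb{R}\to\mathbb{R}$ with finite limit $u(\infty)$ at infinity and $\varepsilon>0$, $$\omega_{\mathbb{R}}(u,\varepsilon)=\sup_{\tau_1,\tau_2\in\mathbb{R}:\,|\tau_1-\tau_2|\le\varepsilon}|u(\tau_1)-u(\tau_2)|,\qquad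 \omega_{\mathbb{R},\infty}(u,\varepsilon)=\sup_{\tau\in\mathbb{R}:\,|\tau|\ge1/\varepsilon}|u(\tau)-u(\infty)|.$$ All integrals along the real axis are understood in the sense of their Cauchy principal values. *)

(* Defs.v *)
From Stdlib Require Import Reals Lra.
From Coquelicot Require Import Coquelicot.
Open Scope R_scope.

(** Coquelicot gives products of normed modules the Euclidean norm
    [sqrt (norm x ^ 2 + norm y ^ 2)] but no completeness; the latter is what
    makes the total operators [iota] and [RInt] available. *)
Section ProdComplete.
Context {K : AbsRing} (U V : CompleteNormedModule K).

Let prodlim (F : (U * V -> Prop) -> Prop) : U * V :=
  (lim (filtermap fst F), lim (filtermap snd F)).

Lemma prod_complete_ax1 (F : (U * V -> Prop) -> Prop) :
  ProperFilter F -> cauchy F ->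
  forall eps : posreal, F (ball (prodlim F) eps).
Proof.
intros FF HF eps.
assert (P1 : ProperFilter (filtermap fst F)) by now apply filtermap_proper_filter.
assert (P2 : ProperFilter (filtermap snd F)) by now apply filtermap_proper_filter.
assert (C1 : cauchy (filtermap fst F)).
{ intros e; destruct (HF e) as [[x y] H]; exists x; unfold filtermap; revert H.
  apply filter_imp; intros p [H _]; exact H. }
assert (C2 : cauchy (filtermap snd F)).
{ intros e; destruct (HF e) as [[x y] H]; exists y; unfold filtermap; revert H.
  apply filter_imp; intros p [_ H]; exact H. }
assert (H1 := complete_cauchy _ P1 C1 eps).
assert (H2 := complete_cauchy _ P2 C2 eps).
unfold filtermap in H1, H2.
exact (filter_and _ _ H1 H2).
Qed.

Lemma prod_complete_ax2 (F1 F2 : (U * V -> Prop) -> Prop) :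
  filter_le F1 F2 -> filter_le F2 F1 -> close (prodlim F1) (prodlim F2).
Proof.
intros H1 H2 eps; split.
- refine (close_lim (filtermap fst F1) (filtermap fst F2) _ _ eps);
    intros P HP; [now apply H1 | now apply H2].
- refine (close_lim (filtermap snd F1) (filtermap snd F2) _ _ eps);
    intros P HP; [now apply H1 | now apply H2].
Qed.

Definition prod_CompleteNormedModule : CompleteNormedModule K :=
  CompleteNormedModule.Pack K (U * V)
    (CompleteNormedModule.Class K (U * V)
      (NormedModule.class K (prod_NormedModule K U V))
      (CompleteSpace.Mixin (prod_UniformSpace U V) prodlim
        prod_complete_ax1 prod_complete_ax2))
    (U * V).
End ProdComplete.

(** The pair [(z1, z2)] stands for [z1 e_1 + z2 e_2]. *)
Definition B : CompleteNormedModule R_AbsRing :=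
  prod_CompleteNormedModule C_R_CompleteNormedModule C_R_CompleteNormedModule.

Definition Badd (a b : B) : B := plus a b.
Definition Bopp (a : B) : B := opp a.
Definition Bsub (a b : B) : B := minus a b.
Definition Bscal (c : C) (b : B) : B := (c * fst b, c * snd b)%C.
(** Bilinear extension of [e_2 ^ 2 = e_1 + 2 i e_2]. *)
Definition Bmul (a b : B) : B :=
  (fst a * fst b + snd a * snd b,
   fst a * snd b + snd a * fst b + 2 * Ci * (snd a * snd b))%C.
(** [(z1 e_1 + z2 e_2) ((z1 + 2 i z2) e_1 - z2 e_2) = (z1 + i z2) ^ 2 e_1];
    meaningful only where [z1 + i z2 <> 0], see [Bmul_inv]. *)
Definition Binv (b : B) : B :=
  let d := (fst b + Ci * snd b)%C in
  ((fst b + 2 * Ci * snd b) / (d * d), - snd b / (d * d))%C.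

Definition e1 : B := (RtoC 1, RtoC 0).
Definition e2 : B := (RtoC 0, RtoC 1).

Definition U1 (b : B) : R := Re (fst b).
Definition U2 (b : B) : R := Im (fst b).
Definition U3 (b : B) : R := Re (snd b).
Definition U4 (b : B) : R := Im (snd b).

(** The plane [{x e_1 + y e_2}] in real coordinates [(x, y)]. *)
Definition mu : NormedModule R_AbsRing :=
  prod_NormedModule R_AbsRing R_NormedModule R_NormedModule.
Definition of_mu (zeta : mu) : B :=
  Badd (Bscal (RtoC (fst zeta)) e1) (Bscal (RtoC (snd zeta)) e2).

Local Ltac C_eq :=
  apply injective_projections; cbv -[Rplus Rmult Ropp IZR]; ring.
Local Ltac B_eq := apply injective_projections; C_eq.

Lemma B_ring_theory : ring_theory (zero : B) e1 Badd Bmul Bsub Bopp eq.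
Proof.
constructor; repeat intros [[? ?] [? ?]]; B_eq.
Qed.

Lemma Be2_sqr : Bmul e2 e2 = Badd e1 (Bscal (2 * Ci) e2).
Proof. B_eq. Qed.

Lemma B_components (b : B) :
  b = Badd (Badd (Badd (Bscal (RtoC (U1 b)) e1) (Bscal (RtoC (U2 b) * Ci) e1))
                 (Bscal (RtoC (U3 b)) e2)) (Bscal (RtoC (U4 b) * Ci) e2).
Proof. destruct b as [[? ?] [? ?]]; B_eq. Qed.

Lemma Bnorm_eq (b : B) : norm b = sqrt (Cmod (fst b) ^ 2 + Cmod (snd b) ^ 2).
Proof.
destruct b as [[x1 y1] [x2 y2]].
assert (H : forall x y : R, sqrt (Rabs x ^ 2 + Rabs y ^ 2) = Cmod (x, y)).
{ now intros x y; unfold Cmod; cbn [fst snd]; rewrite 2!pow2_abs. }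
change (norm ((x1, y1), (x2, y2)))
  with (sqrt (sqrt (Rabs x1 ^ 2 + Rabs y1 ^ 2) ^ 2
            + sqrt (Rabs x2 ^ 2 + Rabs y2 ^ 2) ^ 2)).
now rewrite 2!H.
Qed.

Lemma norm_of_mu (zeta : mu) : norm (of_mu zeta) = norm zeta.
Proof.
rewrite Bnorm_eq; destruct zeta as [x y]; cbn in x, y.
change (norm (x, y)) with (sqrt (Rabs x ^ 2 + Rabs y ^ 2)).
rewrite <- (Cmod_R x), <- (Cmod_R y).
do 2 f_equal; do 2 f_equal; C_eq.
Qed.

Lemma Bmul_inv (b : B) :
  (fst b + Ci * snd b <> 0)%C -> Bmul b (Binv b) = e1.
Proof.
destruct b as [z w]; unfold Bmul, Binv, e1; cbn in z, w; cbn [fst snd].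
intros H.
assert (I : (Ci * Ci = - (1))%C) by C_eq.
assert (S : (z * z + 2 * Ci * z * w - w * w = (z + Ci * w) * (z + Ci * w))%C).
{ transitivity (z * z + 2 * Ci * z * w + (Ci * Ci) * w * w)%C;
    [rewrite I; ring | ring]. }
apply injective_projections; cbn [fst snd];
  match goal with |- ?a = ?b => change (@eq C a b) end.
- transitivity ((z * z + 2 * Ci * z * w - w * w)
                / ((z + Ci * w) * (z + Ci * w)))%C;
    [|rewrite S]; now field.
- now field.
Qed.

Lemma of_mu_unit (h : mu) : h <> zero -> Bmul (of_mu h) (Binv (of_mu h)) = e1.
Proof.
destruct h as [x y]; cbn in x, y; intros H; apply Bmul_inv; intros E; apply H.
assert (Ex := f_equal fst E); assert (Ey := f_equal snd E).
cbv -[Rplus Rmult Ropp IZR] in Ex, Ey; cbv.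
f_equal; lra.
Qed.

Definition is_mderive (Phi : mu -> B) (zeta : mu) (l : B) : Prop :=
  filterlim
    (fun h : mu => Bmul (Bsub (Phi (plus zeta h)) (Phi zeta)) (Binv (of_mu h)))
    (locally' (zero : mu)) (locally l).

(** [D] is meant to be open in [mu], so that values of [Phi] off [D] are
    irrelevant. *)
Definition monogenic (D : mu -> Prop) (Phi : mu -> B) : Prop :=
  forall zeta, D zeta -> exists l, is_mderive Phi zeta l.

Definition Pi_plus (zeta : mu) : Prop := 0 < snd zeta.
Definition Pi_plus_bar (zeta : mu) : Prop := 0 <= snd zeta.
Definition Pi_plus_boundary (zeta : mu) : Prop := snd zeta = 0.

(** The filter of sets containing [{v : norm v > M}] for some [M]. *)
Definition at_infty {V : NormedModule R_AbsRing} (P : V -> Prop) : Prop :=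
  exists M : R, forall v : V, M < norm v -> P v.

(** Functions on the closed half-plane are represented by functions on [mu]
    whose values for [y < 0] are irrelevant. *)
Definition solves_14 (u1 u4 : R -> R) (Phi : mu -> B) : Prop :=
  (forall zeta, Pi_plus_bar zeta ->
     filterlim Phi (within Pi_plus_bar (locally zeta)) (locally (Phi zeta))) /\
  monogenic Pi_plus Phi /\
  (exists l : B, filterlim Phi (within Pi_plus at_infty) (locally l)) /\
  (forall x : R, U1 (Phi (x, 0)) = u1 x /\ U4 (Phi (x, 0)) = u4 x).

Definition omega (u : R -> R) (eps : R) : Rbar :=
  Lub_Rbar (fun r => exists t1 t2 : R,
    Rabs (t1 - t2) <= eps /\ r = Rabs (u t1 - u t2)).

Definition omega_infty (u : R -> R) (u_inf eps : R) : Rbar :=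
  Lub_Rbar (fun r => exists t : R, 1 / eps <= Rabs t /\ r = Rabs (u t - u_inf)).

(** [int_0^1 w(eta) / eta d eta < oo] for a nonnegative nondecreasing [w] with
    values in [[0, +oo]]. Finiteness of [w] on [(0, 1)] has to be required
    separately since [real p_infty = 0]; for such [w] the quotient is then
    Riemann integrable on every [[a, b]] inside [(0, 1)].  The endpoint 1 is
    also approached by a limit since [w 1] may be infinite. *)
Definition dini (w : R -> Rbar) : Prop :=
  (forall eta, 0 < eta < 1 -> is_finite (w eta)) /\
  ex_RInt_gen (fun eta => real (w eta) / eta) (at_right 0) (at_left 1).

(** Principal value over the real line. *)
Definition is_pv (f : R -> B) (l : B) : Prop :=
  filterlimi (fun N : R => is_RInt f (- N) N) (Rbar_locally p_infty) (locally l).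
Definition ex_pv (f : R -> B) : Prop := exists l, is_pv f l.
Definition pv (f : R -> B) : B := iota (is_pv f).

Lemma is_pv_unique (f : R -> B) (l : B) : is_pv f l -> pv f = l.
Proof.
intros H; unfold pv.
apply (iota_filterlimi_locally (F := Rbar_locally p_infty)
         (fun N : R => is_RInt f (- N) N) l); [|exact H].
apply filter_forall; intros N y1 y2 H1 H2.
now rewrite <- (is_RInt_unique f (- N) N y1 H1); apply is_RInt_unique.
Qed.

Definition schwarz_integrand (u : R -> R) (zeta : mu) (t : R) : B :=
  Bmul (Bscal (RtoC (u t / (t ^ 2 + 1)))
              (Badd e1 (Bscal (RtoC t) (of_mu zeta))))
       (Binv (Bsub (Bscal (RtoC t) e1) (of_mu zeta))).

Definition schwarz (u : R -> R) (zeta : mu) : B :=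
  Bscal (/ (RtoC PI * Ci)) (pv (schwarz_integrand u zeta)).

Definition sol_formula (u1 u4 : R -> R) (a1 a2 : R) (zeta : mu) : B :=
  Badd (Badd (Badd (Bmul (schwarz u1 zeta) e1)
                   (Bmul (schwarz u4 zeta) (Bscal Ci e2)))
             (Bscal (RtoC a1 * Ci) e1))
       (Bscal (RtoC a2) e2).

(** [Phi] is given on the closed half-plane by [F] on the open one, continuously
    extended to the boundary. *)
Definition extends_from_Pi_plus (F Phi : mu -> B) : Prop :=
  (forall zeta, Pi_plus zeta -> Phi zeta = F zeta) /\
  (forall zeta, Pi_plus_boundary zeta ->
     filterlim F (within Pi_plus (locally zeta)) (locally (Phi zeta))).

(* Main.v *)
(** Put [n = e_2 - i e_1]; then [n ^ 2 = 0] and [zeta = x e_1 + y e_2] is [z + y n]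
    with [z = x + i y], so that [S[u](zeta) = F z + y F' z n], where [F] is the classical
    Schwarz integral of [u]. After the substitution [t = tan phi] the datum becomes a
    continuous function on a circle of length [PI], [F] becomes a proper integral, and the
    inversion [z -> -1/z] turns infinity into an ordinary boundary point. There
    [Re F -> u] and [y F' -> 0] hold because both are bounded by a Poisson integral, while
    the limit of [Im F] exists because the Dini conditions control the integrals
    [int |u(phi + p) - u(phi)| / p dp] near [p = 0] uniformly in [phi].

    For uniqueness, the component [fst + i snd] of a monogenic function is holomorphic in
    [z], and so is [snd] once [fst + i snd] is constant. For a difference of two solutions
    both have, up to a factor [i], a vanishing real part on the boundary and a limit at
    infinity, hence are constant by the maximum principle, which is derived from Cauchy's
    theorem for rectangles. *)

Require Import Defs.
From Stdlib Require Import Reals Lra Classical ClassicalEpsilon FunctionalExtensionality.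
From Coquelicot Require Import Coquelicot.
Open Scope R_scope.

(** The problem asks for continuity on the closed half-plane, so boundary limits must hold along
    every approach, tangential ones included. Hence no integral is centred at a fixed boundary
    point: each is recentred at the moving angle [atan (Re z)], where the denominator of the kernel
    is bounded below by [|sin p|], independently of [Im z]. Recentring is possible because the
    kernels of [F] and [F'] have total masses [pi_i] and 0. The kernel of [y F'] has exactly the
    modulus of the Poisson kernel, so continuity of the datum suffices for it; the conjugate part of
    the kernel of [F] is only controlled by a multiple of [1 / p], and there the Dini integral
    enters. At infinity the two Dini conditions measure the datum on different scales, and gluing
    them into one estimate on the circle is the delicate point. In the uniqueness part the order
    matters: the difference quotient of [snd] contains a term coming from [fst + i snd]. The
    prescribed components enter through [Re (fst + i snd) = U1 - U4] and [Re (i snd) = - U4]. *)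

#[local] Notation RN := R_NormedModule.
#[local] Notation RCN := R_CompleteNormedModule.
#[local] Notation CN := C_R_NormedModule.
#[local] Notation CCN := C_R_CompleteNormedModule.
#[local] Notation Cu := C_UniformSpace.
#[local] Notation CxR := (prod_UniformSpace C_UniformSpace R_UniformSpace).
#[local] Notation re_fst := (fun q : CxR => Re (fst q)).
#[local] Notation contCC := (@continuous C_UniformSpace C_UniformSpace).

Local Tactic Notation "unfold_ball" :=
  unfold ball; simpl; unfold AbsRing_ball, abs, minus, plus, opp; simpl.
Local Tactic Notation "unfold_ball" "in" hyp(H) :=
  unfold ball in H; simpl in H; unfold AbsRing_ball, abs, minus, plus, opp in H; simpl in H.
Local Ltac pair_ext := apply injective_projections.
(* Coquelicot lemmas leave equations typed in an unfolded module structure, where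
   [ring] and [field] find no instance. *)
Local Ltac eq_in_C := match goal with |- ?a = ?b => change (@eq C a b) end.
Local Ltac eq_in_R := match goal with |- ?a = ?b => change (@eq R a b) end.
Local Ltac le_triangle := eapply Rle_trans; [first [apply Cmod_triangle|apply Rabs_triang]|].
Local Ltac lt_triangle := eapply Rle_lt_trans; [first [apply Cmod_triangle|apply Rabs_triang]|].

(** * Limits and continuity of complex-valued functions *)

Lemma continuous_add_l (c t : R) : continuous (fun p => c + p) t.
Proof. apply (continuous_plus (V := RN)); [apply continuous_const|apply continuous_id]. Qed.

Lemma continuous_add_r (c t : R) : continuous (fun p => p + c) t.
Proof. apply (continuous_plus (V := RN)); [apply continuous_id|apply continuous_const]. Qed.

Lemma continuous_sub_l (c t : R) : continuous (fun p => c - p) t.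
Proof. apply (continuous_minus (V := RN)); [apply continuous_const|apply continuous_id]. Qed.

Lemma norm_C (z : C) : @norm R_AbsRing CN z = Cmod z.
Proof.
destruct z as [x y].
change (sqrt (Rabs x ^ 2 + Rabs y ^ 2) = sqrt (x ^ 2 + y ^ 2)).
now rewrite 2!pow2_abs.
Qed.

Lemma im_le_Cmod (z : C) : Rabs (Im z) <= Cmod z.
Proof. apply (Rle_trans _ _ _ (Rmax_r (Rabs (fst z)) (Rabs (snd z)))), Rmax_Cmod. Qed.

Lemma Cmod_le_abs (x y : R) : Cmod (x, y) <= Rabs x + Rabs y.
Proof.
replace ((x, y) : C) with (RtoC x + RtoC y * Ci)%C
  by (pair_ext; simpl; ring).
le_triangle.
rewrite Cmod_mult, 2!Cmod_R.
replace (Cmod Ci) with 1; [lra|].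
unfold Cmod; simpl; rewrite <- sqrt_1 at 1; f_equal; ring.
Qed.

Lemma Cminus_0_r (z : C) : (z - 0)%C = z.
Proof. ring. Qed.

Local Ltac lt_Cmod_abs := eapply Rle_lt_trans; [apply Cmod_le_abs|]; simpl.

(** Measured in [Cmod], whereas the balls of the uniform structure on [C] are squares. The arbitrary
    filter lets one set of limit rules serve boundary points, infinity and difference quotients. *)
Definition limC {T} (F : (T -> Prop) -> Prop) (f : T -> C) (l : C) :=
  forall eps, 0 < eps -> F (fun p => Cmod (f p - l) < eps).

Lemma limC_filterlim {T} (F : (T -> Prop) -> Prop) {FF : Filter F} (f : T -> C) (l : C) :
  limC F f l <-> filterlim f F (@locally Cu l).
Proof.
rewrite (filterlim_locally_ball_norm (U := CN)).
unfold ball_norm; split; intros H.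
- intros [e He]; generalize (H e He); apply filter_imp; intros p Hp.
  change (@norm R_AbsRing CN (f p - l)%C < e); now rewrite norm_C.
- intros e He; generalize (H (mkposreal e He)); apply filter_imp; intros p Hp.
  rewrite <- norm_C; exact Hp.
Qed.

Lemma continuous_C_iff {T : UniformSpace} (f : T -> C) (p : T) :
  @continuous T Cu f p <->
  continuous (fun t => Re (f t)) p /\ continuous (fun t => Im (f t)) p.
Proof.
split.
- intros H; split.
  + apply (continuous_comp (V := Cu) f (fun z : C => Re z)); [exact H|].
    apply (continuous_fst (U := R_UniformSpace) (V := R_UniformSpace)).
  + apply (continuous_comp (V := Cu) f (fun z : C => Im z)); [exact H|].
    apply (continuous_snd (U := R_UniformSpace) (V := R_UniformSpace)).
- intros [H1 H2].
  apply filterlim_locally; intros eps.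
  assert (L1 := proj1 (filterlim_locally _ _) H1 eps).
  assert (L2 := proj1 (filterlim_locally _ _) H2 eps).
  exact (filter_and _ _ L1 L2).
Qed.

Lemma continuous_Cmult {T : UniformSpace} (f g : T -> C) (p : T) :
  @continuous T Cu f p -> @continuous T Cu g p ->
  @continuous T Cu (fun t => f t * g t)%C p.
Proof.
rewrite !continuous_C_iff; intros [A1 A2] [B1 B2]; split; simpl.
- apply (continuous_minus (V := RN)); apply (continuous_mult (K := R_AbsRing)); assumption.
- apply (continuous_plus (V := RN)); apply (continuous_mult (K := R_AbsRing)); assumption.
Qed.

Lemma continuous_Cplus {T : UniformSpace} (f g : T -> C) (p : T) :
  @continuous T Cu f p -> @continuous T Cu g p ->
  @continuous T Cu (fun t => f t + g t)%C p.
Proof. exact (continuous_plus (V := CN) f g p). Qed.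

Lemma continuous_Cminus {T : UniformSpace} (f g : T -> C) (p : T) :
  @continuous T Cu f p -> @continuous T Cu g p ->
  @continuous T Cu (fun t => f t - g t)%C p.
Proof. exact (continuous_minus (V := CN) f g p). Qed.

Lemma continuous_RtoC {T : UniformSpace} (f : T -> R) (p : T) :
  continuous f p -> @continuous T Cu (fun t => RtoC (f t)) p.
Proof.
intros H; apply continuous_C_iff; split; simpl; [exact H|apply continuous_const].
Qed.

Lemma continuous_inv {T : UniformSpace} (f : T -> R) (p : T) :
  continuous f p -> f p <> 0 -> continuous (fun t => / f t) p.
Proof.
intros H N; apply (continuous_comp f Rinv); [exact H|].
now apply continuous_Rinv.
Qed.

Lemma Cmod2_pos (z : C) : z <> 0%C -> 0 < Re z ^ 2 + Im z ^ 2.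
Proof.
intros N; destruct z as [x y]; simpl.
destruct (Req_dec x 0) as [->|]; [|nra].
destruct (Req_dec y 0) as [->|]; [now elim N|nra].
Qed.

Lemma continuous_Cinv {T : UniformSpace} (f : T -> C) (p : T) :
  @continuous T Cu f p -> f p <> 0%C ->
  @continuous T Cu (fun t => / f t)%C p.
Proof.
rewrite !continuous_C_iff; intros [A1 A2] N.
assert (D : continuous (fun t => / (Re (f t) ^ 2 + Im (f t) ^ 2)) p).
{ apply continuous_inv; [|generalize (Cmod2_pos _ N); lra].
  apply (continuous_plus (V := RN));
    apply (continuous_mult (K := R_AbsRing)); try assumption;
    apply (continuous_mult (K := R_AbsRing)); try assumption; apply continuous_const. }
split; simpl; unfold Rdiv; apply (continuous_mult (K := R_AbsRing)); try assumption.
now apply (continuous_opp (V := RN)).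
Qed.

Lemma continuous_Cdiv {T : UniformSpace} (f g : T -> C) (p : T) :
  @continuous T Cu f p -> @continuous T Cu g p -> g p <> 0%C ->
  @continuous T Cu (fun t => f t / g t)%C p.
Proof.
intros Hf Hg N; apply continuous_Cmult; [exact Hf|now apply continuous_Cinv].
Qed.

Lemma continuous_Cmod {T : UniformSpace} (f : T -> C) (p : T) :
  @continuous T Cu f p -> continuous (fun t => Cmod (f t)) p.
Proof.
intros H.
apply (continuous_ext (fun t => @norm R_AbsRing CN (f t)));
  [intros t; apply norm_C|].
apply (continuous_comp (V := CN) f norm); [exact H|].
apply (filterlim_norm (V := CN)).
Qed.

(** * Integrals of complex-valued functions of a real variable *)

Definition CInt (f : R -> C) (a b : R) : C := RInt (V := CCN) f a b.
#[local] Notation is_CInt := (is_RInt (V := CN)).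
#[local] Notation ex_CInt := (ex_RInt (V := CN)).
#[local] Notation contC := (@continuous R_UniformSpace Cu).

Lemma is_CInt_comp (f : R -> C) a b (l : C) :
  is_CInt f a b l <->
  is_RInt (fun t => Re (f t)) a b (Re l) /\ is_RInt (fun t => Im (f t)) a b (Im l).
Proof.
split.
- intros H; split.
  + exact (is_RInt_fct_extend_fst (U := RN) (V := RN) f a b l H).
  + exact (is_RInt_fct_extend_snd (U := RN) (V := RN) f a b l H).
- intros [H1 H2]; destruct l as [l1 l2].
  exact (is_RInt_fct_extend_pair (U := RN) (V := RN) f a b l1 l2 H1 H2).
Qed.

Lemma is_CInt_mult (c : C) (f : R -> C) a b (l : C) :
  is_CInt f a b l -> is_CInt (fun t => c * f t)%C a b (c * l)%C.
Proof.
rewrite !is_CInt_comp; intros [H1 H2]; split; simpl.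
- apply (is_RInt_minus (V := RN));
    apply (is_RInt_scal (V := RN)); assumption.
- apply (is_RInt_plus (V := RN));
    apply (is_RInt_scal (V := RN)); assumption.
Qed.

Lemma ex_CInt_cont (f : R -> C) a b :
  a <= b -> (forall t, a <= t <= b -> contC f t) -> ex_CInt f a b.
Proof.
intros L H; apply (ex_RInt_continuous (V := CCN)); intros t Ht.
rewrite Rmin_left, Rmax_right in Ht by exact L; now apply H.
Qed.

Lemma CInt_correct (f : R -> C) a b : ex_CInt f a b -> is_CInt f a b (CInt f a b).
Proof. apply (RInt_correct (V := CCN)). Qed.

Lemma CInt_unique (f : R -> C) a b l : is_CInt f a b l -> CInt f a b = l.
Proof. apply (is_RInt_unique (V := CCN)). Qed.

Lemma CInt_ext (f g : R -> C) a b :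
  a <= b -> (forall t, a <= t <= b -> f t = g t) -> CInt f a b = CInt g a b.
Proof.
intros L H; apply (RInt_ext (V := CCN)); intros t Ht.
rewrite Rmin_left, Rmax_right in Ht by exact L; apply H; lra.
Qed.

Lemma CInt_mult c (f : R -> C) a b :
  ex_CInt f a b -> CInt (fun t => c * f t)%C a b = (c * CInt f a b)%C.
Proof. intros H; apply CInt_unique, is_CInt_mult, CInt_correct, H. Qed.

Lemma CInt_plus (f g : R -> C) a b : ex_CInt f a b -> ex_CInt g a b ->
  CInt (fun t => f t + g t)%C a b = (CInt f a b + CInt g a b)%C.
Proof. apply (RInt_plus (V := CCN)). Qed.

Lemma CInt_minus (f g : R -> C) a b : ex_CInt f a b -> ex_CInt g a b ->
  CInt (fun t => f t - g t)%C a b = (CInt f a b - CInt g a b)%C.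
Proof. apply (RInt_minus (V := CCN)). Qed.

Lemma CInt_const (c : C) a b : CInt (fun _ => c) a b = (RtoC (b - a) * c)%C.
Proof.
rewrite (RInt_const (V := CCN)).
pair_ext; cbv -[Rplus Rmult Ropp Rminus]; simpl; ring.
Qed.

Lemma CInt_Chasles (f : R -> C) a b c : ex_CInt f a b -> ex_CInt f b c ->
  (CInt f a b + CInt f b c)%C = CInt f a c.
Proof. apply (RInt_Chasles (V := CCN)). Qed.

Lemma Re_CInt (f : R -> C) a b :
  ex_CInt f a b -> Re (CInt f a b) = RInt (fun t => Re (f t)) a b.
Proof.
intros H; symmetry; apply (is_RInt_unique (V := RCN)).
now apply (is_CInt_comp f a b (CInt f a b)), CInt_correct.
Qed.

Lemma Im_CInt (f : R -> C) a b :
  ex_CInt f a b -> Im (CInt f a b) = RInt (fun t => Im (f t)) a b.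
Proof.
intros H; symmetry; apply (is_RInt_unique (V := RCN)).
now apply (is_CInt_comp f a b (CInt f a b)), CInt_correct.
Qed.

Lemma Cmod_CInt_le (f : R -> C) (g : R -> R) a b :
  a <= b -> (forall t, a <= t <= b -> Cmod (f t) <= g t) ->
  ex_CInt f a b -> ex_RInt g a b -> Cmod (CInt f a b) <= RInt g a b.
Proof.
intros L H Hf Hg; rewrite <- norm_C.
apply (norm_RInt_le (V := CN) f g a b); [exact L| | |].
- intros t Ht; rewrite norm_C; now apply H.
- now apply CInt_correct.
- now apply (RInt_correct (V := RCN)).
Qed.

Lemma Cmod_CInt_le_const (f : R -> C) M a b :
  a <= b -> (forall t, a <= t <= b -> Cmod (f t) <= M) ->
  ex_CInt f a b -> Cmod (CInt f a b) <= (b - a) * M.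
Proof.
intros L H Hf; rewrite <- norm_C.
apply (norm_RInt_le_const (V := CN) f); [exact L| |].
- intros t Ht; rewrite norm_C; now apply H.
- now apply CInt_correct.
Qed.

(** * Complex differentiability *)

Definition cdiff (f : C -> C) (z l : C) : Prop :=
  forall eps, 0 < eps -> exists delta, 0 < delta /\
    forall w, Cmod (w - z) < delta ->
      Cmod (f w - f z - (w - z) * l) <= eps * Cmod (w - z).

Lemma locally_Cmod (z : C) (P : C -> Prop) :
  @locally Cu z P <->
  exists delta, 0 < delta /\ forall w, Cmod (w - z) < delta -> P w.
Proof.
split.
- intros [d H]; exists d; split; [apply cond_pos|].
  intros w Hw; apply H; split; unfold_ball.
  + eapply Rle_lt_trans; [|exact Hw]; apply (re_le_Cmod (w - z)).
  + eapply Rle_lt_trans; [|exact Hw]; apply (im_le_Cmod (w - z)).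
- intros [d [Hd H]].
  assert (Hd2 : 0 < d / 2) by lra.
  exists (mkposreal _ Hd2); intros w [H1 H2]; apply H.
  unfold_ball in H1; unfold_ball in H2.
  lt_Cmod_abs; lra.
Qed.

Lemma cdiff_continuous f z l : cdiff f z l -> contCC f z.
Proof.
intros H; apply limC_filterlim; [apply locally_filter|].
intros eps He; destruct (H 1 Rlt_0_1) as [d [Hd K]].
apply locally_Cmod.
assert (Q : 0 < eps / (2 + Cmod l)).
{ apply Rdiv_lt_0_compat; [lra|generalize (Cmod_ge_0 l); lra]. }
exists (Rmin d (eps / (2 + Cmod l))); split; [now apply Rmin_pos|].
intros w Hw.
assert (Hw1 := Rlt_le_trans _ _ _ Hw (Rmin_l _ _)).
assert (Hw2 := Rlt_le_trans _ _ _ Hw (Rmin_r _ _)).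
specialize (K w Hw1).
replace (f w - f z)%C with ((f w - f z - (w - z) * l) + (w - z) * l)%C by ring.
lt_triangle; rewrite Cmod_mult.
assert (P := Cmod_ge_0 l); assert (P' := Cmod_ge_0 (w - z)).
apply (Rmult_lt_compat_r (2 + Cmod l)) in Hw2; [|lra].
unfold Rdiv in Hw2; rewrite Rmult_assoc, Rinv_l in Hw2 by lra.
nra.
Qed.

Lemma cdiff_limC f z l : cdiff f z l -> limC (@locally Cu z) f (f z).
Proof.
intros H; apply limC_filterlim; [apply locally_filter|exact (cdiff_continuous _ _ _ H)].
Qed.

Lemma limC_plus {T} (F : (T -> Prop) -> Prop) {FF : Filter F} f g l m :
  limC F f l -> limC F g m -> limC F (fun p => f p + g p)%C (l + m)%C.
Proof.
intros Hf Hg eps He; assert (He2 : 0 < eps / 2) by lra.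
generalize (filter_and _ _ (Hf _ He2) (Hg _ He2)); apply filter_imp; intros p [H1 H2].
replace (f p + g p - (l + m))%C with ((f p - l) + (g p - m))%C by ring.
lt_triangle; lra.
Qed.

Lemma limC_const {T} (F : (T -> Prop) -> Prop) {FF : Filter F} c : limC F (fun _ => c) c.
Proof.
intros eps He; apply filter_forall; intros _.
replace (c - c)%C with (RtoC 0) by ring; now rewrite Cmod_0.
Qed.

Lemma limC_scal {T} (F : (T -> Prop) -> Prop) {FF : Filter F} c f l :
  limC F f l -> limC F (fun p => c * f p)%C (c * l)%C.
Proof.
intros Hf eps He.
assert (Pc := Cmod_ge_0 c).
assert (Q : 0 < eps / (Cmod c + 1)) by (apply Rdiv_lt_0_compat; lra).
generalize (Hf _ Q); apply filter_imp; intros p Hp.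
replace (c * f p - c * l)%C with (c * (f p - l))%C by ring; rewrite Cmod_mult.
apply (Rmult_lt_compat_r (Cmod c + 1)) in Hp; [|lra].
replace (eps / (Cmod c + 1) * (Cmod c + 1)) with eps in Hp by (field; lra).
generalize (Cmod_ge_0 (f p - l)); nra.
Qed.

Lemma limC_opp {T} (F : (T -> Prop) -> Prop) {FF : Filter F} f l :
  limC F f l -> limC F (fun p => - f p)%C (- l).
Proof.
intros H eps He; generalize (H eps He); apply filter_imp; intros p Hp.
replace (- f p - - l)%C with (- (f p - l))%C by ring; now rewrite Cmod_opp.
Qed.

Lemma limC_minus {T} (F : (T -> Prop) -> Prop) {FF : Filter F} f g l m :
  limC F f l -> limC F g m -> limC F (fun p => f p - g p)%C (l - m)%C.
Proof. intros Hf Hg; apply limC_plus; [exact FF|exact Hf|now apply limC_opp]. Qed.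

Lemma limC_ext {T} (F : (T -> Prop) -> Prop) {FF : Filter F} f g l :
  F (fun p => f p = g p) -> limC F f l -> limC F g l.
Proof.
intros E Hf eps He; generalize (filter_and _ _ E (Hf eps He)).
apply filter_imp; intros p [<- H]; exact H.
Qed.

Lemma cdiff_const c z : cdiff (fun _ => c) z 0.
Proof.
intros eps He; exists 1; split; [lra|]; intros w _.
replace (c - c - (w - z) * 0)%C with (RtoC 0) by ring.
rewrite Cmod_0; generalize (Cmod_ge_0 (w - z)); nra.
Qed.

(** [mu] and [C] have the same carrier, so complex difference quotients can be taken along this
    filter too; monogenic and complex derivatives thereby become limits along one and the same
    filter. *)
Definition punctured : (mu -> Prop) -> Prop := locally' (zero : mu).

Lemma punctured_iff (P : mu -> Prop) : punctured P <->
  exists d, 0 < d /\ forall h : C, h <> 0%C -> Cmod h < d -> P h.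
Proof.
unfold punctured, locally', within; rewrite (locally_Cmod (0, 0)).
split; intros [d [Hd K]]; exists d; split; try exact Hd.
- intros h Hh Hm; apply K; [|exact Hh].
  replace (h - (0, 0))%C with h by (pair_ext; simpl; ring); exact Hm.
- intros h Hm Hh; apply K; [exact Hh|].
  replace (h - (0, 0))%C with h in Hm by (pair_ext; simpl; ring); exact Hm.
Qed.

#[local] Instance punctured_filter : Filter punctured.
Proof. apply within_filter, locally_filter. Qed.

(** The multiplied-out form suits estimates under an integral and composition; the quotient form
    inherits the algebra of [limC] and matches the definition of a monogenic function. *)
Lemma cdiff_iff_quotient f z l :
  cdiff f z l <-> limC punctured (fun h : C => (f (z + h) - f z) / h)%C l.
Proof.
split.
- intros H eps He; assert (He2 : 0 < eps / 2) by lra.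
  destruct (H _ He2) as [d [Hd K]]; apply punctured_iff; exists d; split; [exact Hd|].
  intros h Hh Hm; specialize (K (z + h)%C).
  replace (z + h - z)%C with h in K by ring; specialize (K Hm).
  assert (Ph := proj1 (Cmod_gt_0 h) Hh).
  replace ((f (z + h) - f z) / h - l)%C with ((f (z + h) - f z - h * l) * / h)%C by (field; exact Hh).
  rewrite Cmod_mult, Cmod_inv by exact Hh.
  apply Rle_lt_trans with (eps / 2); [|lra].
  apply (Rmult_le_reg_r (Cmod h)); [exact Ph|].
  rewrite Rmult_assoc, Rinv_l, Rmult_1_r by lra; exact K.
- intros H eps He; destruct (proj1 (punctured_iff _) (H eps He)) as [d [Hd K]].
  exists d; split; [exact Hd|]; intros w Hw.
  destruct (Ceq_dec (w - z) 0) as [E|N].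
  + assert (Ew : w = z) by now apply Ceq_minus.
    rewrite Ew; replace (f z - f z - (z - z) * l)%C with (RtoC 0) by ring.
    rewrite Cmod_0; generalize (Cmod_ge_0 (z - z)); nra.
  + specialize (K _ N Hw); replace (z + (w - z))%C with w in K by ring.
    assert (Ph := proj1 (Cmod_gt_0 (w - z)) N).
    replace (f w - f z - (w - z) * l)%C with (((f w - f z) / (w - z) - l) * (w - z))%C by (field; exact N).
    rewrite Cmod_mult; apply Rmult_le_compat_r; lra.
Qed.

Lemma cdiff_plus f g z l m : cdiff f z l -> cdiff g z m -> cdiff (fun w => f w + g w)%C z (l + m)%C.
Proof.
intros Hf Hg; apply cdiff_iff_quotient.
apply (limC_ext _ (fun h : C => (f (z + h) - f z) / h + (g (z + h) - g z) / h)%C).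
- apply punctured_iff; exists 1; split; [lra|]; intros h Hh _; field; exact Hh.
- apply limC_plus; [apply punctured_filter| |]; now apply cdiff_iff_quotient.
Qed.

Lemma cdiff_scal c f z l : cdiff f z l -> cdiff (fun w => c * f w)%C z (c * l).
Proof.
intros Hf; apply cdiff_iff_quotient.
apply (limC_ext _ (fun h : C => c * ((f (z + h) - f z) / h))%C).
- apply punctured_iff; exists 1; split; [lra|]; intros h Hh _; field; exact Hh.
- apply limC_scal; [apply punctured_filter|now apply cdiff_iff_quotient].
Qed.

Lemma cdiff_minus f g z l m : cdiff f z l -> cdiff g z m -> cdiff (fun w => f w - g w)%C z (l - m)%C.
Proof.
intros Hf Hg; apply cdiff_iff_quotient.
apply (limC_ext _ (fun h : C => (f (z + h) - f z) / h - (g (z + h) - g z) / h)%C).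
- apply punctured_iff; exists 1; split; [lra|]; intros h Hh _; field; exact Hh.
- apply limC_minus; [apply punctured_filter| |]; now apply cdiff_iff_quotient.
Qed.

(** * Cauchy's theorem for rectangles *)

Lemma contC_horiz (f : C -> C) t c :
  contCC f (t, c) -> contC (fun t => f (t, c)) t.
Proof.
intros H; apply (continuous_comp (V := Cu) (fun t => (t, c)) f); [|exact H].
apply continuous_C_iff; split; simpl; [apply continuous_id|apply continuous_const].
Qed.

Lemma contC_vert (f : C -> C) t c :
  contCC f (c, t) -> contC (fun t => f (c, t)) t.
Proof.
intros H; apply (continuous_comp (V := Cu) (fun t => (c, t)) f); [|exact H].
apply continuous_C_iff; split; simpl; [apply continuous_const|apply continuous_id].
Qed.

(** The integral of [f z dz] taken counterclockwise along the boundary; the factor [Ci] is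
    [dz = i dt] on the vertical sides. *)
Definition rect_int (f : C -> C) (a b c d : R) : C :=
  (CInt (fun t => f (t, c)) a b - CInt (fun t => f (t, d)) a b
   + Ci * (CInt (fun t => f (b, t)) c d - CInt (fun t => f (a, t)) c d))%C.

Definition cont_on_rect (f : C -> C) a b c d :=
  forall x y, a <= x <= b -> c <= y <= d -> contCC f (x, y).

Lemma ex_horiz f a b c d y a' b' : cont_on_rect f a b c d -> c <= y <= d ->
  a <= a' -> a' <= b' -> b' <= b -> ex_CInt (fun t => f (t, y)) a' b'.
Proof. intros H Hy ? ? ?; apply ex_CInt_cont; [lra|]; intros; apply contC_horiz, H; lra. Qed.

Lemma ex_vert f a b c d x c' d' : cont_on_rect f a b c d -> a <= x <= b ->
  c <= c' -> c' <= d' -> d' <= d -> ex_CInt (fun t => f (x, t)) c' d'.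
Proof. intros H Hy ? ? ?; apply ex_CInt_cont; [lra|]; intros; apply contC_vert, H; lra. Qed.

Lemma rect_int_split f a m b c n d :
  a <= m <= b -> c <= n <= d -> cont_on_rect f a b c d ->
  rect_int f a b c d = (rect_int f a m c n + rect_int f m b c n
                        + rect_int f a m n d + rect_int f m b n d)%C.
Proof.
intros Hm Hn H; unfold rect_int.
assert (Hh : forall y, c <= y <= d ->
  (CInt (fun t => f (t, y)) a m + CInt (fun t => f (t, y)) m b)%C = CInt (fun t => f (t, y)) a b).
{ intros y Hy; apply CInt_Chasles; apply (ex_horiz f a b c d); auto; lra. }
assert (Hv : forall x, a <= x <= b ->
  (CInt (fun t => f (x, t)) c n + CInt (fun t => f (x, t)) n d)%C = CInt (fun t => f (x, t)) c d).
{ intros x Hx; apply CInt_Chasles; apply (ex_vert f a b c d); auto; lra. }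
rewrite <- (Hh c), <- (Hh d), <- (Hv a), <- (Hv b) by lra.
ring.
Qed.

Lemma Cmod_Ci : Cmod Ci = 1.
Proof. transitivity (sqrt 1); [unfold Cmod; f_equal; simpl; ring|apply sqrt_1]. Qed.

Lemma rect_int_bound f a b c d M : a <= b -> c <= d -> cont_on_rect f a b c d ->
  (forall x y, a <= x <= b -> c <= y <= d -> Cmod (f (x, y)) <= M) ->
  Cmod (rect_int f a b c d) <= 2 * ((b - a) + (d - c)) * M.
Proof.
intros Hab Hcd H HM; unfold rect_int.
assert (Hh : forall y, c <= y <= d -> Cmod (CInt (fun t => f (t, y)) a b) <= (b - a) * M).
{ intros y Hy; apply Cmod_CInt_le_const; [lra| |apply (ex_horiz f a b c d); auto; lra].
  intros; now apply HM. }
assert (Hv : forall x, a <= x <= b -> Cmod (CInt (fun t => f (x, t)) c d) <= (d - c) * M).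
{ intros x Hx; apply Cmod_CInt_le_const; [lra| |apply (ex_vert f a b c d); auto; lra].
  intros; now apply HM. }
assert (H1 := Hh c ltac:(lra)); assert (H2 := Hh d ltac:(lra)).
assert (H3 := Hv a ltac:(lra)); assert (H4 := Hv b ltac:(lra)).
le_triangle; rewrite Cmod_mult, Cmod_Ci.
unfold Cminus.
assert (K1 := Cmod_triangle (CInt (fun t => f (t, c)) a b) (- CInt (fun t => f (t, d)) a b)).
assert (K2 := Cmod_triangle (CInt (fun t => f (b, t)) c d) (- CInt (fun t => f (a, t)) c d)).
rewrite Cmod_opp in K1, K2; lra.
Qed.

Lemma rect_int_plus f g a b c d : a <= b -> c <= d ->
  cont_on_rect f a b c d -> cont_on_rect g a b c d ->
  rect_int (fun p => f p + g p)%C a b c d = (rect_int f a b c d + rect_int g a b c d)%C.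
Proof.
intros Hab Hcd Hf Hg.
assert (Hh : forall y, c <= y <= d -> CInt (fun t => f (t, y) + g (t, y))%C a b
  = (CInt (fun t => f (t, y)) a b + CInt (fun t => g (t, y)) a b)%C).
{ intros y Hy; apply CInt_plus;
    [apply (ex_horiz f a b c d)|apply (ex_horiz g a b c d)]; auto; lra. }
assert (Hv : forall x, a <= x <= b -> CInt (fun t => f (x, t) + g (x, t))%C c d
  = (CInt (fun t => f (x, t)) c d + CInt (fun t => g (x, t)) c d)%C).
{ intros x Hx; apply CInt_plus;
    [apply (ex_vert f a b c d)|apply (ex_vert g a b c d)]; auto; lra. }
unfold rect_int; rewrite (Hh c), (Hh d), (Hv a), (Hv b) by lra.
ring.
Qed.

Lemma rect_int_ext f g a b c d : a <= b -> c <= d ->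
  (forall x y, a <= x <= b -> c <= y <= d -> f (x, y) = g (x, y)) ->
  rect_int f a b c d = rect_int g a b c d.
Proof.
intros Hab Hcd H; unfold rect_int.
rewrite (CInt_ext (fun t => f (t, c)) (fun t => g (t, c))),
  (CInt_ext (fun t => f (t, d)) (fun t => g (t, d))),
  (CInt_ext (fun t => f (a, t)) (fun t => g (a, t))),
  (CInt_ext (fun t => f (b, t)) (fun t => g (b, t)));
  [reflexivity|..]; auto; intros; apply H; lra.
Qed.

Lemma CInt_affine (P Q : C) a b :
  CInt (fun t => P + RtoC t * Q)%C a b = (RtoC (b - a) * P + RtoC ((b ^ 2 - a ^ 2) / 2) * Q)%C.
Proof.
apply CInt_unique.
assert (L : forall p q, is_RInt (fun t => p + t * q) a b ((b - a) * p + (b ^ 2 - a ^ 2) / 2 * q)).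
{ intros p q.
  replace ((b - a) * p + (b ^ 2 - a ^ 2) / 2 * q) with
    (minus (b * p + b ^ 2 / 2 * q) (a * p + a ^ 2 / 2 * q))
    by (unfold minus, plus, opp; simpl; field).
  apply (is_RInt_derive (V := RCN) (fun t => t * p + t ^ 2 / 2 * q)).
  - intros x _; auto_derive; [exact I|field].
  - intros x _; apply (ex_derive_continuous (V := RN)); auto_derive; exact I. }
apply is_CInt_comp; split.
- replace (Re _) with ((b - a) * Re P + (b ^ 2 - a ^ 2) / 2 * Re Q) by (unfold Re, Im; simpl; ring).
  eapply is_RInt_ext; [|apply L]; intros; eq_in_R;
    unfold Re, Im; simpl; ring.
- replace (Im _) with ((b - a) * Im P + (b ^ 2 - a ^ 2) / 2 * Im Q) by (unfold Re, Im; simpl; ring).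
  eapply is_RInt_ext; [|apply L]; intros; eq_in_R;
    unfold Re, Im; simpl; ring.
Qed.

(** Allows the first-order expansion of [f] at a point to be subtracted, so that only the remainder
    is integrated. *)
Lemma rect_int_affine (P Q : C) a b c d : a <= b -> c <= d ->
  rect_int (fun p => P + p * Q)%C a b c d = 0%C.
Proof.
intros Hab Hcd; unfold rect_int.
assert (H : forall y, CInt (fun t => P + ((t, y) : C) * Q)%C a b =
  (RtoC (b - a) * (P + Ci * RtoC y * Q) + RtoC ((b ^ 2 - a ^ 2) / 2) * Q)%C).
{ intros y; rewrite <- CInt_affine; apply CInt_ext; [exact Hab|].
  intros; pair_ext; simpl; ring. }
assert (V : forall x, CInt (fun t => P + ((x, t) : C) * Q)%C c d =
  (RtoC (d - c) * (P + RtoC x * Q) + RtoC ((d ^ 2 - c ^ 2) / 2) * (Ci * Q))%C).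
{ intros x; rewrite <- CInt_affine; apply CInt_ext; [exact Hcd|].
  intros; pair_ext; simpl; ring. }
rewrite 2!H, 2!V; pair_ext; simpl; field.
Qed.

Lemma nested_intervals (l u : nat -> R) :
  (forall n, l n <= l (S n)) -> (forall n, u (S n) <= u n) -> (forall n, l n <= u n) ->
  exists x, forall n, l n <= x <= u n.
Proof.
intros Hl Hu H.
assert (Ml : forall n k, l n <= l (n + k)%nat).
{ intros n k; induction k; [rewrite Nat.add_0_r; lra|].
  rewrite Nat.add_succ_r; eapply Rle_trans; [exact IHk|apply Hl]. }
assert (Mu : forall n k, u (n + k)%nat <= u n).
{ intros n k; induction k; [rewrite Nat.add_0_r; lra|].
  rewrite Nat.add_succ_r; eapply Rle_trans; [apply Hu|exact IHk]. }
assert (LU : forall n m, l n <= u m).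
{ intros n m; apply Rle_trans with (l (n + m)%nat); [apply Ml|].
  eapply Rle_trans; [apply H|]; rewrite Nat.add_comm; apply Mu. }
destruct (completeness (fun r => exists n, r = l n)) as [x [Hx1 Hx2]].
- exists (u 0%nat); intros r [n ->]; apply LU.
- now exists (l 0%nat), 0%nat.
- exists x; intros n; split; [apply Hx1; now exists n|].
  apply Hx2; intros r [m ->]; apply LU.
Qed.

(** The threshold is quadratic in the size: halving the sides divides it by four, and the four
    quarters add up to the whole, so one of them exceeds its threshold with the same [eps]. *)
Lemma rect_int_quarter f eps x y w h : 0 <= w -> 0 <= h ->
  cont_on_rect f x (x + w) y (y + h) ->
  eps * (w + h) ^ 2 < Cmod (rect_int f x (x + w) y (y + h)) ->
  exists x' y', (x' = x \/ x' = x + w / 2) /\ (y' = y \/ y' = y + h / 2) /\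
    eps * (w / 2 + h / 2) ^ 2 < Cmod (rect_int f x' (x' + w / 2) y' (y' + h / 2)).
Proof.
intros Hw Hh Hc H.
apply NNPP; intros N.
assert (K : forall x' y', (x' = x \/ x' = x + w / 2) -> (y' = y \/ y' = y + h / 2) ->
  Cmod (rect_int f x' (x' + w / 2) y' (y' + h / 2)) <= eps * (w / 2 + h / 2) ^ 2).
{ intros x' y' Hx' Hy'; apply Rnot_lt_le; intros L; apply N; now exists x', y'. }
rewrite (rect_int_split f x (x + w / 2) (x + w) y (y + h / 2) (y + h)) in H; [|lra|lra|exact Hc].
assert (K1 := K _ _ (or_introl eq_refl) (or_introl eq_refl)).
assert (K2 := K _ _ (or_intror eq_refl) (or_introl eq_refl)).
assert (K3 := K _ _ (or_introl eq_refl) (or_intror eq_refl)).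
assert (K4 := K _ _ (or_intror eq_refl) (or_intror eq_refl)).
replace (x + w / 2 + w / 2) with (x + w) in * by field.
replace (y + h / 2 + h / 2) with (y + h) in * by field.
revert H; apply Rle_not_lt.
le_triangle.
eapply Rle_trans; [apply Rplus_le_compat_r, Cmod_triangle|].
eapply Rle_trans; [apply Rplus_le_compat_r, Rplus_le_compat_r, Cmod_triangle|].
replace (eps * (w + h) ^ 2) with (4 * (eps * (w / 2 + h / 2) ^ 2)) by field.
lra.
Qed.

(** Goursat's bisection: a nonzero integral would stay large, relative to the squared size, along
    nested rectangles, against differentiability at their common point. *)
Lemma Cauchy_rectangle f a b c d : a <= b -> c <= d ->
  (forall x y, a <= x <= b -> c <= y <= d -> exists l, cdiff f (x, y) l) ->
  rect_int f a b c d = 0%C.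
Proof.
intros Hab Hcd Hf.
assert (Hc : cont_on_rect f a b c d).
{ intros x y Hx Hy; destruct (Hf x y Hx Hy) as [l Hl]; now apply (cdiff_continuous f _ l). }
apply Cmod_eq_0, Rle_antisym; [|apply Cmod_ge_0].
apply Rnot_lt_le; intros N.
set (L := (b - a) + (d - c)).
assert (HL : 0 <= L) by (unfold L; lra).
(* The summand 1 makes the initial inequality [eps * L ^ 2 < Cmod (rect_int f a b c d)] strict and
   covers a degenerate rectangle with [L = 0]. *)
set (eps := Cmod (rect_int f a b c d) / (L ^ 2 + 1)).
assert (He : 0 < eps) by (apply Rdiv_lt_0_compat; [lra|nra]).
set (W := fun n => (b - a) / 2 ^ n); set (H := fun n => (d - c) / 2 ^ n).
assert (HW : forall n, W (S n) = W n / 2).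
{ intros n; unfold W; simpl; field; apply pow_nonzero; lra. }
assert (HH : forall n, H (S n) = H n / 2).
{ intros n; unfold H; simpl; field; apply pow_nonzero; lra. }
assert (W0 : forall n, 0 <= W n).
{ intros n; induction n; [unfold W; simpl; lra|rewrite HW; lra]. }
assert (H0 : forall n, 0 <= H n).
{ intros n; induction n; [unfold H; simpl; lra|rewrite HH; lra]. }
set (Bad := fun n (p : R * R) => a <= fst p /\ fst p + W n <= b /\ c <= snd p /\ snd p + H n <= d /\
   eps * (W n + H n) ^ 2 <
   Cmod (rect_int f (fst p) (fst p + W n) (snd p) (snd p + H n))).
set (Near := fun n (p q : R * R) => (fst q = fst p \/ fst q = fst p + W (S n)) /\
       (snd q = snd p \/ snd q = snd p + H (S n))).
(* Badness is a premise inside the existential, so the choice function is total and the recursion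
   carries no proofs. *)
assert (St : forall n p, exists q, Bad n p -> Near n p q /\ Bad (S n) q).
{ intros n p.
  destruct (classic (Bad n p)) as [Bp|]; [|now exists p].
  destruct Bp as [P1 [P2 [P3 [P4 P5]]]].
  destruct (rect_int_quarter f eps (fst p) (snd p) (W n) (H n)) as [x' [y' [Q1 [Q2 Q3]]]];
    auto.
  { intros x y Hx Hy; apply Hc; lra. }
  rewrite <- HW, <- HH in *.
  exists (x', y'); intros _; unfold Near, Bad; simpl.
  assert (W0n := W0 (S n)); assert (H0n := H0 (S n)).
  assert (HWn := HW n); assert (HHn := HH n).
  repeat split; auto; try (destruct Q1; lra); try (destruct Q2; lra). }
set (next := fun n p => proj1_sig (constructive_indefinite_description _ (St n p))).
assert (Hnext : forall n p, Bad n p -> Near n p (next n p) /\ Bad (S n) (next n p)).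
{ intros n p; unfold next; destruct constructive_indefinite_description; auto. }
set (s := fix s n := match n with O => (a, c) | S n => next n (s n) end).
assert (HB : forall n, Bad n (s n)).
{ induction n; [|now apply Hnext].
  unfold Bad, W, H; simpl; unfold Rdiv; rewrite Rinv_1, !Rmult_1_r.
  replace (a + (b - a)) with b by ring; replace (c + (d - c)) with d by ring.
  repeat split; try lra; fold L.
  unfold eps; replace (L ^ 2) with (L * L) by ring.
  apply (Rmult_lt_reg_r (L * L + 1)); [nra|].
  apply Rle_lt_trans with (Cmod (rect_int f a b c d) * (L * L)); [right; field; nra|].
  nra. }
assert (HN : forall n, Near n (s n) (s (S n))) by (intros n; apply Hnext, HB).
destruct (nested_intervals (fun n => fst (s n)) (fun n => fst (s n) + W n)) as [x Hx].
{ intros n; destruct (HN n) as [Q _]; assert (W0n := W0 (S n)); lra. }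
{ intros n; destruct (HN n) as [Q _]; assert (W0n := W0 (S n)); assert (HWn := HW n); lra. }
{ intros n; assert (W0n := W0 n); lra. }
destruct (nested_intervals (fun n => snd (s n)) (fun n => snd (s n) + H n)) as [y Hy].
{ intros n; destruct (HN n) as [_ Q]; assert (W0n := H0 (S n)); lra. }
{ intros n; destruct (HN n) as [_ Q]; assert (W0n := H0 (S n)); assert (HWn := HH n); lra. }
{ intros n; assert (W0n := H0 n); lra. }
assert (Hxy : a <= x <= b /\ c <= y <= d).
{ generalize (Hx O) (Hy O) (HB O); unfold Bad; lra. }
destruct Hxy as [Hxab Hycd].
destruct (Hf x y Hxab Hycd) as [l Hl].
(* The perimeter is [2 * (W n + H n)] and the remainder is at most [eps / 2 * (W n + H n)], so the
   integral is at most [eps * (W n + H n) ^ 2], which badness forbids. *)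
destruct (Hl (eps / 2)) as [dl [Hdl K]]; [lra|].
assert (Hn : exists n, W n + H n < dl).
{ destruct (pow_lt_1_zero (/ 2)) with (y := dl / (L + 1)) as [n Pn].
  - rewrite Rabs_pos_eq; lra.
  - apply Rdiv_lt_0_compat; lra.
  - exists n; specialize (Pn n (le_n n)).
    rewrite pow_inv, Rabs_pos_eq in Pn by (left; apply Rinv_0_lt_compat, pow_lt; lra).
    unfold W, H, Rdiv; rewrite <- Rmult_plus_distr_r; fold L.
    apply (Rmult_lt_compat_r (L + 1)) in Pn; [|lra].
    unfold Rdiv in Pn; rewrite Rmult_assoc, Rinv_l, Rmult_1_r in Pn by lra.
    assert (0 < / 2 ^ n) by (apply Rinv_0_lt_compat, pow_lt; lra).
    nra. }
destruct Hn as [n Hn].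
specialize (Hx n); specialize (Hy n).
destruct (HB n) as [P1 [P2 [P3 [P4 P5]]]].
assert (W0n := W0 n); assert (H0n := H0 n).
revert P5; apply Rle_not_lt.
set (z := (x, y) : C).
set (g := fun p : C => (f z - z * l + p * l)%C).
assert (Cg : forall p, contCC g p).
{ intros p; apply continuous_Cplus; [apply continuous_const|].
  apply continuous_Cmult; [apply continuous_id|apply continuous_const]. }
assert (Cf : cont_on_rect f (fst (s n)) (fst (s n) + W n) (snd (s n)) (snd (s n) + H n)).
{ intros u v Hu Hv; apply Hc; lra. }
assert (E : rect_int f (fst (s n)) (fst (s n) + W n) (snd (s n)) (snd (s n) + H n) =
  rect_int (fun p => f p - g p)%C (fst (s n)) (fst (s n) + W n) (snd (s n)) (snd (s n) + H n)).
{ rewrite <- (Cplus_0_r (rect_int (fun p => f p - g p)%C _ _ _ _)).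
  rewrite <- (rect_int_affine (f z - z * l) l (fst (s n)) (fst (s n) + W n) (snd (s n)) (snd (s n) + H n)) by lra.
  rewrite <- rect_int_plus; [|lra|lra| |].
  - apply rect_int_ext; try lra; intros u v _ _; unfold g; ring.
  - intros u v Hu Hv; apply continuous_Cminus; auto.
  - intros u v _ _; apply Cg. }
rewrite E.
eapply Rle_trans.
- apply rect_int_bound with (M := eps / 2 * (W n + H n)); [lra|lra| |].
  + intros u v Hu Hv; apply continuous_Cminus; auto.
  + intros u v Hu Hv.
    assert (Hm : Cmod ((u, v) - z) <= W n + H n).
    { unfold z; eapply Rle_trans; [apply Cmod_le_abs|]; simpl.
      apply Rplus_le_compat; apply Rabs_le; lra. }
    replace (f (u, v) - g (u, v))%C with (f (u, v) - f z - ((u, v) - z) * l)%C by (unfold g; ring).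
    eapply Rle_trans; [apply K; eapply Rle_lt_trans; [exact Hm|lra]|].
    apply Rmult_le_compat_l; [lra|exact Hm].
- right; field.
Qed.

(** * The maximum principle in the half-plane *)

Lemma cdiff_comp f g z l m :
  cdiff g z m -> cdiff f (g z) l -> cdiff (fun w => f (g w)) z (m * l)%C.
Proof.
intros Hg Hf eps He.
assert (Pl := Cmod_ge_0 l); assert (Pm := Cmod_ge_0 m).
set (e1 := eps / 2 / (Cmod m + 1)).
assert (He1 : 0 < e1) by (apply Rdiv_lt_0_compat; lra).
destruct (Hf e1 He1) as [d1 [Hd1 K1]].
set (e2 := Rmin 1 (eps / 2 / (Cmod l + 1))).
assert (He2 : 0 < e2) by (apply Rmin_pos; [lra|apply Rdiv_lt_0_compat; lra]).
destruct (Hg e2 He2) as [d2 [Hd2 K2]].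
assert (Hd : 0 < d1 / (Cmod m + 1)) by (apply Rdiv_lt_0_compat; lra).
exists (Rmin d2 (d1 / (Cmod m + 1))); split; [now apply Rmin_pos|].
intros w Hw.
assert (Hw1 := Rlt_le_trans _ _ _ Hw (Rmin_l _ _)).
assert (Hw2 := Rlt_le_trans _ _ _ Hw (Rmin_r _ _)).
specialize (K2 w Hw1).
set (h := Cmod (w - z)) in *.
assert (Ph : 0 <= h) by apply Cmod_ge_0.
assert (B1 : Cmod (g w - g z) <= (Cmod m + 1) * h).
{ replace (g w - g z)%C with ((g w - g z - (w - z) * m) + (w - z) * m)%C by ring.
  le_triangle; rewrite Cmod_mult; fold h.
  assert (e2 <= 1) by apply Rmin_l; nra. }
assert (B2 : Cmod (g w - g z) < d1).
{ eapply Rle_lt_trans; [exact B1|].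
  apply (Rmult_lt_compat_l (Cmod m + 1)) in Hw2; [|lra].
  replace ((Cmod m + 1) * (d1 / (Cmod m + 1))) with d1 in Hw2 by (field; lra); lra. }
specialize (K1 _ B2).
replace (f (g w) - f (g z) - (w - z) * (m * l))%C with
  ((f (g w) - f (g z) - (g w - g z) * l) + (g w - g z - (w - z) * m) * l)%C by ring.
le_triangle; rewrite Cmod_mult.
assert (Q1 : e1 * (Cmod m + 1) = eps / 2) by (unfold e1; field; lra).
assert (Q2 : e2 * (Cmod l + 1) <= eps / 2).
{ apply Rle_trans with (eps / 2 / (Cmod l + 1) * (Cmod l + 1)); [|right; field; lra].
  apply Rmult_le_compat_r; [lra|apply Rmin_r]. }
assert (e1 * Cmod (g w - g z) <= eps / 2 * h) by (rewrite <- Q1; nra).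
assert (Cmod (g w - g z - (w - z) * m) * Cmod l <= e2 * h * Cmod l) by nra.
assert (e2 * h * Cmod l <= eps / 2 * h) by nra.
lra.
Qed.

Lemma derivable_0_estimate f l : derivable_pt_lim f 0 l ->
  forall eps, 0 < eps -> exists d, 0 < d /\
    forall h, Rabs h < d -> Rabs (f h - f 0 - l * h) <= eps * Rabs h.
Proof.
intros H eps He; destruct (H eps He) as [d K]; exists d; split; [apply cond_pos|].
intros h Hh; destruct (Req_dec h 0) as [->|N].
{ replace (f 0 - f 0 - l * 0) with 0 by ring; rewrite Rabs_R0; lra. }
specialize (K h N Hh); rewrite Rplus_0_l in K.
replace (f h - f 0 - l * h) with (((f h - f 0) / h - l) * h) by (field; exact N).
rewrite Rabs_mult; apply Rmult_le_compat_r; [apply Rabs_pos|lra].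
Qed.

(** * The complex exponential *)

Definition Cexp (z : C) : C := (exp (Re z) * cos (Im z), exp (Re z) * sin (Im z)).

Lemma Cexp_plus z w : Cexp (z + w) = (Cexp z * Cexp w)%C.
Proof.
unfold Cexp; pair_ext; simpl;
  rewrite exp_plus, ?cos_plus, ?sin_plus; unfold Re, Im; ring.
Qed.

Lemma cdiff_Cexp_0 : cdiff Cexp 0 1.
Proof.
intros eps He.
(* The errors in the real and imaginary parts come out below [3 * (e * h)] and [4 * (e * h)],
   together less than [8 * (e * h)]. *)
set (e := Rmin (eps / 8) 1).
assert (Pe : 0 < e) by (apply Rmin_pos; lra).
assert (E1 : e <= eps / 8) by apply Rmin_l.
assert (E2 : e <= 1) by apply Rmin_r.
assert (D1 : derivable_pt_lim exp 0 1).
{ rewrite <- exp_0; apply derivable_pt_lim_exp. }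
assert (D2 : derivable_pt_lim sin 0 1).
{ rewrite <- cos_0; apply derivable_pt_lim_sin. }
assert (D3 : derivable_pt_lim cos 0 0).
{ replace 0 with (- sin 0) at 2 by (rewrite sin_0; ring); apply derivable_pt_lim_cos. }
destruct (derivable_0_estimate _ _ D1 e Pe) as [d1 [P1 K1]].
destruct (derivable_0_estimate _ _ D2 e Pe) as [d2 [P2 K2]].
destruct (derivable_0_estimate _ _ D3 e Pe) as [d3 [P3 K3]].
exists (Rmin e (Rmin d1 (Rmin d2 d3))); split; [exact (Rmin_pos _ _ Pe (Rmin_pos _ _ P1 (Rmin_pos _ _ P2 P3)))|].
intros w Hw.
replace (w - 0)%C with w in * by ring.
assert (Hw0 := Rlt_le_trans _ _ _ Hw (Rmin_l _ _)).
assert (Hw' := Rlt_le_trans _ _ _ Hw (Rmin_r _ _)).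
assert (Hw1 := Rlt_le_trans _ _ _ Hw' (Rmin_l _ _)).
assert (Hw'' := Rlt_le_trans _ _ _ Hw' (Rmin_r _ _)).
assert (Hw2 := Rlt_le_trans _ _ _ Hw'' (Rmin_l _ _)).
assert (Hw3 := Rlt_le_trans _ _ _ Hw'' (Rmin_r _ _)).
assert (Ra := re_le_Cmod w); assert (Rb := im_le_Cmod w).
set (a := Re w) in *; set (b := Im w) in *; set (h := Cmod w) in *.
specialize (K1 a ltac:(lra)); specialize (K2 b ltac:(lra)); specialize (K3 b ltac:(lra)).
rewrite exp_0 in K1; rewrite sin_0 in K2; rewrite cos_0 in K3.
replace (Cexp w - Cexp 0 - w * 1)%C with
  ((((exp a - 1 - 1 * a) * cos b + (1 + a) * (cos b - 1 - 0 * b)),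
   (exp a - 1 - 1 * a) * sin b + a * sin b + (sin b - 0 - 1 * b)) : C).
2:{ unfold Cexp; pair_ext; simpl; fold a b;
    rewrite exp_0, ?cos_0, ?sin_0; unfold a, b, Re, Im; ring. }
assert (Pa := Rabs_pos a); assert (Pb := Rabs_pos b).
assert (Sb : Rabs (sin b) <= 1) by (apply Rabs_le, SIN_bound).
assert (Cb : Rabs (cos b) <= 1) by (apply Rabs_le, COS_bound).
assert (Sb' : Rabs (sin b) <= 2 * Rabs b).
{ replace (sin b) with ((sin b - 0 - 1 * b) + b) by ring.
  le_triangle; nra. }
assert (Ph : 0 <= h) by lra.
set (x1 := exp a - 1 - 1 * a) in *; set (x2 := sin b - 0 - 1 * b) in *.
set (x3 := cos b - 1 - 0 * b) in *.
assert (A1 : Rabs x1 <= e * h) by nra.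
assert (A2 : Rabs x2 <= e * h) by nra.
assert (A3 : Rabs x3 <= e * h) by nra.
assert (Z1 : Rabs (x1 * cos b + (1 + a) * x3) <= 3 * (e * h)).
{ le_triangle; rewrite !Rabs_mult.
  assert (Rabs (1 + a) <= 2) by (le_triangle; rewrite Rabs_R1; lra).
  assert (Px1 := Rabs_pos x1); assert (Px3 := Rabs_pos x3).
  assert (Rabs x1 * Rabs (cos b) <= e * h) by nra.
  assert (Rabs (1 + a) * Rabs x3 <= 2 * (e * h)) by (apply Rmult_le_compat; try lra; apply Rabs_pos).
  lra. }
assert (Z2 : Rabs (x1 * sin b + a * sin b + x2) <= 4 * (e * h)).
{ le_triangle.
  assert (T := Rabs_triang (x1 * sin b) (a * sin b)); rewrite !Rabs_mult in T.
  assert (Rabs x1 * Rabs (sin b) <= e * h).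
  { assert (Px1 := Rabs_pos x1); nra. }
  assert (Rabs a * Rabs (sin b) <= e * (2 * h)).
  { apply Rmult_le_compat; try apply Rabs_pos; lra. }
  lra. }
eapply Rle_trans; [apply Cmod_le_abs|].
nra.
Qed.

Lemma cdiff_Cexp z : cdiff Cexp z (Cexp z).
Proof.
apply cdiff_iff_quotient.
assert (H := cdiff_scal (Cexp z) _ _ _ cdiff_Cexp_0); apply cdiff_iff_quotient in H.
rewrite Cmult_1_r in H; refine (limC_ext _ _ _ _ _ H).
apply filter_forall; intros h; rewrite Cplus_0_l, (Cexp_plus z h).
replace (Cexp 0) with (RtoC 1); [unfold Cdiv; ring|].
unfold Cexp; simpl; rewrite exp_0, cos_0, sin_0; pair_ext; simpl; ring.
Qed.

(** * Averages of holomorphic functions over circles *)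

Definition hol (f : C -> C) : Prop := forall z, 0 < Im z -> exists l, cdiff f z l.

Definition polar (z : C) (r t : R) : C := (Re z + r * cos t, Im z + r * sin t).

Lemma Im_polar_pos z r t : 0 < r < Im z -> 0 < Im (polar z r t).
Proof. intros H; simpl; generalize (SIN_bound t); nra. Qed.

Lemma Cmod_polar z r t : 0 <= r -> Cmod (polar z r t - z) = r.
Proof.
intros H; unfold Cmod, polar; simpl; unfold Re, Im.
replace (_ + _) with (r ^ 2 * (Rsqr (sin t) + Rsqr (cos t))) by (unfold Rsqr; ring).
rewrite sin2_cos2, Rmult_1_r; now apply sqrt_pow2.
Qed.

Lemma cdiff_translate z w : cdiff (fun w => z + w)%C w 1.
Proof.
intros eps He; exists 1; split; [lra|]; intros u _.
replace (z + u - (z + w) - (u - w) * 1)%C with (RtoC 0) by ring.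
rewrite Cmod_0; generalize (Cmod_ge_0 (u - w)); nra.
Qed.

Lemma contC_polar f z r t : hol f -> 0 < r < Im z -> contC (fun t => f (polar z r t)) t.
Proof.
intros Hf Hr.
apply (continuous_comp (V := Cu) (fun t => polar z r t) f).
- apply continuous_C_iff; split; simpl;
  apply (ex_derive_continuous (V := RN)); auto_derive; exact I.
- destruct (Hf _ (Im_polar_pos z r t Hr)) as [l Hl]; exact (cdiff_continuous _ _ _ Hl).
Qed.

(* [f (z + exp w)] is holomorphic for [Re w < ln (Im z)] and has period [2 i PI],
   so Cauchy's theorem makes its integrals over vertical segments of that length equal. *)
Lemma polar_int_const f z r1 r2 : hol f -> 0 < r1 -> r1 <= r2 -> r2 < Im z ->
  CInt (fun t => f (polar z r1 t)) 0 (2 * PI) = CInt (fun t => f (polar z r2 t)) 0 (2 * PI).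
Proof.
intros Hf H1 H12 H2.
set (g := fun w => f (z + Cexp w)%C).
assert (HPI := PI_RGT_0).
assert (Eg : forall r t, 0 < r -> g (ln r, t) = f (polar z r t)).
{ intros r t Hr; unfold g, Cexp, polar; simpl; rewrite exp_ln by exact Hr; reflexivity. }
assert (Hln : ln r1 <= ln r2).
{ destruct H12 as [H12| ->]; [left; now apply ln_increasing|lra]. }
assert (K : rect_int g (ln r1) (ln r2) 0 (2 * PI) = 0%C).
{ apply Cauchy_rectangle; [exact Hln|lra|].
  intros x y Hx _.
  assert (Hex : exp x <= r2).
  { rewrite <- (exp_ln r2) by lra; destruct (proj2 Hx) as [L| ->]; [left; now apply exp_increasing|lra]. }
  assert (0 < exp x) by apply exp_pos.
  destruct (Hf (z + Cexp (x, y))%C) as [l Hl].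
  { change (0 < Im z + exp x * sin y); generalize (SIN_bound y); nra. }
  eexists.
  apply (cdiff_comp f (fun w => z + Cexp w)%C); [|exact Hl].
  apply (cdiff_comp (fun w => z + w)%C Cexp); [apply cdiff_Cexp|apply cdiff_translate]. }
unfold rect_int in K.
rewrite (CInt_ext (fun t => g (t, 2 * PI)) (fun t => g (t, 0))) in K.
- rewrite (CInt_ext (fun t => g (ln r1, t)) (fun t => f (polar z r1 t))) in K
    by (try lra; intros; apply Eg; lra).
  rewrite (CInt_ext (fun t => g (ln r2, t)) (fun t => f (polar z r2 t))) in K
    by (try lra; intros; apply Eg; lra).
  set (A := CInt _ _ _) in K; set (B1 := CInt _ _ _) in K; set (B2 := CInt _ _ _) in K.
  assert (E : (B1 - B2)%C = 0%C).
  { replace (B1 - B2)%C with (- Ci * (A - A + Ci * (B1 - B2)))%C;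
      [rewrite K; ring|pair_ext; simpl; ring]. }
  change (B2 = B1); transitivity (B1 - (B1 - B2))%C; [ring|rewrite E; ring].
- exact Hln.
- intros t _; unfold g, Cexp; simpl; now rewrite cos_2PI, sin_2PI, cos_0, sin_0.
Qed.

(** The circle integral does not depend on the radius, and on small circles [f] is close to its
    value at the centre. *)
Lemma mean_value f z r : hol f -> 0 < r < Im z ->
  CInt (fun t => f (polar z r t)) 0 (2 * PI) = (RtoC (2 * PI) * f z)%C.
Proof.
intros Hf Hr.
assert (HPI := PI_RGT_0).
apply Ceq_minus, Cmod_eq_0, Rle_antisym; [|apply Cmod_ge_0].
apply le_epsilon; intros eps He; rewrite Rplus_0_l.
destruct (Hf z ltac:(lra)) as [l Hl].
assert (Hc := cdiff_limC _ _ _ Hl).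
assert (Q : 0 < eps / (2 * PI)) by (apply Rdiv_lt_0_compat; lra).
destruct (proj1 (locally_Cmod _ _) (Hc _ Q)) as [d [Hd K]].
set (r' := Rmin r (d / 2)).
assert (Hr' : 0 < r') by (apply Rmin_pos; lra).
assert (r' <= r) by apply Rmin_l.
assert (r' <= d / 2) by apply Rmin_r.
rewrite <- (polar_int_const f z r' r) by (auto; lra).
assert (Ex : ex_CInt (fun t => f (polar z r' t)) 0 (2 * PI)).
{ apply ex_CInt_cont; [lra|]; intros; apply contC_polar; [exact Hf|lra]. }
assert (Ex0 : ex_CInt (fun t => f z) 0 (2 * PI)).
{ apply ex_CInt_cont; [lra|]; intros; apply continuous_const. }
replace (RtoC (2 * PI) * f z)%C with (CInt (fun _ => f z) 0 (2 * PI))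
  by (rewrite CInt_const, Rminus_0_r; reflexivity).
rewrite <- CInt_minus by assumption.
eapply Rle_trans; [apply (Cmod_CInt_le_const _ (eps / (2 * PI)))|].
- lra.
- intros t _; left; apply K; rewrite Cmod_polar; lra.
- now apply (ex_RInt_minus (V := CN)).
- right; field; lra.
Qed.

Lemma RInt_0_nonneg (g : R -> R) a b t0 :
  a < t0 < b -> (forall t, a <= t <= b -> continuous g t) ->
  (forall t, a <= t <= b -> 0 <= g t) -> RInt g a b = 0 -> g t0 = 0.
Proof.
intros Ht Hc Hp H0.
apply Rle_antisym; [|apply Hp; lra].
apply Rnot_lt_le; intros N.
assert (Ex : forall u v, a <= u -> u <= v -> v <= b -> ex_RInt g u v).
{ intros u v ? ? ?; apply (ex_RInt_continuous (V := RCN)); intros t.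
  rewrite Rmin_left, Rmax_right by lra; intros; apply Hc; lra. }
assert (Hc0 : continuous g t0) by (apply Hc; lra).
assert (N2 : 0 < g t0 / 2) by lra.
destruct (proj1 (filterlim_locally _ _) Hc0 (mkposreal _ N2)) as [d K].
set (e := Rmin (d / 2) (Rmin (t0 - a) (b - t0))).
assert (Pd := cond_pos d).
assert (Pe : 0 < e) by (apply Rmin_pos; [lra|apply Rmin_pos; lra]).
assert (e <= d / 2) by apply Rmin_l.
assert (e <= t0 - a) by (eapply Rle_trans; [apply Rmin_r|apply Rmin_l]).
assert (e <= b - t0) by (eapply Rle_trans; [apply Rmin_r|apply Rmin_r]).
assert (Q : forall u v, a <= u -> u <= v -> v <= b -> 0 <= RInt g u v).
{ intros; apply RInt_ge_0; auto; intros; apply Hp; lra. }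
assert (C0 : forall u v w, a <= u -> u <= v -> v <= w -> w <= b -> RInt g u v + RInt g v w = RInt g u w).
{ intros u v w ? ? ? ?; apply (RInt_Chasles (V := RCN)); apply Ex; lra. }
assert (C1 : RInt g a (t0 - e) + RInt g (t0 - e) b = RInt g a b) by (apply C0; lra).
assert (C2 : RInt g (t0 - e) t0 + RInt g t0 b = RInt g (t0 - e) b) by (apply C0; lra).
assert (Q1 : 0 <= RInt g a (t0 - e)) by (apply Q; lra).
assert (Q2 : 0 <= RInt g t0 b) by (apply Q; lra).
assert (Q3 : RInt (fun _ => g t0 / 2) (t0 - e) t0 <= RInt g (t0 - e) t0).
{ apply RInt_le; [lra|apply ex_RInt_const|apply Ex; lra|].
  intros t Htt.
  assert (B := K t); unfold_ball in B.
  assert (B' : Rabs (t + - t0) < d) by (apply Rabs_def1; lra).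
  apply B, Rabs_def2 in B'; lra. }
rewrite RInt_const in Q3; unfold scal in Q3; simpl in Q3; unfold mult in Q3; simpl in Q3.
rewrite <- C1, <- C2 in H0.
nra.
Qed.

(** The average of the nonnegative gap [Re (f z) - Re (f w)] over the circle is zero, so the gap
    vanishes at each of its points. The angle [3 * (PI / 2)] selects the lowest one, which can be
    brought as near to the real line as desired. *)
Lemma max_spreads f z r : hol f -> 0 < Im z ->
  (forall w, 0 < Im w -> Re (f w) <= Re (f z)) -> 0 < r < Im z ->
  Re (f (polar z r (3 * (PI / 2)))) = Re (f z).
Proof.
intros Hf Hz Hmax Hr.
assert (HPI := PI_RGT_0).
assert (Cg : forall t, continuous (fun t => Re (f (polar z r t))) t).
{ intros t; apply (proj1 (continuous_C_iff _ _) (contC_polar f z r t Hf Hr)). }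
assert (E : RInt (fun t => Re (f z) - Re (f (polar z r t))) 0 (2 * PI) = 0).
{ rewrite (RInt_minus (V := RCN) (fun t => Re (f z)) (fun t => Re (f (polar z r t)))).
  - rewrite RInt_const.
    assert (Ex : ex_CInt (fun t => f (polar z r t)) 0 (2 * PI)).
    { apply ex_CInt_cont; [lra|]; intros; now apply contC_polar. }
    rewrite <- (Re_CInt _ _ _ Ex), mean_value by auto.
    unfold minus, plus, opp, scal; simpl; unfold mult, Re; simpl; ring.
  - apply ex_RInt_const.
  - apply (ex_RInt_continuous (V := RCN)); intros; apply Cg. }
apply Rminus_diag_uniq_sym.
apply (RInt_0_nonneg (fun t => Re (f z) - Re (f (polar z r t))) 0 (2 * PI)); [lra| | |exact E].
- intros t _; apply (continuous_minus (V := RN)); [apply continuous_const|apply Cg].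
- intros t _; generalize (Hmax _ (Im_polar_pos z r t Hr)); lra.
Qed.

(** Approach from the open half-plane without any angular restriction, so limits along this filter
    include tangential ones. *)
Definition near_real (x : R) : (mu -> Prop) -> Prop := within Pi_plus (locally ((x, 0) : mu)).
Definition near_infty : (mu -> Prop) -> Prop := within Pi_plus at_infty.

Lemma norm_mu (z : mu) : norm z = Cmod z.
Proof. exact (norm_C z). Qed.

Lemma near_real_iff x (P : mu -> Prop) : near_real x P <->
  exists d, 0 < d /\ forall z : C, 0 < Im z -> Cmod (z - RtoC x) < d -> P z.
Proof.
unfold near_real, within.
rewrite (locally_Cmod (x, 0)); split; intros [d [Hd K]]; exists d; split; try exact Hd.
- intros z Hz Hm; apply K; [exact Hm|exact Hz].
- intros z Hm Hz; apply K; [exact Hz|exact Hm].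
Qed.

Lemma near_infty_iff (P : mu -> Prop) : near_infty P <->
  exists M, forall z : C, 0 < Im z -> M < Cmod z -> P z.
Proof.
unfold near_infty, within, at_infty; split; intros [M K]; exists M.
- intros z Hz Hm; apply (K z); [now rewrite norm_mu|exact Hz].
- intros z Hm Hz; apply K; [exact Hz|now rewrite <- norm_mu].
Qed.

#[local] Instance at_infty_filter (V : NormedModule R_AbsRing) : Filter (@at_infty V).
Proof.
constructor.
- now exists 0.
- intros P Q [M1 H1] [M2 H2]; exists (Rmax M1 M2); intros v Hv; split;
    [apply H1|apply H2]; eapply Rle_lt_trans; try exact Hv; [apply Rmax_l|apply Rmax_r].
- intros P Q H [M K]; exists M; auto.
Qed.

#[local] Instance near_real_filter x : ProperFilter (near_real x).
Proof.
constructor; [|apply within_filter, locally_filter].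
intros P HP; destruct (proj1 (near_real_iff x P) HP) as [d [Hd K]].
exists (x, d / 2); apply K; simpl; [lra|].
lt_Cmod_abs.
rewrite Ropp_0, Rplus_0_r, Rplus_opp_r, Rabs_R0, Rabs_pos_eq; lra.
Qed.

#[local] Instance near_infty_filter : ProperFilter near_infty.
Proof.
constructor; [|apply within_filter, at_infty_filter].
intros P HP; destruct (proj1 (near_infty_iff P) HP) as [M K].
exists (0, Rabs M + 1); apply K; simpl; [generalize (Rabs_pos M); lra|].
eapply Rlt_le_trans; [|apply im_le_Cmod]; simpl.
rewrite (Rabs_pos_eq (Rabs M + 1)); generalize (Rabs_pos M) (Rle_abs M); lra.
Qed.

Lemma limC_unique {T} (F : (T -> Prop) -> Prop) {FF : ProperFilter F} f l m :
  limC F f l -> limC F f m -> l = m.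
Proof.
intros Hl Hm; apply Ceq_minus, Cmod_eq_0, Rle_antisym; [|apply Cmod_ge_0].
apply le_epsilon; intros eps He; rewrite Rplus_0_l.
assert (He2 : 0 < eps / 2) by lra.
destruct (filter_ex _ (filter_and _ _ (Hl _ He2) (Hm _ He2))) as [p [P1 P2]].
replace (l - m)%C with ((f p - m) - (f p - l))%C by ring.
le_triangle; rewrite Cmod_opp; lra.
Qed.

(* Suprema are taken of [atan (Re f)], so that [Re f] need not be known to be bounded. *)
Lemma atan_gap c S : atan c < S -> S <= PI / 2 ->
  exists d, 0 < d /\ forall t, t < c + d -> atan t <= S - d.
Proof.
intros H1 H2.
assert (B := atan_bound c).
set (m := (atan c + S) / 2).
assert (Hm : - PI / 2 < m < PI / 2) by (unfold m; lra).
assert (Hc : c < tan m).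
{ rewrite <- (tan_atan c); apply tan_increasing; unfold m in *; lra. }
assert (P1 : 0 < tan m - c) by lra.
assert (P2 : 0 < S - m) by (unfold m; lra).
exists (Rmin (tan m - c) (S - m)); split; [now apply Rmin_pos|].
intros t Ht.
assert (M1 := Rmin_l (tan m - c) (S - m)); assert (M2 := Rmin_r (tan m - c) (S - m)).
assert (atan t < atan (tan m)) by (apply atan_increasing; lra).
rewrite atan_tan in H by lra; lra.
Qed.

Lemma Re_le_Cmod_diff (a b : C) : Re a <= Re b + Cmod (a - b).
Proof.
assert (H := re_le_Cmod (a - b)%C); apply Rabs_le_between in H; simpl in H.
unfold Re; lra.
Qed.

Section Maximum.
Variable f : C -> C.
Hypothesis Hf : hol f.
Hypothesis Hb : forall x, exists l, limC (near_real x) f l /\ Re l = 0.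
Hypothesis Hi : exists l, limC near_infty f l.

(** A point that is far out and close enough to the real line sees both the limit at infinity and a
    boundary value with zero real part. *)
Lemma Re_lim_infty_0 l : limC near_infty f l -> Re l = 0.
Proof.
intros Hl.
destruct (Req_dec (Re l) 0) as [|N]; [assumption|exfalso].
assert (Pe : 0 < Rabs (Re l) / 3) by (generalize (Rabs_pos_lt _ N); lra).
destruct (proj1 (near_infty_iff _) (Hl _ Pe)) as [M K].
set (x := Rabs M + 2).
assert (Px := Rabs_pos M); assert (Px' := Rle_abs M).
destruct (Hb x) as [lx [Hlx Hx0]].
destruct (proj1 (near_real_iff x _) (Hlx _ Pe)) as [d [Hd Kd]].
set (y := Rmin (d / 2) 1).
assert (Py : 0 < y) by (apply Rmin_pos; lra).
assert (y <= d / 2) by apply Rmin_l.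
assert (y <= 1) by apply Rmin_r.
assert (A1 : Cmod (f (x, y) - l) < Rabs (Re l) / 3).
{ apply K; [exact Py|].
  eapply Rlt_le_trans; [|apply re_le_Cmod]; simpl; unfold x.
  rewrite (Rabs_pos_eq (Rabs M + 2)); lra. }
assert (A2 : Cmod (f (x, y) - lx) < Rabs (Re l) / 3).
{ apply Kd; [exact Py|].
  lt_Cmod_abs.
  rewrite Ropp_0, Rplus_0_r, Rplus_opp_r, Rabs_R0, Rabs_pos_eq; lra. }
assert (A3 : Rabs (Re l) <= Cmod (l - lx)).
{ replace (Re l) with (Re (l - lx)%C) by (simpl; unfold Re in *; lra); apply re_le_Cmod. }
assert (A4 : Cmod (l - lx) <= Cmod (f (x, y) - l) + Cmod (f (x, y) - lx)).
{ replace (l - lx)%C with ((f (x, y) - lx) - (f (x, y) - l))%C by ring.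
  le_triangle; rewrite Cmod_opp; lra. }
lra.
Qed.

(** If the supremum [S] of [atan (Re f)] were not attained, each point of the closed half-plane, and
    infinity, would have a neighbourhood on which [atan (Re f)] stays a fixed amount below [S].
    Compactness makes the amount uniform, which contradicts the choice of [S]. *)
Lemma max_attained z1 : 0 < Im z1 -> 0 < Re (f z1) ->
  exists z0, 0 < Im z0 /\ 0 < Re (f z0) /\ forall w, 0 < Im w -> Re (f w) <= Re (f z0).
Proof.
intros Hz1 Hp.
destruct (completeness (fun r => exists w, 0 < Im w /\ r = atan (Re (f w)))) as [S [Hub Hlub]].
{ exists (PI / 2); intros r [w [_ ->]]; generalize (atan_bound (Re (f w))); lra. }
{ now exists (atan (Re (f z1))), z1. }
assert (Hub' : forall w, 0 < Im w -> atan (Re (f w)) <= S).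
{ intros w Hw; apply Hub; now exists w. }
assert (S0 : atan 0 < S).
{ eapply Rlt_le_trans; [|apply (Hub' _ Hz1)]; now apply atan_increasing. }
assert (S1 : S <= PI / 2).
{ apply Hlub; intros r [w [_ ->]]; generalize (atan_bound (Re (f w))); lra. }
destruct (classic (exists z0, 0 < Im z0 /\ atan (Re (f z0)) = S)) as [[z0 [Hz0 E]]|N].
{ assert (Mx : forall w, 0 < Im w -> Re (f w) <= Re (f z0)).
  { intros w Hw; apply Rnot_lt_le; intros L; apply atan_increasing in L.
    generalize (Hub' w Hw); lra. }
  exists z0; repeat split; [exact Hz0| |exact Mx].
  generalize (Mx _ Hz1); lra. }
exfalso.
(* One number [d] is both the radius of the neighbourhood and the gap, so a lower bound for the
   radii is also one for the gaps. Points with [v < 0] get a radius that avoids the half-plane; thus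
   a full square can be covered. *)
assert (G : forall u v, exists d : posreal, forall w, 0 < Im w ->
   Rabs (Re w - u) < d -> Rabs (Im w - v) < d -> atan (Re (f w)) <= S - d).
{ intros u v.
  destruct (Rtotal_order v 0) as [Hv|[->|Hv]].
  - assert (Pv : 0 < - v) by lra.
    exists (mkposreal _ Pv); intros w Hw _ H; simpl in *.
    apply Rabs_def2 in H; unfold Im in *; lra.
  - destruct (Hb u) as [l [Hl Hl0]].
    destruct (atan_gap 0 S S0 S1) as [d [Hd Kd]].
    destruct (proj1 (near_real_iff u _) (Hl d Hd)) as [d' [Hd' K']].
    assert (Pm : 0 < Rmin d (d' / 2)) by (apply Rmin_pos; lra).
    exists (mkposreal _ Pm); simpl; intros w Hw H1 H2.
    assert (M1 := Rmin_l d (d' / 2)); assert (M2 := Rmin_r d (d' / 2)).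
    apply Rle_trans with (S - d); [|lra].
    apply Kd; rewrite <- Hl0; eapply Rle_lt_trans; [apply (Re_le_Cmod_diff _ l)|].
    apply Rplus_lt_compat_l, K'; [exact Hw|].
    destruct w as [a b]; lt_Cmod_abs; simpl in *.
    unfold Rminus in H1, H2; rewrite Ropp_0, Rplus_0_r in H2 |- *; lra.
  - destruct (Hf (u, v) Hv) as [l Hl].
    assert (Hc := cdiff_limC _ _ _ Hl).
    assert (Hlt : atan (Re (f (u, v))) < S).
    { destruct (Rle_lt_or_eq_dec _ _ (Hub' (u, v) Hv)) as [|E]; [assumption|].
      elim N; now exists (u, v). }
    destruct (atan_gap _ S Hlt S1) as [d [Hd Kd]].
    destruct (proj1 (locally_Cmod (u, v) _) (Hc d Hd)) as [d' [Hd' K']].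
    assert (Pm : 0 < Rmin d (d' / 2)) by (apply Rmin_pos; lra).
    exists (mkposreal _ Pm); simpl; intros w Hw H1 H2.
    assert (M1 := Rmin_l d (d' / 2)); assert (M2 := Rmin_r d (d' / 2)).
    apply Rle_trans with (S - d); [|lra].
    apply Kd; eapply Rle_lt_trans; [apply (Re_le_Cmod_diff _ (f (u, v)))|].
    apply Rplus_lt_compat_l, K'.
    destruct w as [a b]; lt_Cmod_abs; simpl in *.
    unfold Rminus in H1, H2; lra. }
set (delta := fun u v => proj1_sig (constructive_indefinite_description _ (G u v))).
assert (Hdelta : forall u v w, 0 < Im w ->
   Rabs (Re w - u) < delta u v -> Rabs (Im w - v) < delta u v -> atan (Re (f w)) <= S - delta u v).
{ intros u v; unfold delta; destruct constructive_indefinite_description; assumption. }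
destruct Hi as [l Hl].
assert (Hl0 := Re_lim_infty_0 l Hl).
destruct (atan_gap 0 S S0 S1) as [d [Hd Kd]].
destruct (proj1 (near_infty_iff _) (Hl d Hd)) as [M K].
destruct (compactness_value_2d (- M) M (- M) M delta) as [d' Hd'].
assert (Q : S <= S - Rmin d d').
{ apply Hlub; intros r [w [Hw ->]].
  assert (M1 := Rmin_l d d'); assert (M2 := Rmin_r d d').
  destruct (Rlt_le_dec M (Cmod w)) as [L|L].
  - apply Rle_trans with (S - d); [|lra].
    apply Kd; rewrite <- Hl0; eapply Rle_lt_trans; [apply (Re_le_Cmod_diff _ l)|].
    now apply Rplus_lt_compat_l, K.
  - assert (R1 := re_le_Cmod w); assert (R2 := im_le_Cmod w).
    assert (R1' : - M <= Re w <= M) by (apply Rabs_le_between; lra).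
    assert (R2' : - M <= Im w <= M) by (apply Rabs_le_between; lra).
    destruct (NNPP _ (Hd' (Re w) (Im w) R1' R2')) as [u [v [_ [_ [D1 [D2 D3]]]]]].
    assert (D4 := Hdelta u v w Hw D1 D2); lra. }
assert (0 < Rmin d d') by (apply Rmin_pos; [exact Hd|apply cond_pos]).
lra.
Qed.

(** A positive maximum at [z0] would reappear at the lowest point [(Re z0, y)] of the circle of
    radius [Im z0 - y], for arbitrarily small [y], although the boundary limit of [Re f] there is
    0. *)
Lemma Re_nonpos z : 0 < Im z -> Re (f z) <= 0.
Proof.
intros Hz; apply Rnot_lt_le; intros N.
destruct (max_attained z Hz N) as [z0 [H0 [Hp Hm]]].
destruct (Hb (Re z0)) as [l [Hl Hl0]].
destruct (proj1 (near_real_iff _ _) (Hl _ Hp)) as [d [Hd K]].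
set (y := Rmin (d / 2) (Im z0 / 2)).
assert (Py : 0 < y) by (apply Rmin_pos; lra).
assert (y <= d / 2) by apply Rmin_l.
assert (y <= Im z0 / 2) by apply Rmin_r.
assert (E := max_spreads f z0 (Im z0 - y) Hf H0 Hm ltac:(lra)).
assert (Ep : polar z0 (Im z0 - y) (3 * (PI / 2)) = (Re z0, y)).
{ unfold polar.
  assert (S3 : sin (3 * (PI / 2)) = -1).
  { replace (3 * (PI / 2)) with (PI / 2 + PI) by field; rewrite neg_sin, sin_PI2; reflexivity. }
  assert (C3 : cos (3 * (PI / 2)) = 0).
  { replace (3 * (PI / 2)) with (PI / 2 + PI) by field; rewrite neg_cos, cos_PI2; ring. }
  rewrite S3, C3; f_equal; ring. }
rewrite Ep in E.
assert (B : Cmod (f (Re z0, y) - l) < Re (f z0)).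
{ apply K; [exact Py|].
  lt_Cmod_abs.
  rewrite Ropp_0, Rplus_0_r, Rplus_opp_r, Rabs_R0, Rabs_pos_eq; lra. }
assert (R := Re_le_Cmod_diff (f (Re z0, y)) l); lra.
Qed.
End Maximum.

Lemma zero_of_small a : (forall eps, 0 < eps -> Rabs a <= eps) -> a = 0.
Proof.
intros H; destruct (Req_dec a 0) as [|N]; [assumption|].
apply Rabs_pos_lt in N; specialize (H (Rabs a / 2) ltac:(lra)); lra.
Qed.

(** Differentiating [Re f = 0] in the direction [v] gives [Re (v * l) = 0]; the directions [1] and
    [- Ci] yield the real and the imaginary part of [l]. *)
Lemma cdiff_Re_0 f z l : hol f -> (forall w, 0 < Im w -> Re (f w) = 0) ->
  0 < Im z -> cdiff f z l -> l = 0%C.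
Proof.
intros Hf H0 Hz Hl.
assert (K : forall eps v, 0 < eps -> Cmod v <= 1 -> Rabs (Re (v * l)%C) <= eps).
{ intros eps v He Hv.
  destruct (Hl eps He) as [d [Hd K]].
  set (t := Rmin (d / 2) (Im z / 2)).
  assert (Pt : 0 < t) by (apply Rmin_pos; lra).
  assert (t <= d / 2) by apply Rmin_l.
  assert (t <= Im z / 2) by apply Rmin_r.
  assert (Pv := Cmod_ge_0 v).
  assert (E : (z + RtoC t * v - z)%C = (RtoC t * v)%C) by ring.
  specialize (K (z + RtoC t * v)%C).
  rewrite E, Cmod_mult, Cmod_R, (Rabs_pos_eq t) in K by lra.
  assert (Htv : t * Cmod v < d) by nra; specialize (K Htv).
  assert (R := Rle_trans _ _ _ (re_le_Cmod _) K).
  assert (Hw : 0 < Im (z + RtoC t * v)%C).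
  { assert (Iv := im_le_Cmod v); apply Rabs_le_between in Iv.
    replace (Im (z + RtoC t * v)%C) with (Im z + t * Im v) by (simpl; unfold Im; ring); nra. }
  assert (E2 : Re (f (z + RtoC t * v) - f z - RtoC t * v * l)%C = - (t * Re (v * l)%C)).
  { assert (A1 := H0 _ Hw); assert (A2 := H0 _ Hz); unfold Re in *.
    change (fst (f (z + RtoC t * v)%C) + - fst (f z) + - fst (RtoC t * v * l)%C = - (t * fst (v * l)%C)).
    rewrite A1, A2; simpl; ring. }
  rewrite E2, Rabs_Ropp, Rabs_mult, (Rabs_pos_eq t) in R by lra.
  apply (Rmult_le_reg_l t); [exact Pt|].
  assert (0 < eps * t) by now apply Rmult_lt_0_compat.
  nra. }
pair_ext; apply zero_of_small; intros eps He.
- replace (fst l) with (Re (1 * l)%C) by (simpl; ring); apply K; [exact He|rewrite Cmod_1; lra].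
- replace (snd l) with (Re (- Ci * l)%C) by (simpl; ring); apply K; [exact He|rewrite Cmod_opp, Cmod_Ci; lra].
Qed.

Lemma cdiff_0_const f : (forall z, 0 < Im z -> cdiff f z 0) ->
  forall z w, 0 < Im z -> 0 < Im w -> f z = f w.
Proof.
intros H z w Hz Hw.
set (p := fun t : R => (z + RtoC t * (w - z))%C).
assert (E : f (p 0) = f (p 1)).
{ apply (eq_is_derive (V := CN) (fun t => f (p t)) 0 1); [|lra].
  intros t Ht.
  assert (Hp : 0 < Im (p t)).
  { replace (Im (p t)) with ((1 - t) * Im z + t * Im w) by (unfold p; simpl; unfold Im; ring).
    destruct (Req_dec t 0) as [->|]; nra. }
  split; [apply is_linear_scal_l|].
  intros x Hx; assert (Ex : t = x) by (apply (is_filter_lim_locally_unique t x Hx)); subst x.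
  intros eps.
  assert (Pc := Cmod_ge_0 (w - z)).
  assert (He : 0 < eps / (Cmod (w - z) + 1)) by (apply Rdiv_lt_0_compat; [apply cond_pos|lra]).
  destruct (H _ Hp _ He) as [d [Hd K]].
  assert (Pd : 0 < d / (Cmod (w - z) + 1)) by (apply Rdiv_lt_0_compat; lra).
  exists (mkposreal _ Pd); intros s Hs.
  unfold_ball in Hs.
  assert (Eps : (p s - p t)%C = (RtoC (s - t) * (w - z))%C).
  { unfold p; rewrite RtoC_minus; ring. }
  specialize (K (p s)); rewrite Eps, Cmod_mult, Cmod_R in K.
  change (@norm R_AbsRing CN (f (p s) - f (p t) - @scal R_AbsRing CN (s - t)%R (RtoC 0))%C <= eps * Rabs (s - t)).
  rewrite norm_C.
  replace (f (p s) - f (p t) - @scal R_AbsRing CN (s - t)%R (RtoC 0))%C with (f (p s) - f (p t) - RtoC (s - t) * (w - z) * 0)%C.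
  2:{ pair_ext; simpl; unfold scal; simpl; unfold mult; simpl; ring. }
  assert (Hs1 : Rabs (s - t) * Cmod (w - z) < d).
  { apply Rle_lt_trans with (Rabs (s - t) * (Cmod (w - z) + 1)); [generalize (Rabs_pos (s - t)); nra|].
    apply (Rmult_lt_compat_r (Cmod (w - z) + 1)) in Hs; [|lra].
    replace (d / (Cmod (w - z) + 1) * (Cmod (w - z) + 1)) with d in Hs by (field; lra); exact Hs. }
  eapply Rle_trans; [apply (K Hs1)|].
  assert (Q : eps / (Cmod (w - z) + 1) * Cmod (w - z) <= eps).
  { apply Rle_trans with (eps / (Cmod (w - z) + 1) * (Cmod (w - z) + 1)); [nra|right; field; lra]. }
  assert (P := Rabs_pos (s - t)); nra. }
replace z with (p 0) by (unfold p; ring).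
rewrite E; f_equal; unfold p; ring.
Qed.

(** The one-sided bound applied to [f] and to [- f] gives [Re f = 0], hence a vanishing
    derivative. *)
Lemma half_plane_rigidity f : hol f ->
  (forall x, exists l, limC (near_real x) f l /\ Re l = 0) ->
  (exists l, limC near_infty f l) ->
  forall z w, 0 < Im z -> 0 < Im w -> f z = f w.
Proof.
intros Hf Hb Hi.
assert (H0 : forall z, 0 < Im z -> Re (f z) = 0).
{ intros z Hz; apply Rle_antisym; [now apply Re_nonpos|].
  assert (E : forall w, Re (RtoC (-1) * w)%C = - Re w) by (intros w; simpl; unfold Re; ring).
  cut (Re (RtoC (-1) * f z)%C <= 0); [rewrite E; lra|].
  apply (Re_nonpos (fun z => RtoC (-1) * f z)%C); [| | |exact Hz].
  - intros w Hw; destruct (Hf w Hw) as [l Hl]; eexists; exact (cdiff_scal _ _ _ _ Hl).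
  - intros x; destruct (Hb x) as [l [Hl El]]; eexists; split.
    + apply limC_scal; [apply near_real_filter|exact Hl].
    + rewrite E, El; ring.
  - destruct Hi as [l Hl]; eexists; apply limC_scal; [apply near_infty_filter|exact Hl]. }
apply cdiff_0_const; intros z Hz; destruct (Hf z Hz) as [l Hl].
now rewrite (cdiff_Re_0 f z l Hf H0 Hz Hl) in Hl.
Qed.

(** * Dini moduli *)

(** Cauchy's criterion at 0 for the Dini integral, phrased with proper integrals only. *)
Definition small_tail (w : R -> R) (eps delta : R) : Prop :=
  forall a b, 0 < a -> a <= b -> b <= delta ->
    ex_RInt (fun s => w s / s) a b /\ RInt (fun s => w s / s) a b <= eps.

(** What the two moduli have in common. Arguments stay below 1 because [dini] guarantees finite
    values only there. *)
Record dini_modulus (w : R -> R) : Prop := {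
  modulus_mono : forall a b, 0 < a -> a <= b -> b < 1 -> w a <= w b;
  modulus_pos : forall a, 0 < a -> a < 1 -> 0 <= w a;
  modulus_tail : forall eps, 0 < eps -> exists delta, 0 < delta < 1 /\ small_tail w eps delta }.

(** With [c] fixed near 1, the integrals over [[a, c]] and [[b, c]] are both within [eps / 2] of the
    improper one; their difference is the integral over [[a, b]]. *)
Lemma dini_tail (w : R -> Rbar) : dini w -> forall eps, 0 < eps ->
  exists delta, 0 < delta < 1 /\ small_tail (fun s => real (w s)) eps delta.
Proof.
intros [_ [l Hl]] eps He.
assert (He2 : 0 < eps / 2) by lra.
destruct (Hl (ball l (mkposreal _ He2)) (locally_ball l (mkposreal _ He2))) as [Q T HQ HT H].
destruct HQ as [d1 K1]; destruct HT as [d2 K2].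
assert (P1 := cond_pos d1); assert (P2 := cond_pos d2).
set (d := Rmin (d1 / 2) (1 / 4)).
assert (Pd : 0 < d) by (apply Rmin_pos; lra).
assert (D1 : d <= d1 / 2) by apply Rmin_l.
assert (D2 : d <= 1 / 4) by apply Rmin_r.
set (c := 1 - Rmin (d2 / 2) (1 / 2)).
assert (Pc : 0 < Rmin (d2 / 2) (1 / 2)) by (apply Rmin_pos; lra).
assert (Pc1 : Rmin (d2 / 2) (1 / 2) <= d2 / 2) by apply Rmin_l.
assert (Pc2 : Rmin (d2 / 2) (1 / 2) <= 1 / 2) by apply Rmin_r.
assert (Tc : T c).
{ apply K2; unfold c; [|lra].
  unfold_ball.
  apply Rabs_def1; lra. }
assert (Qa : forall a, 0 < a -> a <= d -> Q a).
{ intros a H1 H2; apply K1; [|exact H1].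
  unfold_ball.
  apply Rabs_def1; lra. }
exists d; split; [lra|]; intros a b Ha Hab Hb.
destruct (H a c (Qa a Ha ltac:(lra)) Tc) as [ya [Ia Ba]]; simpl in Ia.
destruct (H b c (Qa b ltac:(lra) ltac:(lra)) Tc) as [yb [Ib Bb]]; simpl in Ib.
assert (Hc : b <= c) by (unfold c; lra).
assert (Ex : ex_RInt (fun s => real (w s) / s) a b).
{ apply (ex_RInt_Chasles_1 (V := RCN) _ a b c); [lra|now exists ya]. }
split; [exact Ex|].
assert (E := RInt_Chasles (V := RCN) _ a b c Ex (ex_intro _ yb Ib)).
rewrite (is_RInt_unique _ _ _ _ Ia), (is_RInt_unique _ _ _ _ Ib) in E.
unfold plus in E; simpl in E.
unfold_ball in Ba; unfold_ball in Bb.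
apply Rabs_def2 in Ba; apply Rabs_def2 in Bb; lra.
Qed.

Lemma lub_ge (E : R -> Prop) x : is_finite (Lub_Rbar E) -> E x -> x <= real (Lub_Rbar E).
Proof.
intros Hf Hx; assert (H := proj1 (Lub_Rbar_correct E) x Hx).
rewrite <- Hf in H; exact H.
Qed.

Lemma lub_mono (E F : R -> Prop) : is_finite (Lub_Rbar E) -> is_finite (Lub_Rbar F) ->
  (forall x, E x -> F x) -> real (Lub_Rbar E) <= real (Lub_Rbar F).
Proof.
intros HE HF H.
assert (L : Rbar_le (Lub_Rbar E) (Lub_Rbar F)).
{ apply (proj2 (Lub_Rbar_correct E)); intros x Hx.
  apply (proj1 (Lub_Rbar_correct F)); auto. }
rewrite <- HE, <- HF in L; exact L.
Qed.

Lemma omega_ge u eps t1 t2 : is_finite (omega u eps) -> Rabs (t1 - t2) <= eps ->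
  Rabs (u t1 - u t2) <= real (omega u eps).
Proof. intros Hf H; apply lub_ge; [exact Hf|now exists t1, t2]. Qed.

Lemma omega_infty_ge u L eps t : is_finite (omega_infty u L eps) -> 1 / eps <= Rabs t ->
  Rabs (u t - L) <= real (omega_infty u L eps).
Proof. intros Hf H; apply lub_ge; [exact Hf|now exists t]. Qed.

Lemma omega_modulus u : dini (omega u) -> dini_modulus (fun s => real (omega u s)).
Proof.
intros H; constructor.
- intros a b Ha Hab Hb; apply lub_mono; try (apply H; lra).
  intros x [t1 [t2 [H1 H2]]]; exists t1, t2; split; [lra|exact H2].
- intros a Ha Ha1; eapply Rle_trans; [apply (Rabs_pos (u 0 - u 0))|].
  apply omega_ge; [apply H; lra|]; rewrite Rminus_diag, Rabs_R0; lra.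
- now apply dini_tail.
Qed.

Lemma omega_infty_modulus u L : dini (omega_infty u L) ->
  dini_modulus (fun s => real (omega_infty u L s)).
Proof.
intros H; constructor.
- intros a b Ha Hab Hb; apply lub_mono; try (apply H; lra).
  intros x [t [H1 H2]]; exists t; split; [|exact H2].
  eapply Rle_trans; [|exact H1]; unfold Rdiv; rewrite !Rmult_1_l.
  now apply Rinv_le_contravar.
- intros a Ha Ha1; eapply Rle_trans; [apply (Rabs_pos (u (1 / a) - L))|].
  apply omega_infty_ge; [apply H; lra|apply Rle_abs].
- now apply dini_tail.
Qed.

Lemma is_RInt_inv a b : 0 < a -> a <= b -> is_RInt (fun s => / s) a b (ln (b / a)).
Proof.
intros Ha Hab; rewrite ln_div by lra.
apply (is_RInt_derive (V := RCN) ln); intros x;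
  rewrite Rmin_left, Rmax_right by lra; intros Hx.
- apply is_derive_Reals, derivable_pt_lim_ln; lra.
- apply continuous_Rinv; lra.
Qed.

(** By monotonicity [w a / s <= w s / s] on [[a, b]]. So a Dini modulus is small even against a
    logarithm, which the middle range in [uniform_dini_infty] requires. *)
Lemma modulus_log w eps delta : dini_modulus w -> 0 < delta < 1 -> small_tail w eps delta ->
  forall a b, 0 < a -> a <= b -> b <= delta -> w a * ln (b / a) <= eps.
Proof.
intros Hw Hd Ht a b Ha Hab Hb.
destruct (Ht a b Ha Hab Hb) as [Ex B].
eapply Rle_trans; [|exact B].
assert (I : is_RInt (fun s => w a * / s) a b (w a * ln (b / a)))
  by (apply (is_RInt_scal (V := RN)), is_RInt_inv; assumption).
rewrite <- (is_RInt_unique (V := RCN) _ _ _ _ I).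
apply RInt_le; [exact Hab|now eexists; exact I|exact Ex|].
intros x Hx; apply Rmult_le_compat_r.
- left; apply Rinv_0_lt_compat; lra.
- apply (modulus_mono w Hw); lra.
Qed.

Lemma modulus_to_0 w : dini_modulus w -> forall eps, 0 < eps ->
  exists delta, 0 < delta < 1 /\ forall a, 0 < a -> a <= delta -> w a <= eps.
Proof.
intros Hw eps He; destruct (modulus_tail w Hw eps He) as [d [Hd Ht]].
assert (E1 : 1 < exp 1) by (generalize (exp_ineq1 1); lra).
assert (Q : d / exp 1 < d).
{ apply (Rmult_lt_reg_r (exp 1)); [lra|].
  unfold Rdiv; rewrite Rmult_assoc, Rinv_l; nra. }
assert (Q0 : 0 < d / exp 1) by (apply Rdiv_lt_0_compat; lra).
exists (d / exp 1); split; [lra|].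
intros a Ha Had.
eapply Rle_trans; [apply (modulus_mono w Hw a (d / exp 1)); lra|].
(* The endpoints have ratio [exp 1], so the logarithm equals 1 and [w] itself is bounded. *)
assert (L := modulus_log w eps d Hw Hd Ht (d / exp 1) d Q0 ltac:(lra) ltac:(lra)).
replace (d / (d / exp 1)) with (exp 1) in L by (field; split; lra).
rewrite ln_exp in L; lra.
Qed.

Lemma omega_continuous u : dini (omega u) -> forall t, continuous u t.
Proof.
intros H t; apply filterlim_locally; intros eps.
destruct (modulus_to_0 _ (omega_modulus u H) (eps / 2)) as [d [Hd K]].
{ generalize (cond_pos eps); lra. }
exists (mkposreal d (proj1 Hd)); intros s Hs.
unfold_ball in Hs; unfold_ball.
eapply Rle_lt_trans.
- apply (omega_ge u d); [apply H; lra|left; exact Hs].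
- generalize (K d (proj1 Hd) (Rle_refl d)) (cond_pos eps); lra.
Qed.

(** * Data on the circle *)

Definition circle_data (u : R -> R) (L phi : R) : R :=
  if Req_EM_T (cos phi) 0 then L else u (tan phi).

Lemma circle_data_tan u L phi : cos phi <> 0 -> circle_data u L phi = u (tan phi).
Proof. intros H; unfold circle_data; destruct Req_EM_T; [contradiction|reflexivity]. Qed.

Lemma circle_data_infty u L phi : cos phi = 0 -> circle_data u L phi = L.
Proof. intros H; unfold circle_data; destruct Req_EM_T; [reflexivity|contradiction]. Qed.

Lemma circle_data_periodic u L phi : circle_data u L (phi + PI) = circle_data u L phi.
Proof.
unfold circle_data; unfold tan; rewrite neg_cos, neg_sin.
destruct (Req_EM_T (cos phi) 0) as [E|E]; destruct (Req_EM_T (- cos phi) 0) as [E'|E'];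
  try reflexivity; try lra.
f_equal; field; lra.
Qed.

Lemma continuous_cos_R x : continuous cos x.
Proof. apply (ex_derive_continuous (V := RN)); auto_derive; exact I. Qed.
Lemma continuous_sin_R x : continuous sin x.
Proof. apply (ex_derive_continuous (V := RN)); auto_derive; exact I. Qed.

Lemma locally_lt (f : R -> R) x c : continuous f x -> f x < c -> locally x (fun y => f y < c).
Proof. intros H Hc; apply (H (fun z => z < c)); now apply open_lt. Qed.
Lemma locally_gt (f : R -> R) x c : continuous f x -> c < f x -> locally x (fun y => c < f y).
Proof. intros H Hc; apply (H (fun z => c < z)); now apply open_gt. Qed.

Lemma circle_data_continuous u L : (forall t, continuous u t) ->
  filterlim u at_infty (locally L) -> forall phi, continuous (circle_data u L) phi.
Proof.
intros Hu HL phi.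
destruct (Req_dec (cos phi) 0) as [E|E].
- intros P HP; rewrite (circle_data_infty _ _ _ E) in HP.
  destruct (HL P HP) as [M K].
  assert (Es : 1 = Rabs (sin phi)).
  { generalize (sin2_cos2 phi); rewrite E; unfold Rsqr; intros S.
    unfold Rabs; destruct Rcase_abs; nra. }
  assert (A1 : locally phi (fun t => 1 / 2 < Rabs (sin t))).
  { apply (locally_gt (fun t => Rabs (sin t))); [|rewrite <- Es; lra].
    apply (continuous_comp sin Rabs); [apply continuous_sin_R|apply continuous_Rabs]. }
  assert (PM := Rabs_pos M).
  (* With [|sin t| > 1 / 2] this forces [|tan t| > |M| + 1], beyond the threshold [M]. *)
  assert (A2 : locally phi (fun t => Rabs (cos t) < / (2 * (Rabs M + 1)))).
  { apply (locally_lt (fun t => Rabs (cos t))).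
    - apply (continuous_comp cos Rabs); [apply continuous_cos_R|apply continuous_Rabs].
    - rewrite E, Rabs_R0; apply Rinv_0_lt_compat; lra. }
  change (locally phi (fun t => P (circle_data u L t))).
  generalize (filter_and _ _ A1 A2); apply filter_imp; intros t [T1 T2].
  destruct (Req_dec (cos t) 0) as [E'|E'].
  + rewrite circle_data_infty by exact E'; now apply locally_singleton.
  + rewrite circle_data_tan by exact E'; apply K.
    change (M < Rabs (tan t)); unfold tan, Rdiv; rewrite Rabs_mult, Rabs_inv.
    assert (Pc := Rabs_pos_lt _ E').
    apply (Rmult_lt_reg_r (Rabs (cos t))); [exact Pc|].
    rewrite Rmult_assoc, Rinv_l, Rmult_1_r by lra.
    apply (Rmult_lt_compat_r (Rabs M + 1)) in T2; [|lra].
    replace (/ (2 * (Rabs M + 1)) * (Rabs M + 1)) with (1 / 2) in T2 by (field; lra).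
    generalize (Rle_abs M); nra.
- assert (A : locally phi (fun t => cos t <> 0)).
  { destruct (Rdichotomy _ _ E) as [N|N].
    - generalize (locally_lt cos phi 0 (continuous_cos_R _) N); apply filter_imp; intros; lra.
    - generalize (locally_gt cos phi 0 (continuous_cos_R _) N); apply filter_imp; intros; lra. }
  apply (continuous_ext_loc (circle_data u L) (fun t => u (tan t))).
  { revert A; apply filter_imp; intros t Ht; symmetry; now apply circle_data_tan. }
  apply (continuous_comp tan u); [|apply Hu].
  apply (ex_derive_continuous (V := RN)).
  eexists; apply is_derive_tan, E.
Qed.

(* Uniformity in the base point [a] is what yields limits along tangential approach. *)
Definition uniform_dini (v : R -> R) (a0 : R) : Prop :=
  forall eps, 0 < eps -> exists delta, 0 < delta <= 1 /\
    forall a, Rabs (a - a0) < delta -> forall rho, 0 < rho -> rho <= delta ->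
      RInt (fun p => (Rabs (v (a + p) - v a) + Rabs (v (a - p) - v a)) / p) rho delta <= eps.

Lemma ex_dini_integral v a r s : (forall t, continuous v t) -> 0 < r -> r <= s ->
  ex_RInt (fun p => (Rabs (v (a + p) - v a) + Rabs (v (a - p) - v a)) / p) r s.
Proof.
intros Hv Hr Hrs; apply (ex_RInt_continuous (V := RCN)).
rewrite Rmin_left, Rmax_right by lra; intros z Hz.
apply (continuous_mult (K := R_AbsRing)); [|apply continuous_Rinv; lra].
assert (A : forall g, continuous g z -> continuous (fun p => Rabs (g p - v a)) z).
{ intros g Hg; apply (continuous_comp (fun p => g p - v a) Rabs); [|apply continuous_Rabs].
  apply (continuous_minus (V := RN)); [exact Hg|apply continuous_const]. }
apply (continuous_plus (V := RN)).
- apply (A (fun p => v (a + p))), (continuous_comp (fun p => a + p) v); [|apply Hv].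
  apply continuous_add_l.
- apply (A (fun p => v (a - p))), (continuous_comp (fun p => a - p) v); [|apply Hv].
  apply continuous_sub_l.
Qed.

(** The measure [dp / p] is invariant under scaling, so a Lipschitz factor [c] shortens the
    admissible range without enlarging the bound. *)
Lemma scaled_tail w eps delta c r s : small_tail w eps delta ->
  0 < c -> 0 < r -> r <= s -> c * s <= delta ->
  ex_RInt (fun p => w (c * p) / p) r s /\ RInt (fun p => w (c * p) / p) r s <= eps.
Proof.
intros Ht Hc Hr Hrs Hs.
destruct (Ht (c * r) (c * s)) as [Ex B]; [nra|nra|exact Hs|].
assert (I := RInt_correct (V := RCN) _ _ _ Ex).
rewrite <- (Rplus_0_r (c * r)), <- (Rplus_0_r (c * s)) in I.
apply (is_RInt_comp_lin (V := RN)) in I.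
assert (J : is_RInt (fun p => w (c * p) / p) r s (RInt (fun s => w s / s) (c * r + 0) (c * s + 0))).
{ eapply is_RInt_ext; [|exact I].
  rewrite Rmin_left, Rmax_right by lra; intros x Hx.
  unfold scal; simpl; unfold mult; simpl; rewrite Rplus_0_r; field; split; lra. }
split; [now eexists; exact J|].
rewrite (is_RInt_unique (V := RCN) _ _ _ _ J), !Rplus_0_r; exact B.
Qed.

Lemma dini_integral_le_tail v a w eps delta K c r s :
  (forall t, continuous v t) -> small_tail w eps delta ->
  0 <= K -> 0 < c -> 0 < r -> r <= s -> c * s <= delta ->
  (forall p, r < p < s -> Rabs (v (a + p) - v a) <= K * w (c * p)) ->
  (forall p, r < p < s -> Rabs (v (a - p) - v a) <= K * w (c * p)) ->
  RInt (fun p => (Rabs (v (a + p) - v a) + Rabs (v (a - p) - v a)) / p) r s <= 2 * K * eps.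
Proof.
intros Hv Ht HK Hc Hr Hrs Hs B1 B2.
destruct (scaled_tail w eps delta c r s Ht Hc Hr Hrs Hs) as [Ex B].
apply Rle_trans with (2 * K * RInt (fun p => w (c * p) / p) r s); [|nra].
assert (I := is_RInt_scal (V := RN) _ _ _ (2 * K) _ (RInt_correct (V := RCN) _ _ _ Ex)).
eapply Rle_trans; [|right; exact (is_RInt_unique (V := RCN) _ _ _ _ I)].
apply RInt_le; [exact Hrs|now apply ex_dini_integral|now eexists; exact I|].
intros p Hp; unfold scal; simpl; unfold mult; simpl.
replace (2 * K * (w (c * p) / p)) with ((2 * K * w (c * p)) / p) by (field; lra).
apply Rmult_le_compat_r; [left; apply Rinv_0_lt_compat; lra|].
specialize (B1 p Hp); specialize (B2 p Hp); lra.
Qed.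

Lemma cos_lipschitz a b : Rabs (cos a - cos b) <= Rabs (a - b).
Proof.
destruct (MVT_gen cos b a (fun x => - sin x)) as [c [_ E]].
- intros x _; auto_derive; [exact I|ring].
- intros x _; apply continuity_pt_filterlim, continuous_cos_R.
- rewrite E, Rabs_mult, Rabs_Ropp.
  assert (Rabs (sin c) <= 1) by (apply Rabs_le, SIN_bound).
  generalize (Rabs_pos (a - b)); nra.
Qed.

Lemma sin_le_abs x : Rabs (sin x) <= Rabs x.
Proof.
destruct (MVT_gen sin 0 x cos) as [c [_ E]].
- intros y _; auto_derive; [exact I|ring].
- intros y _; apply continuity_pt_filterlim, continuous_sin_R.
- rewrite sin_0, !Rminus_0_r in E; rewrite E, Rabs_mult.
  assert (Rabs (cos c) <= 1) by (apply Rabs_le, COS_bound).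
  generalize (Rabs_pos x); nra.
Qed.

Lemma tan_diff a b : cos a <> 0 -> cos b <> 0 -> tan a - tan b = sin (a - b) / (cos a * cos b).
Proof. intros Ha Hb; unfold tan; rewrite sin_minus; field; tauto. Qed.

Lemma uniform_dini_finite u L a0 : dini (omega u) -> filterlim u at_infty (locally L) ->
  0 < cos a0 -> uniform_dini (circle_data u L) a0.
Proof.
intros H HL H0 eps He.
assert (Hw := omega_modulus u H).
assert (Hv := circle_data_continuous u L (omega_continuous u H) HL).
destruct (modulus_tail _ Hw (eps / 2)) as [d [Hd Ht]]; [lra|].
(* A Lipschitz constant of [tan] near [a0]: a difference of tangents is
   [sin (a - b) / (cos a * cos b)], and within [2 * r] of [a0] both cosines exceed [cos a0 / 2]. *)
set (c := 4 / (cos a0 * cos a0)).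
assert (Pc : 0 < c) by (apply Rdiv_lt_0_compat; nra).
set (r := Rmin (cos a0 / 4) (d / c)).
assert (Pr : 0 < r) by (apply Rmin_pos; [lra|apply Rdiv_lt_0_compat; lra]).
assert (R1 : r <= cos a0 / 4) by apply Rmin_l.
assert (R2 : c * r <= d).
{ apply Rle_trans with (c * (d / c)); [|right; field; lra].
  apply Rmult_le_compat_l; [lra|apply Rmin_r]. }
assert (Cos : forall a, Rabs (a - a0) < 2 * r -> cos a0 / 2 < cos a).
{ intros a Ha; assert (B := cos_lipschitz a a0); apply Rabs_le_between in B; lra. }
assert (C1 := COS_bound a0).
exists r; split; [lra|]; intros a Ha rho Hrho Hrho'.
assert (G : forall q, Rabs q <= r -> 0 < Rabs q -> Rabs (circle_data u L (a + q) - circle_data u L a)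
   <= 1 * real (omega u (c * Rabs q))).
{ intros q Hq Hq0; rewrite Rmult_1_l.
  assert (Ca := Cos a ltac:(lra)).
  assert (Hs : Rabs (a + q - a0) < 2 * r).
  { replace (a + q - a0) with ((a - a0) + q) by ring.
    lt_triangle; lra. }
  assert (Cq := Cos (a + q) Hs).
  rewrite !circle_data_tan by lra.
  apply omega_ge; [apply H; nra|].
  rewrite tan_diff by lra; replace (a + q - a) with q by ring.
  unfold Rdiv; rewrite Rabs_mult, Rabs_inv, (Rabs_pos_eq (_ * _)) by nra.
  rewrite Rmult_comm; apply Rmult_le_compat; [left; apply Rinv_0_lt_compat; nra|apply Rabs_pos| |apply sin_le_abs].
  unfold c; replace (4 / (cos a0 * cos a0)) with (/ (cos a0 / 2 * (cos a0 / 2))) by (field; lra).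
  apply Rinv_le_contravar; nra. }
apply Rle_trans with (2 * 1 * (eps / 2)); [|lra].
apply (dini_integral_le_tail _ a (fun s => real (omega u s)) (eps / 2) d 1 c rho r); auto; try lra.
- intros p Hp; specialize (G p); rewrite (Rabs_pos_eq p) in G by lra; apply G; lra.
- intros p Hp; specialize (G (- p)); rewrite Rabs_Ropp, (Rabs_pos_eq p) in G by lra; apply G; lra.
Qed.

Lemma cos_ge_half x : Rabs x <= 1 -> 1 / 2 <= cos x.
Proof.
intros H.
assert (P3 := PI2_3_2).
assert (E : cos x = cos (Rabs x)) by (unfold Rabs; destruct Rcase_abs; [now rewrite cos_neg|reflexivity]).
rewrite E, <- cos_PI3.
generalize (Rabs_pos x); intros; apply cos_decr_1; lra.
Qed.

Lemma sin_ge_half x : Rabs x <= 1 -> Rabs x / 2 <= Rabs (sin x).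
Proof.
intros H.
destruct (MVT_gen sin 0 x cos) as [c [Hc E]].
- intros y _; auto_derive; [exact I|ring].
- intros y _; apply continuity_pt_filterlim, continuous_sin_R.
- rewrite sin_0, !Rminus_0_r in E; rewrite E, Rabs_mult.
  assert (Hc1 : Rabs c <= 1).
  { apply Rabs_le_between in H; apply Rabs_le; unfold Rmin, Rmax in Hc; destruct (Rle_dec 0 x); lra. }
  assert (B := cos_ge_half c Hc1); rewrite (Rabs_pos_eq (cos c)) by lra.
  generalize (Rabs_pos x); nra.
Qed.

Lemma circle_data_at_infty u L b : sin b <> 0 ->
  circle_data u L (b + PI / 2) = u (- (cos b / sin b)).
Proof.
intros H.
assert (C : cos (b + PI / 2) = - sin b) by (rewrite cos_plus, cos_PI2, sin_PI2; ring).
assert (S : sin (b + PI / 2) = cos b) by (rewrite sin_plus, cos_PI2, sin_PI2; ring).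
rewrite circle_data_tan by (rewrite C; lra).
unfold tan; rewrite C, S; f_equal; field; exact H.
Qed.

(** The argument of [u] is [- (cos b / sin b)]; since [cos b >= 1 / 2] and [|sin b| <= eta], its
    modulus is at least [1 / (2 * eta)]. For [b = 0] the datum is [L] itself. *)
Lemma circle_data_near_infty u L b eta : dini (omega_infty u L) ->
  Rabs b <= eta -> 0 < eta -> 2 * eta < 1 ->
  Rabs (circle_data u L (b + PI / 2) - L) <= real (omega_infty u L (2 * eta)).
Proof.
intros H Hb H0 H1.
destruct (Req_dec b 0) as [->|N].
{ rewrite circle_data_infty, Rminus_diag, Rabs_R0 by (rewrite Rplus_0_l; apply cos_PI2).
  apply (modulus_pos _ (omega_infty_modulus u L H)); lra. }
assert (Pb := Rabs_pos_lt _ N).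
assert (S1 := sin_ge_half b ltac:(lra)); assert (S2 := sin_le_abs b).
assert (C1 := cos_ge_half b ltac:(lra)).
assert (Ns : sin b <> 0) by (intros E; rewrite E, Rabs_R0 in S1; lra).
rewrite circle_data_at_infty by exact Ns.
apply omega_infty_ge; [apply H; lra|].
unfold Rdiv; rewrite Rabs_Ropp, Rabs_mult, Rabs_inv, (Rabs_pos_eq (cos b)) by lra.
rewrite Rmult_1_l.
replace (/ (2 * eta)) with (1 / 2 * / eta) by (field; lra).
apply Rmult_le_compat; [lra|left; apply Rinv_0_lt_compat; lra|exact C1|].
apply Rinv_le_contravar; lra.
Qed.

Lemma uniform_dini_infty u L : dini (omega u) -> dini (omega_infty u L) ->
  filterlim u at_infty (locally L) -> uniform_dini (fun b => circle_data u L (b + PI / 2)) 0.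
Proof.
(* For the base point [b], with [B = |b|], the range of [p] is split at [B ^ 3] and [B / 2].
   Below, points [p] apart on the circle are [8 p / B ^ 2] apart on the line; above, both
   points are within [3 p] of infinity; in between, both are within [3 B / 2] of it and
   only the factor [ln (1 / B)] has to be absorbed. *)
intros H H' HL eps He.
assert (Hw := omega_modulus u H); assert (Hw' := omega_infty_modulus u L H').
set (v := fun b => circle_data u L (b + PI / 2)).
assert (Hv : forall t, continuous v t).
{ intros t; apply (continuous_comp (fun b => b + PI / 2) (circle_data u L)).
  - apply continuous_add_r.
  - apply circle_data_continuous; [now apply omega_continuous|exact HL]. }
(* The middle range costs most: the factor [4 * k], times a logarithm up to four times that of
   [modulus_log], uses sixteen tails, that is [eps / 2]. The two outer ranges cost at most [eps / 8]
   each. *)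
destruct (modulus_tail _ Hw (eps / 32)) as [d [Hd Ht]]; [lra|].
destruct (modulus_tail _ Hw' (eps / 32)) as [d' [Hd' Ht']]; [lra|].
(* The scaled arguments are at most [8 * B] below [B ^ 3] and [6 * p] above [B / 2], which must stay
   below [d] and [d']. Taking [r <= r0 * r0] gives [sqrt B <= r0], so [3 * sqrt B] also stays below
   [d']. *)
set (r0 := Rmin (d / 8) (d' / 6)).
set (r := Rmin r0 (r0 * r0)).
assert (Pr0 : 0 < r0) by (apply Rmin_pos; lra).
assert (Pr : 0 < r) by (apply Rmin_pos; nra).
assert (R1 : r0 <= d / 8) by apply Rmin_l.
assert (R2 : r0 <= d' / 6) by apply Rmin_r.
assert (R3 : r <= r0) by apply Rmin_l.
assert (R4 : r <= r0 * r0) by apply Rmin_r.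
exists r; split; [lra|]; intros b Hb rho Hrho Hrho'.
rewrite Rminus_0_r in Hb.
assert (Near : forall q eta, Rabs q <= eta -> 0 < eta -> 2 * eta < 1 ->
  Rabs (v q - L) <= real (omega_infty u L (2 * eta))).
{ intros q eta ? ? ?; now apply circle_data_near_infty. }
set (J := fun r s => RInt (fun p => (Rabs (v (b + p) - v b) + Rabs (v (b - p) - v b)) / p) r s).
change (J rho r <= eps).
assert (JC : forall x y z, 0 < x -> x <= y -> y <= z -> J x z = J x y + J y z).
{ intros x y z ? ? ?; symmetry; apply (RInt_Chasles (V := RCN));
  apply ex_dini_integral; auto; lra. }
assert (JP : forall x y, 0 < x -> x <= y -> 0 <= J x y).
{ intros x y ? ?; apply RInt_ge_0; [assumption|apply ex_dini_integral; auto; lra|].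
  intros p Hp; apply Rmult_le_pos; [|left; apply Rinv_0_lt_compat; lra].
  apply Rplus_le_le_0_compat; apply Rabs_pos. }
assert (Far : forall x y, 0 < x -> x <= y -> Rabs b / 2 <= x -> y <= r -> J x y <= eps / 8).
{ intros x y Hx Hxy Hbx Hy.
  assert (T : forall q p, Rabs q = p -> x < p < y ->
    Rabs (v (b + q) - v b) <= 2 * real (omega_infty u L (6 * p))).
  { intros q p Hq Hp.
    assert (A1 := Near (b + q) (3 * p)); assert (A2 := Near b (3 * p)).
    replace (2 * (3 * p)) with (6 * p) in A1, A2 by ring.
    replace (v (b + q) - v b) with ((v (b + q) - L) + - (v b - L)) by ring.
    le_triangle; rewrite Rabs_Ropp.
    assert (B := Rabs_triang b q).
    specialize (A1 ltac:(lra) ltac:(lra) ltac:(lra)); specialize (A2 ltac:(lra) ltac:(lra) ltac:(lra)); lra. }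
  apply Rle_trans with (2 * 2 * (eps / 32)); [|lra].
  apply (dini_integral_le_tail v b (fun s => real (omega_infty u L s)) (eps / 32) d' 2 6 x y); auto; try lra.
  - intros p Hp; apply T; [apply Rabs_pos_eq; lra|exact Hp].
  - intros p Hp; apply (T (- p)); [rewrite Rabs_Ropp; apply Rabs_pos_eq; lra|exact Hp]. }
destruct (Req_dec b 0) as [Eb|Nb].
{ apply Rle_trans with (eps / 8); [|lra]; apply Far; try lra; rewrite Eb, Rabs_R0; lra. }
set (B := Rabs b) in *.
assert (PB : 0 < B) by now apply Rabs_pos_lt.
assert (PB1 : B < 1 / 6) by lra.
assert (PB3 : 0 < B * B * B) by (apply Rmult_lt_0_compat; nra).
assert (PB4 : B * B * B <= B / 2) by nra.
assert (Close : forall x, 0 < x -> x <= B * B * B -> J x (B * B * B) <= eps / 8).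
{ intros x Hx Hxy.
  (* A difference of cotangents is [sin q] over the product of sines; [|sin b| >= B / 2], and
     [|sin (b + q)| >= B / 4] because [|q| < B / 2]. *)
  set (c := 8 / (B * B)).
  assert (Pc : 0 < c) by (apply Rdiv_lt_0_compat; nra).
  assert (c3 : c * (B * B * B) = 8 * B) by (unfold c; field; lra).
  assert (T : forall q p, Rabs q = p -> x < p < B * B * B ->
    Rabs (v (b + q) - v b) <= 1 * real (omega u (c * p))).
  { intros q p Hq Hp; rewrite Rmult_1_l.
    assert (Q1 : B / 2 <= Rabs (b + q)).
    { assert (W := Rabs_triang (b + q) (- q)); rewrite Rabs_Ropp in W.
      replace (b + q + - q) with b in W by ring; fold B in W; lra. }
    assert (Q2 := Rabs_triang b q); fold B in Q2.
    assert (S1 := sin_ge_half b ltac:(fold B; lra)); fold B in S1.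
    assert (S2 := sin_ge_half (b + q) ltac:(lra)).
    assert (N1 : sin b <> 0) by (intros E; rewrite E, Rabs_R0 in S1; lra).
    assert (N2 : sin (b + q) <> 0) by (intros E; rewrite E, Rabs_R0 in S2; lra).
    unfold v; rewrite !circle_data_at_infty by assumption.
    assert (cp : c * p < 1) by nra.
    apply omega_ge; [apply H; split; [apply Rmult_lt_0_compat; lra|exact cp]|].
    replace (- (cos (b + q) / sin (b + q)) - - (cos b / sin b)) with (sin q / (sin b * sin (b + q))).
    2:{ replace (sin q) with (sin (b + q - b)) by (f_equal; ring).
        rewrite sin_minus; field; tauto. }
    unfold Rdiv; rewrite Rabs_mult, Rabs_inv, (Rabs_mult (sin b)).
    rewrite Rmult_comm; apply Rmult_le_compat;
      [left; apply Rinv_0_lt_compat; nra|apply Rabs_pos| |rewrite <- Hq; apply sin_le_abs].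
    unfold c; replace (8 / (B * B)) with (/ ((B / 2) * (B / 4))) by (field; lra).
    apply Rinv_le_contravar; nra. }
  apply Rle_trans with (2 * 1 * (eps / 32)); [|lra].
  apply (dini_integral_le_tail v b (fun s => real (omega u s)) (eps / 32) d 1 c x (B * B * B)); auto; try lra.
  - intros p Hp; apply T; [apply Rabs_pos_eq; lra|exact Hp].
  - intros p Hp; apply (T (- p)); [rewrite Rabs_Ropp; apply Rabs_pos_eq; lra|exact Hp]. }
assert (Mid : J (B * B * B) (B / 2) <= eps / 2).
{ set (k := real (omega_infty u L (3 * B))).
  assert (Pk : 0 <= k) by (apply (modulus_pos _ Hw'); lra).
  assert (T : forall q p, Rabs q = p -> p <= B / 2 -> Rabs (v (b + q) - v b) <= 2 * k).
  { intros q p Hq Hp.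
    assert (A1 := Near (b + q) (3 * B / 2)); assert (A2 := Near b (3 * B / 2)).
    replace (2 * (3 * B / 2)) with (3 * B) in A1, A2 by field.
    replace (v (b + q) - v b) with ((v (b + q) - L) + - (v b - L)) by ring.
    le_triangle; rewrite Rabs_Ropp.
    assert (W := Rabs_triang b q); fold B in W, A2.
    specialize (A1 ltac:(lra) ltac:(lra) ltac:(lra)); specialize (A2 ltac:(lra) ltac:(lra) ltac:(lra)).
    fold k in A1, A2; lra. }
  assert (I := is_RInt_scal (V := RN) _ _ _ (4 * k) _ (is_RInt_inv _ _ PB3 PB4)).
  apply Rle_trans with (4 * k * ln (B / 2 / (B * B * B))).
  - eapply Rle_trans; [|right; exact (is_RInt_unique (V := RCN) _ _ _ _ I)].
    apply RInt_le; [exact PB4|now apply ex_dini_integral|now eexists; exact I|].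
    intros p Hp; unfold scal; simpl; unfold mult; simpl.
    apply Rmult_le_compat_r; [left; apply Rinv_0_lt_compat; lra|].
    assert (T1 := T p p (Rabs_pos_eq p ltac:(lra)) ltac:(lra)).
    assert (T2 := T (- p) p ltac:(rewrite Rabs_Ropp; apply Rabs_pos_eq; lra) ltac:(lra)).
    replace (b + - p) with (b - p) in T2 by ring; lra.
  - (* The logarithm is at most four times that of the interval [3B, 3 sqrt B],
       on which [omega_infty] is at least [k]. *)
    assert (PsB : 0 < sqrt B) by now apply sqrt_lt_R0.
    assert (sB : sqrt B * sqrt B = B) by (apply sqrt_sqrt; lra).
    assert (sB1 : sqrt B < 1) by nra.
    assert (sBr : sqrt B <= r0).
    { apply Rsqr_incr_0; unfold Rsqr; [rewrite sB; lra|lra|lra]. }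
    assert (M := modulus_log _ (eps / 32) d' Hw' Hd' Ht' (3 * B) (3 * sqrt B)
       ltac:(lra) ltac:(nra) ltac:(lra)); simpl in M; fold k in M.
    assert (E : ln (3 * sqrt B / (3 * B)) = - ln (sqrt B)).
    { rewrite <- ln_Rinv by exact PsB; f_equal; rewrite <- sB at 2; field; lra. }
    rewrite E in M.
    assert (E2 : ln (B / 2 / (B * B * B)) <= 4 * - ln (sqrt B)).
    { apply Rle_trans with (ln (/ (B * B))).
      - apply Rcomplements.ln_le; [apply Rdiv_lt_0_compat; lra|].
        replace (B / 2 / (B * B * B)) with (/ 2 * / (B * B)) by (field; lra).
        assert (0 < / (B * B)) by (apply Rinv_0_lt_compat; nra); lra.
      - rewrite ln_Rinv by nra; rewrite ln_mult by lra.
        assert (E3 : ln B = ln (sqrt B) + ln (sqrt B)) by (rewrite <- ln_mult by lra; f_equal; lra).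
        lra. }
    nra. }
assert (Total : forall x, 0 < x -> x <= B * B * B -> J x r <= eps).
{ intros x Hx Hxy; destruct (Rle_lt_dec (B / 2) r) as [Hr|Hr].
  - rewrite (JC x (B * B * B) r), (JC (B * B * B) (B / 2) r) by lra.
    assert (Z1 := Close x Hx Hxy); assert (Z2 := Far (B / 2) r ltac:(lra) ltac:(lra) ltac:(lra) ltac:(lra)).
    lra.
  - lra. }
destruct (Rle_lt_dec rho (B * B * B)) as [Hs|Hs]; [now apply Total|].
apply Rle_trans with (J (B * B * B) r); [|apply Total; lra].
rewrite (JC (B * B * B) rho r) by lra.
assert (Z := JP (B * B * B) rho PB3 ltac:(lra)); lra.
Qed.

(** * The Schwarz integral in the angular variable *)

(* With [t = tan phi], [kker phi z = (1 + t z) / (t - z)] and [d phi = dt / (t ^ 2 + 1)]. *)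
Definition dker (phi : R) (z : C) : C := (RtoC (sin phi) - z * RtoC (cos phi))%C.
Definition nker (phi : R) (z : C) : C := (RtoC (cos phi) + z * RtoC (sin phi))%C.
Definition kker (phi : R) (z : C) : C := (nker phi z / dker phi z)%C.

#[local] Notation hpi := (PI / 2).
Definition half_turn_int (g : R -> C) : C := CInt g (- hpi) hpi.
Definition pi_i : C := (RtoC PI * Ci)%C.
Definition Fint (v : R -> R) (z : C) : C :=
  (/ pi_i * half_turn_int (fun phi => RtoC (v phi) * kker phi z))%C.
(** The [z]-derivative of [kker phi z] is [/ (dker phi z * dker phi z)], its numerator reducing to 1
    by [sin ^ 2 + cos ^ 2 = 1]. Hence this is the derivative of [Fint], and [F2int] is the second
    one. *)
Definition F1int (v : R -> R) (z : C) : C :=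
  (/ pi_i * half_turn_int (fun phi => RtoC (v phi) * / (dker phi z * dker phi z)))%C.
Definition F2int (v : R -> R) (z : C) : C :=
  (/ pi_i * half_turn_int (fun phi => RtoC (v phi) *
     (2 * RtoC (cos phi) / (dker phi z * dker phi z * dker phi z))))%C.

Lemma half_turn_ext f g : (forall t, f t = g t) -> half_turn_int f = half_turn_int g.
Proof.
intros H; unfold half_turn_int; apply CInt_ext; [generalize PI_RGT_0; lra|auto].
Qed.

Lemma pi_i_neq_0 : pi_i <> 0%C.
Proof.
unfold pi_i; intros E; apply (f_equal Im) in E; simpl in E; generalize PI_RGT_0; lra.
Qed.

Lemma abs_sin_cos_ge_1 x : 1 <= Rabs (sin x) + Rabs (cos x).
Proof.
assert (S := sin2_cos2 x); unfold Rsqr in S.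
assert (P1 := Rabs_pos (sin x)); assert (P2 := Rabs_pos (cos x)).
assert (E1 : Rabs (sin x) * Rabs (sin x) = sin x * sin x)
  by (rewrite <- Rabs_mult; apply Rabs_pos_eq; nra).
assert (E2 : Rabs (cos x) * Rabs (cos x) = cos x * cos x)
  by (rewrite <- Rabs_mult; apply Rabs_pos_eq; nra).
nra.
Qed.

Lemma Im_dker phi z : Im (dker phi z) = - (Im z * cos phi).
Proof. simpl; unfold Im; ring. Qed.

Lemma Re_dker phi z : Re (dker phi z) = sin phi - Re z * cos phi.
Proof. simpl; unfold Re; ring. Qed.

(** The imaginary part of [dker] controls [Im z * |cos phi|], and then [dker] itself controls
    [|sin phi|]; the sine and the cosine are never both small. *)
Lemma dker_lower z : 0 < Im z -> exists c, 0 < c /\ forall phi, c <= Cmod (dker phi z).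
Proof.
intros Hz; assert (Pz := Cmod_ge_0 z).
exists (Im z / (Im z + 1 + Cmod z)); split; [apply Rdiv_lt_0_compat; lra|].
intros phi.
apply (Rmult_le_reg_r (Im z + 1 + Cmod z)); [lra|].
unfold Rdiv; rewrite Rmult_assoc, Rinv_l, Rmult_1_r by lra.
assert (B1 := im_le_Cmod (dker phi z)).
rewrite Im_dker, Rabs_Ropp, Rabs_mult, (Rabs_pos_eq (Im z)) in B1 by lra.
assert (B2 : Rabs (sin phi) <= Cmod (dker phi z) + Cmod z * Rabs (cos phi)).
{ rewrite <- (Cmod_R (sin phi)), <- (Cmod_R (cos phi)), <- Cmod_mult.
  replace (RtoC (sin phi)) with (dker phi z + z * RtoC (cos phi))%C by (unfold dker; ring).
  apply Cmod_triangle. }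
assert (B3 := abs_sin_cos_ge_1 phi).
nra.
Qed.

Lemma dker_neq_0 phi z : 0 < Im z -> dker phi z <> 0%C.
Proof.
intros Hz E; destruct (dker_lower z Hz) as [c [Pc H]].
specialize (H phi); rewrite E, Cmod_0 in H; lra.
Qed.

Lemma continuous_dker {T : UniformSpace} (f : T -> R) (g : T -> C) t :
  continuous f t -> @continuous T Cu g t ->
  @continuous T Cu (fun t => dker (f t) (g t)) t.
Proof.
intros Hf Hg; apply continuous_Cminus; [|apply continuous_Cmult; [exact Hg|]];
  apply continuous_RtoC; [apply (continuous_comp f sin)|apply (continuous_comp f cos)];
  auto; [apply continuous_sin_R|apply continuous_cos_R].
Qed.

Lemma continuous_kker {T : UniformSpace} (f : T -> R) (g : T -> C) t :
  continuous f t -> @continuous T Cu g t -> dker (f t) (g t) <> 0%C ->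
  @continuous T Cu (fun t => kker (f t) (g t)) t.
Proof.
intros Hf Hg N; apply continuous_Cdiv; [|now apply continuous_dker|exact N].
apply continuous_Cplus; [|apply continuous_Cmult; [exact Hg|]];
  apply continuous_RtoC; [apply (continuous_comp f cos)|apply (continuous_comp f sin)];
  auto; [apply continuous_cos_R|apply continuous_sin_R].
Qed.

Lemma contC_kker phi z : 0 < Im z -> contC (fun p => kker p z) phi.
Proof.
intros Hz; apply (continuous_kker (fun p : R => p) (fun _ => z));
  [apply continuous_id|apply continuous_const|now apply dker_neq_0].
Qed.

Lemma contC_dker phi z : contC (fun p => dker p z) phi.
Proof.
apply (continuous_dker (fun p : R => p) (fun _ => z)); [apply continuous_id|apply continuous_const].
Qed.

Lemma contC_inv_dker2 phi z : 0 < Im z -> contC (fun p => / (dker p z * dker p z))%C phi.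
Proof.
intros Hz; apply continuous_Cinv; [apply continuous_Cmult; apply contC_dker|].
apply Cmult_neq_0; now apply dker_neq_0.
Qed.

Lemma contC_dker3 phi z : 0 < Im z ->
  contC (fun p => 2 * RtoC (cos p) / (dker p z * dker p z * dker p z))%C phi.
Proof.
intros Hz; apply continuous_Cdiv.
- apply continuous_Cmult; [apply continuous_const|apply continuous_RtoC, continuous_cos_R].
- apply continuous_Cmult; [apply continuous_Cmult|]; apply contC_dker.
- apply Cmult_neq_0; [apply Cmult_neq_0|]; now apply dker_neq_0.
Qed.

(** * Derivatives of the Schwarz integral *)

Lemma continuous_bounded (v : R -> R) a b : a <= b -> (forall t, a <= t <= b -> continuous v t) ->
  exists M, 0 <= M /\ forall t, a <= t <= b -> Rabs (v t) <= M.
Proof.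
intros L H.
destruct (continuity_ab_maj (fun t => Rabs (v t)) a b L) as [m [Hm _]].
- intros c Hc; apply continuity_pt_filterlim.
  apply (continuous_comp v Rabs); [now apply H|apply continuous_Rabs].
- exists (Rabs (v m)); split; [apply Rabs_pos|exact Hm].
Qed.

(** Differentiation under the integral sign: a second-order remainder of the kernel, uniform in the
    angle, survives integration against the bounded [v]. *)
Lemma cdiff_param (v : R -> R) (ker ker' : R -> C -> C) z :
  0 < Im z -> (forall t, continuous v t) ->
  (forall phi w, 0 < Im w -> contC (fun p => ker p w) phi) ->
  (forall phi, contC (fun p => ker' p z) phi) ->
  (exists K d, 0 <= K /\ 0 < d /\ forall phi w, Cmod (w - z) < d ->
     Cmod (ker phi w - ker phi z - (w - z) * ker' phi z) <= K * Cmod (w - z) ^ 2) ->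
  cdiff (fun w => half_turn_int (fun phi => RtoC (v phi) * ker phi w)%C) z
        (half_turn_int (fun phi => RtoC (v phi) * ker' phi z)%C).
Proof.
intros Hz Hv Hk Hk' [K [d [HK [Hd B]]]] eps He.
assert (HPI := PI_RGT_0).
destruct (continuous_bounded v (- hpi) hpi) as [M [PM HM]]; [lra|intros; apply Hv|].
assert (P1 : 0 <= PI * (M * K)) by (apply Rmult_le_pos; [lra|now apply Rmult_le_pos]).
assert (Pq : 0 < eps / (PI * (M * K) + 1)) by (apply Rdiv_lt_0_compat; lra).
exists (Rmin (Rmin d (Im z)) (eps / (PI * (M * K) + 1))); split; [repeat apply Rmin_pos; lra|].
intros w Hw.
assert (Hw1 := Rlt_le_trans _ _ _ (Rlt_le_trans _ _ _ Hw (Rmin_l _ _)) (Rmin_l _ _)).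
assert (Hw2 := Rlt_le_trans _ _ _ (Rlt_le_trans _ _ _ Hw (Rmin_l _ _)) (Rmin_r _ _)).
assert (Hw3 := Rlt_le_trans _ _ _ Hw (Rmin_r _ _)).
assert (Iw : 0 < Im w).
{ assert (A := im_le_Cmod (w - z)); apply Rabs_le_between in A; simpl in A; unfold Im in *; lra. }
assert (Cv : forall phi, contC (fun p => RtoC (v p)) phi)
  by (intros; apply continuous_RtoC, Hv).
assert (Ex : forall g, (forall phi, contC g phi) -> ex_CInt g (- hpi) hpi)
  by (intros g Hg; apply ex_CInt_cont; [lra|intros; apply Hg]).
unfold half_turn_int.
rewrite <- CInt_mult by (apply Ex; intros; apply continuous_Cmult; auto).
rewrite <- CInt_minus by (apply Ex; intros; apply continuous_Cmult; auto).
rewrite <- CInt_minus.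
2:{ apply Ex; intros; apply continuous_Cminus; apply continuous_Cmult; auto. }
2:{ apply Ex; intros; apply continuous_Cmult; [apply continuous_const|apply continuous_Cmult; auto]. }
set (h := Cmod (w - z)) in *.
assert (Ph : 0 <= h) by apply Cmod_ge_0.
eapply Rle_trans; [apply (Cmod_CInt_le_const _ (M * (K * h ^ 2)))|].
- lra.
- intros t Ht.
  replace (RtoC (v t) * ker t w - RtoC (v t) * ker t z - (w - z) * (RtoC (v t) * ker' t z))%C
    with (RtoC (v t) * (ker t w - ker t z - (w - z) * ker' t z))%C by ring.
  rewrite Cmod_mult, Cmod_R.
  apply Rmult_le_compat; [apply Rabs_pos|apply Cmod_ge_0|now apply HM|now apply B].
- apply Ex; intros; apply continuous_Cminus; [apply continuous_Cminus|];
    apply continuous_Cmult; auto; try apply continuous_const; apply continuous_Cmult; auto.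
- replace ((hpi - - hpi) * (M * (K * h ^ 2))) with (PI * (M * K) * h * h) by field.
  apply Rmult_le_compat_r; [exact Ph|].
  apply (Rmult_lt_compat_r (PI * (M * K) + 1)) in Hw3; [|lra].
  replace (eps / (PI * (M * K) + 1) * (PI * (M * K) + 1)) with eps in Hw3 by (field; lra).
  nra.
Qed.

Lemma dker_shift phi z w : dker phi w = (dker phi z - (w - z) * RtoC (cos phi))%C.
Proof. unfold dker; ring. Qed.

Lemma dker_lower_near z : 0 < Im z -> exists c, 0 < c /\ forall phi w, Cmod (w - z) < c ->
  c <= Cmod (dker phi z) /\ c <= Cmod (dker phi w).
Proof.
intros Hz; destruct (dker_lower z Hz) as [c [Pc H]].
exists (c / 2); split; [lra|]; intros phi w Hw; specialize (H phi); split; [lra|].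
assert (T := Cmod_triangle (dker phi w) ((w - z) * RtoC (cos phi))).
replace (dker phi w + (w - z) * RtoC (cos phi))%C with (dker phi z) in T
  by (rewrite (dker_shift phi z w); ring).
rewrite Cmod_mult, Cmod_R in T.
assert (Rabs (cos phi) <= 1) by (apply Rabs_le, COS_bound).
generalize (Cmod_ge_0 (w - z)) (Rabs_pos (cos phi)); nra.
Qed.

Lemma neq_0_of_Cmod c z : 0 < c -> c <= Cmod z -> z <> 0%C.
Proof. intros Hc H E; rewrite E, Cmod_0 in H; lra. Qed.

Lemma Cmod_inv_le c z : 0 < c -> c <= Cmod z -> Cmod (/ z) <= / c.
Proof.
intros Hc H; rewrite Cmod_inv by now apply (neq_0_of_Cmod c).
now apply Rinv_le_contravar.
Qed.

Lemma sincos_C phi : (RtoC (sin phi) * RtoC (sin phi) + RtoC (cos phi) * RtoC (cos phi))%C = 1%C.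
Proof.
rewrite <- !RtoC_mult, <- RtoC_plus; f_equal; exact (sin2_cos2 phi).
Qed.

Lemma cdiff_Fint v z : 0 < Im z -> (forall t, continuous v t) -> cdiff (Fint v) z (F1int v z).
Proof.
intros Hz Hv; apply cdiff_scal.
apply (cdiff_param v kker (fun p z => / (dker p z * dker p z))%C); auto.
- intros; now apply contC_kker.
- intros; now apply contC_inv_dker2.
- destruct (dker_lower_near z Hz) as [c [Pc H]].
  exists (/ c * / c * / c), c.
  assert (Pic : 0 < / c) by now apply Rinv_0_lt_compat.
  split; [left; repeat apply Rmult_lt_0_compat; exact Pic|split; [exact Pc|]].
  intros phi w Hw; destruct (H phi w Hw) as [B1 B2].
  assert (N1 := neq_0_of_Cmod _ _ Pc B1); assert (N2 := neq_0_of_Cmod _ _ Pc B2).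
  (* The remainder is explicit, [(w - z) ^ 2] times [cos phi] over three factors [dker], whence the
     constant [/ c * / c * / c]. *)
  replace (kker phi w - kker phi z - (w - z) * / (dker phi z * dker phi z))%C with
   ((w - z) * (w - z) * RtoC (cos phi) * (/ dker phi z * / dker phi z * / dker phi w))%C.
  2:{ unfold kker.
      assert (E1 : (nker phi w * dker phi z - nker phi z * dker phi w)%C = (w - z)%C).
      { unfold nker, dker.
        transitivity ((w - z) * (RtoC (sin phi) * RtoC (sin phi) + RtoC (cos phi) * RtoC (cos phi)))%C;
          [ring|rewrite sincos_C; ring]. }
      assert (E2 : (dker phi z - dker phi w)%C = ((w - z) * RtoC (cos phi))%C) by (unfold dker; ring).
      transitivity ((w - z) * ((w - z) * RtoC (cos phi)) / (dker phi z * dker phi z * dker phi w))%C;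
        [field; tauto|].
      rewrite <- E2.
      transitivity ((nker phi w * dker phi z - nker phi z * dker phi w) / (dker phi z * dker phi w)
        - (w - z) / (dker phi z * dker phi z))%C; [rewrite E1|]; field; tauto. }
  rewrite !Cmod_mult, Cmod_R.
  assert (Rabs (cos phi) <= 1) by (apply Rabs_le, COS_bound).
  assert (I1 := Cmod_inv_le _ _ Pc B1); assert (I2 := Cmod_inv_le _ _ Pc B2).
  assert (J1 := Cmod_ge_0 (/ dker phi z)); assert (J2 := Cmod_ge_0 (/ dker phi w)).
  set (h := Cmod (w - z)) in *.
  replace (/ c * / c * / c * h ^ 2) with (h * h * 1 * (/ c * / c * / c)) by ring.
  assert (Ph : 0 <= h) by apply Cmod_ge_0.
  assert (0 <= h * h) by nra.
  apply Rmult_le_compat; [apply Rmult_le_pos; [lra|apply Rabs_pos]| | |].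
  + repeat apply Rmult_le_pos; assumption.
  + apply Rmult_le_compat; try lra; apply Rabs_pos.
  + apply Rmult_le_compat; [now apply Rmult_le_pos|assumption| |assumption].
    now apply Rmult_le_compat.
Qed.

Lemma cdiff_F1int v z : 0 < Im z -> (forall t, continuous v t) -> cdiff (F1int v) z (F2int v z).
Proof.
intros Hz Hv; apply cdiff_scal.
apply (cdiff_param v (fun p z => / (dker p z * dker p z))%C
  (fun p z => 2 * RtoC (cos p) / (dker p z * dker p z * dker p z))%C); auto.
- intros; now apply contC_inv_dker2.
- intros; now apply contC_dker3.
- destruct (dker_lower_near z Hz) as [c [Pc H]].
  exists (3 * (/ c * / c * (/ c * / c))), c.
  assert (Pic : 0 < / c) by now apply Rinv_0_lt_compat.
  assert (Pcc : 0 < / c * / c) by nra.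
  split; [nra|split; [exact Pc|]].
  intros phi w Hw; destruct (H phi w Hw) as [B1 B2].
  assert (N1 := neq_0_of_Cmod _ _ Pc B1); assert (N2 := neq_0_of_Cmod _ _ Pc B2).
  set (k := RtoC (cos phi)).
  set (a := dker phi z) in *.
  assert (Eb : dker phi w = (a - (w - z) * k)%C) by apply dker_shift.
  set (b := dker phi w) in *.
  replace (/ (b * b) - / (a * a) - (w - z) * (2 * k / (a * a * a)))%C with
    (((w - z) * k) * ((w - z) * k) * (/ a * / a * (/ b * / b) + 2 * (/ a * / a * (/ a * / b))))%C.
  2:{ assert (E : ((w - z) * k)%C = (a - b)%C) by (rewrite Eb; ring).
      replace ((w - z) * (2 * k / (a * a * a)))%C with (2 * ((w - z) * k) / (a * a * a))%C by (field; exact N1).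
      rewrite E; field; tauto. }
  rewrite !Cmod_mult.
  assert (Kk : Cmod k <= 1) by (unfold k; rewrite Cmod_R; apply Rabs_le, COS_bound).
  assert (Pk := Cmod_ge_0 k).
  assert (I1 := Cmod_inv_le _ _ Pc B1); assert (I2 := Cmod_inv_le _ _ Pc B2).
  assert (J1 := Cmod_ge_0 (/ a)); assert (J2 := Cmod_ge_0 (/ b)).
  set (h := Cmod (w - z)) in *.
  assert (Ph : 0 <= h) by apply Cmod_ge_0.
  assert (T : Cmod (/ a * / a * (/ b * / b) + 2 * (/ a * / a * (/ a * / b))) <= 3 * (/ c * / c * (/ c * / c))).
  { le_triangle; rewrite !Cmod_mult.
    replace (Cmod 2) with 2 by (rewrite Cmod_R, Rabs_pos_eq; lra).
    assert (Q : forall x y, 0 <= x -> x <= / c -> 0 <= y -> y <= / c -> x * y <= / c * / c)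
      by (intros; apply Rmult_le_compat; lra).
    assert (Q1 := Q _ _ J1 I1 J1 I1); assert (Q2 := Q _ _ J2 I2 J2 I2); assert (Q3 := Q _ _ J1 I1 J2 I2).
    assert (Cmod (/ a) * Cmod (/ a) * (Cmod (/ b) * Cmod (/ b)) <= / c * / c * (/ c * / c))
      by (apply Rmult_le_compat; nra).
    assert (Cmod (/ a) * Cmod (/ a) * (Cmod (/ a) * Cmod (/ b)) <= / c * / c * (/ c * / c))
      by (apply Rmult_le_compat; nra).
    lra. }
  assert (Hk : h * Cmod k <= h).
  { rewrite <- (Rmult_1_r h) at 2; now apply Rmult_le_compat_l. }
  assert (S : h * Cmod k * (h * Cmod k) <= h ^ 2).
  { replace (h ^ 2) with (h * h) by ring.
    apply Rmult_le_compat; try assumption; now apply Rmult_le_pos. }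
  replace (3 * (/ c * / c * (/ c * / c)) * h ^ 2) with (h ^ 2 * (3 * (/ c * / c * (/ c * / c)))) by ring.
  apply Rmult_le_compat; [|apply Cmod_ge_0|exact S|exact T].
  repeat apply Rmult_le_pos; assumption.
Qed.

(** * Total masses of the kernels *)

Lemma is_derive_C (f : R -> C) t (l : C) :
  is_derive (fun t => Re (f t)) t (Re l) -> is_derive (fun t => Im (f t)) t (Im l) ->
  is_derive (V := CN) f t l.
Proof.
intros H1 H2.
apply (is_derive_ext (V := CN) (fun t => (Re (f t), Im (f t)))).
{ intros s; symmetry; apply surjective_pairing. }
assert (E : l = (Re l, Im l)) by apply surjective_pairing.
split; [apply is_linear_scal_l|].
intros x Hx eps.
assert (Ex : t = x) by (apply (is_filter_lim_locally_unique t x Hx)); subst x.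
assert (Pe : 0 < eps / 2) by (generalize (cond_pos eps); lra).
destruct H1 as [_ H1]; destruct H2 as [_ H2].
generalize (filter_and _ _ (H1 t Hx (mkposreal _ Pe)) (H2 t Hx (mkposreal _ Pe))).
apply filter_imp; intros s [K1 K2].
rewrite norm_C.
eapply Rle_trans; [apply Cmod_le_abs|].
simpl in K1, K2.
apply Rle_trans with (eps / 2 * Rabs (s - t) + eps / 2 * Rabs (s - t)).
- apply Rplus_le_compat; [exact K1|exact K2].
- right; change (eps / 2 * Rabs (s - t) + eps / 2 * Rabs (s - t) = eps * Rabs (s - t)); field.
Qed.

Lemma C_opp_real_div (c : R) (d : C) :
  (- (RtoC c / d))%C =
  (- (c * Re d / (Re d ^ 2 + Im d ^ 2)), c * Im d / (Re d ^ 2 + Im d ^ 2)).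
Proof.
destruct d as [p r]; pair_ext; simpl; unfold Rdiv; ring.
Qed.

Lemma C_inv_sqr (d : C) : d <> 0%C ->
  (/ (d * d))%C = ((Re d ^ 2 - Im d ^ 2) / (Re d ^ 2 + Im d ^ 2) ^ 2,
                   - (2 * Re d * Im d) / (Re d ^ 2 + Im d ^ 2) ^ 2).
Proof.
intros N; apply Cmod2_pos in N; destruct d as [p r]; simpl in N.
assert (N' : (p * p - r * r) * ((p * p - r * r) * 1) + (p * r + r * p) * ((p * r + r * p) * 1) <> 0).
{ replace ((p * p - r * r) * ((p * p - r * r) * 1) + (p * r + r * p) * ((p * r + r * p) * 1))
    with ((p * (p * 1) + r * (r * 1)) * (p * (p * 1) + r * (r * 1))) by ring; nra. }
pair_ext; simpl; field; split; lra.
Qed.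

Lemma is_derive_Re_cos_div (a b x : R) : (sin x - a * cos x) ^ 2 + (- (b * cos x)) ^ 2 <> 0 ->
  is_derive (fun t => - (cos t * (sin t - a * cos t) / ((sin t - a * cos t) ^ 2 + (- (b * cos t)) ^ 2))) x
    (((sin x - a * cos x) ^ 2 - (- (b * cos x)) ^ 2) / ((sin x - a * cos x) ^ 2 + (- (b * cos x)) ^ 2) ^ 2).
Proof.
intros H.
assert (S := sin2_cos2 x); unfold Rsqr in S.
auto_derive; [simpl in H; lra|].
(* The identity holds only modulo [sin ^ 2 + cos ^ 2 = 1]. Multiplying the claimed derivative by
   this sum turns it into an identity of rational functions in free variables [s] and [c]. *)
apply (f_equal (fun k => k *
  (((sin x - a * cos x) ^ 2 - (- (b * cos x)) ^ 2) / ((sin x - a * cos x) ^ 2 + (- (b * cos x)) ^ 2) ^ 2))) in S.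
rewrite Rmult_1_l in S; rewrite <- S; clear S.
set (s := sin x) in *. set (c := cos x) in *.
simpl; field; simpl in H; lra.
Qed.
Lemma is_derive_Im_cos_div (a b x : R) : (sin x - a * cos x) ^ 2 + (- (b * cos x)) ^ 2 <> 0 ->
  is_derive (fun t => cos t * - (b * cos t) / ((sin t - a * cos t) ^ 2 + (- (b * cos t)) ^ 2)) x
 (- (2 * (sin x - a * cos x) * - (b * cos x)) / ((sin x - a * cos x) ^ 2 + (- (b * cos x)) ^ 2) ^ 2).
Proof.
intros H.
assert (S := sin2_cos2 x); unfold Rsqr in S.
auto_derive; [simpl in H; lra|].
apply (f_equal (fun k => k *
  (- (2 * (sin x - a * cos x) * - (b * cos x)) / ((sin x - a * cos x) ^ 2 + (- (b * cos x)) ^ 2) ^ 2))) in S.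
rewrite Rmult_1_l in S; rewrite <- S; clear S.
set (s := sin x) in *. set (c := cos x) in *.
simpl; field; simpl in H; lra.
Qed.

(** In the variable [t = tan phi] this is the antiderivative [- 1 / (t - z)] of [(t - z)^-2];
    written with [dker] it stays regular where the cosine vanishes. *)
Lemma is_derive_cos_div_dker z x : 0 < Im z ->
  is_derive (V := CN) (fun phi => - (RtoC (cos phi) / dker phi z))%C x
    (/ (dker x z * dker x z))%C.
Proof.
intros Hz; assert (N := dker_neq_0 x z Hz).
assert (N' := Cmod2_pos _ N).
rewrite (C_inv_sqr _ N); rewrite Re_dker, Im_dker in *.
set (a := Re z) in *; set (b := Im z) in *.
apply (is_derive_ext (V := CN) (fun t =>
  (- (cos t * (sin t - a * cos t) / ((sin t - a * cos t) ^ 2 + (- (b * cos t)) ^ 2)),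
   cos t * - (b * cos t) / ((sin t - a * cos t) ^ 2 + (- (b * cos t)) ^ 2)) : C)).
{ intros t; rewrite C_opp_real_div, Re_dker, Im_dker; reflexivity. }
assert (P : (sin x - a * cos x) ^ 2 + (- (b * cos x)) ^ 2 <> 0) by lra.
apply is_derive_C; [now apply is_derive_Re_cos_div|now apply is_derive_Im_cos_div].
Qed.

(** The antiderivative carries the factor [cos phi], which vanishes at both ends. So constants may
    be subtracted from the datum without changing [F1int]. *)
Lemma int_inv_dker2 z : 0 < Im z -> half_turn_int (fun phi => / (dker phi z * dker phi z))%C = 0%C.
Proof.
intros Hz; unfold half_turn_int.
assert (I : is_CInt (fun phi => / (dker phi z * dker phi z))%C (- hpi) hpi
  ((fun phi => - (RtoC (cos phi) / dker phi z))%C hpi - (fun phi => - (RtoC (cos phi) / dker phi z))%C (- hpi)%R)%C).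
{ apply (is_RInt_derive (V := CCN) (fun phi => - (RtoC (cos phi) / dker phi z))%C).
  - intros x _; now apply is_derive_cos_div_dker.
  - intros x _; now apply contC_inv_dker2. }
rewrite (CInt_unique _ _ _ _ I).
rewrite cos_neg, cos_PI2; unfold Cdiv; ring.
Qed.

(** For the constant datum 1 the derivative [F1int] is zero, so the integral does not depend on [z];
    at [z = Ci] the kernel is identically [Ci]. *)
Lemma half_turn_kker z : 0 < Im z -> half_turn_int (fun phi => kker phi z) = pi_i.
Proof.
intros Hz.
assert (HPI := PI_RGT_0).
assert (E0 : forall w, 0 < Im w -> cdiff (Fint (fun _ => 1)) w 0).
{ intros w Hw.
  replace (RtoC 0) with (F1int (fun _ => 1) w).
  - apply cdiff_Fint; [exact Hw|intros; apply continuous_const].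
  - unfold F1int.
    replace (half_turn_int _) with (half_turn_int (fun phi => / (dker phi w * dker phi w))%C).
    + rewrite int_inv_dker2 by exact Hw; ring.
    + apply half_turn_ext; intros; ring. }
assert (Hi : 0 < Im Ci) by (simpl; lra).
assert (E1 := cdiff_0_const _ E0 z Ci Hz Hi).
assert (E2 : forall w, Fint (fun _ => 1) w = (/ pi_i * half_turn_int (fun phi => kker phi w))%C).
{ intros w; unfold Fint; f_equal; apply half_turn_ext; intros; ring. }
rewrite !E2 in E1.
assert (E3 : half_turn_int (fun phi => kker phi Ci) = pi_i).
{ unfold half_turn_int; rewrite (CInt_ext _ (fun _ => Ci)); [|lra|].
  - rewrite CInt_const; unfold pi_i; do 2 f_equal; field.
  - intros t _; unfold kker.
    replace (nker t Ci) with (Ci * dker t Ci)%C.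
    + field; now apply dker_neq_0.
    + unfold nker, dker; pair_ext; simpl; ring. }
rewrite E3 in E1.
replace (half_turn_int (fun phi => kker phi z)) with
  (pi_i * (/ pi_i * half_turn_int (fun phi => kker phi z)))%C by (field; apply pi_i_neq_0).
rewrite E1; field; apply pi_i_neq_0.
Qed.

Lemma Im_Cdiv (n d : C) : Im (n / d)%C = (Im n * Re d - Re n * Im d) / (Re d ^ 2 + Im d ^ 2).
Proof. destruct n as [a b], d as [p r]; simpl; unfold Rdiv; ring. Qed.

(** This is the Poisson kernel. It is also the modulus of the kernel [Im z / dker ^ 2] of
    [Im z * F1int], so one Poisson integral bounds both [Re Fint - v] and [Im z * F1int]. *)
Lemma Im_kker phi z : 0 < Im z -> Im (kker phi z) = Im z / Cmod (dker phi z) ^ 2.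
Proof.
intros Hz; rewrite Cmod2_alt; unfold kker; rewrite Im_Cdiv.
f_equal; rewrite Re_dker, Im_dker.
replace (Im (nker phi z)) with (Im z * sin phi) by (simpl; unfold Im; ring).
replace (Re (nker phi z)) with (cos phi + Re z * sin phi) by (simpl; unfold Re; ring).
transitivity (Im z * (Rsqr (sin phi) + Rsqr (cos phi))); [unfold Rsqr; ring|].
rewrite sin2_cos2; ring.
Qed.

Lemma Cmod_dker_pos phi z : 0 < Im z -> 0 < Cmod (dker phi z).
Proof. intros Hz; now apply Cmod_gt_0, dker_neq_0. Qed.

Lemma Im_kker_pos phi z : 0 < Im z -> 0 < Im (kker phi z).
Proof.
intros Hz; rewrite Im_kker by exact Hz.
apply Rdiv_lt_0_compat; [exact Hz|apply pow_lt; now apply Cmod_dker_pos].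
Qed.

Lemma Cmod_kker_le phi z c : 0 < c -> c <= Cmod (dker phi z) ->
  Cmod (kker phi z) <= (1 + Cmod z) * / c.
Proof.
intros Hc H; unfold kker, Cdiv; rewrite Cmod_mult.
apply Rmult_le_compat; [apply Cmod_ge_0|apply Cmod_ge_0| |now apply Cmod_inv_le].
unfold nker; le_triangle; rewrite Cmod_mult, !Cmod_R.
assert (Rabs (cos phi) <= 1) by (apply Rabs_le, COS_bound).
assert (Rabs (sin phi) <= 1) by (apply Rabs_le, SIN_bound).
generalize (Cmod_ge_0 z) (Rabs_pos (sin phi)); nra.
Qed.

Lemma dker_periodic phi z : dker (phi + PI) z = (- dker phi z)%C.
Proof. unfold dker; rewrite neg_sin, neg_cos, !RtoC_opp; ring. Qed.

Lemma kker_periodic phi z : 0 < Im z -> kker (phi + PI) z = kker phi z.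
Proof.
intros Hz; unfold kker; rewrite dker_periodic.
replace (nker (phi + PI) z) with (- nker phi z)%C
  by (unfold nker; rewrite neg_sin, neg_cos, !RtoC_opp; ring).
field; now apply dker_neq_0.
Qed.

Lemma CInt_shift (g : R -> C) c a b : (forall t, contC g t) ->
  CInt (fun t => g (c + t)) a b = CInt g (c + a) (c + b).
Proof.
intros Hg.
assert (Ex : is_CInt g (1 * a + c) (1 * b + c) (CInt g (1 * a + c) (1 * b + c))).
{ apply CInt_correct, (ex_RInt_continuous (V := CCN)); intros; apply Hg. }
apply (is_RInt_comp_lin (V := CN)) in Ex.
rewrite (CInt_unique (fun t => g (c + t)) a b (CInt g (1 * a + c) (1 * b + c))).
- f_equal; ring.
- eapply is_RInt_ext; [|exact Ex]; intros x _.
  transitivity (g (1 * x + c)); [exact (scal_one (V := CN) _)|f_equal; ring].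
Qed.

Lemma half_turn_shift (g : R -> C) c : (forall t, contC g t) -> (forall t, g (t + PI) = g t) ->
  half_turn_int (fun t => g (c + t)) = half_turn_int g.
Proof.
intros Hg Hp; unfold half_turn_int.
assert (Ex : forall a b, ex_CInt g a b).
{ intros a b; apply (ex_RInt_continuous (V := CCN)); intros; apply Hg. }
rewrite CInt_shift by exact Hg.
assert (E : CInt g hpi (c + hpi) = CInt g (- hpi) (c + - hpi)).
{ replace (CInt g hpi (c + hpi)) with (CInt g (PI + - hpi) (PI + (c + - hpi))) by (f_equal; field).
  rewrite <- CInt_shift by exact Hg.
  f_equal; apply functional_extensionality; intros t; now rewrite Rplus_comm. }
rewrite <- (CInt_Chasles g (c + - hpi) (- hpi) (c + hpi)), <- (CInt_Chasles g (- hpi) hpi (c + hpi)), E by apply Ex.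
replace (CInt g (- hpi) (c + - hpi)) with (- CInt g (c + - hpi) (- hpi))%C.
- ring.
- symmetry; apply CInt_unique.
  exact (is_RInt_swap (V := CN) _ _ _ _ (CInt_correct _ _ _ (Ex (c + - hpi) (- hpi)))).
Qed.

Lemma CInt_fold (g : R -> C) a : (forall t, contC g t) ->
  CInt g (- a) a = CInt (fun t => g t + g (- t)%R)%C 0 a.
Proof.
intros Hg.
assert (Ex : forall g a b, (forall t, contC g t) -> ex_CInt g a b).
{ intros h c d Hh; apply (ex_RInt_continuous (V := CCN)); intros; apply Hh. }
assert (Hgm : forall t, contC (fun t => g (- t)) t).
{ intros t; apply (continuous_comp (V := R_UniformSpace) Ropp g); [|apply Hg].
  apply (continuous_opp (V := RN)), continuous_id. }
rewrite CInt_plus, <- (CInt_Chasles g (- a) 0 a) by auto.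
assert (E : CInt (fun t => g (- t)) 0 a = CInt g (- a) 0); [|rewrite E; ring].
assert (I := CInt_correct _ _ _ (Ex (fun t => g (- t)) 0 a Hgm)).
assert (J := CInt_correct _ _ _ (Ex g (- 0) (- a) Hg)).
apply (is_RInt_comp_opp (V := CN)) in J.
apply (is_RInt_opp (V := CN)) in J.
apply CInt_unique.
rewrite Ropp_0 in J.
replace (CInt g (- a) 0) with (opp (CInt g 0 (- a) : CN)).
- eapply is_RInt_ext; [|exact J]; intros x _; apply opp_opp.
- symmetry; apply CInt_unique.
  exact (is_RInt_swap (V := CN) _ _ _ _ (CInt_correct _ _ _ (Ex g 0 (- a) Hg))).
Qed.

(** At the angle [atan (Re z) + p] the real part of [dker] is [sin p] divided by
    [cos (atan (Re z))]. The bound is independent of [Im z] and therefore persists up to the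
    boundary. *)
Lemma abs_sin_le_dker p z : Rabs (sin p) <= Cmod (dker (atan (Re z) + p) z).
Proof.
set (a := atan (Re z)).
assert (Ha := atan_bound (Re z)); fold a in Ha.
assert (Pc : 0 < cos a) by (apply cos_gt_0; lra).
assert (E : sin p = cos a * Re (dker (a + p) z)).
{ rewrite Re_dker; replace (Re z) with (sin a / cos a) by (fold (tan a); apply tan_atan).
  replace (sin p) with (sin (a + p - a)) by (f_equal; ring).
  rewrite sin_minus; field; lra. }
rewrite E, Rabs_mult, (Rabs_pos_eq (cos a)) by lra.
assert (B := re_le_Cmod (dker (a + p) z)).
assert (cos a <= 1) by apply COS_bound.
generalize (Rabs_pos (Re (dker (a + p) z))); nra.
Qed.

(** The approximate limit may change with [eps]; completeness of [C] then produces the limit, for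
    which no closed form is at hand in the case of [Im Fint]. *)
Lemma cauchy_limC {T} (F : (T -> Prop) -> Prop) {PF : ProperFilter F} (f : T -> C) :
  (forall eps, 0 < eps -> exists L, F (fun p => Cmod (f p - L) <= eps)) -> exists L, limC F f L.
Proof.
intros H.
destruct (proj1 (Hierarchy.filterlim_locally_cauchy (U := CCN) (F := F) f)) as [y Hy].
- intros eps.
  assert (P : 0 < eps / 4) by (generalize (cond_pos eps); lra).
  destruct (H _ P) as [L HL]; exists (fun p => Cmod (f p - L) <= eps / 4); split; [exact HL|].
  intros u v Hu Hv.
  assert (B : Cmod (f v - f u) < eps).
  { replace (f v - f u)%C with ((f v - L) - (f u - L))%C by ring.
    lt_triangle; rewrite Cmod_opp; lra. }
  split.
  + exact (Rle_lt_trans _ _ _ (re_le_Cmod _) B).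
  + exact (Rle_lt_trans _ _ _ (im_le_Cmod _) B).
- exists y; apply limC_filterlim; [apply PF|exact Hy].
Qed.

(** Continuity is assumed at the points of the slice [z = z0], and compactness of [[a, b]] makes it
    uniform. In the application [z0] lies on the real line. *)
Lemma CInt_param_continuous (f : C -> R -> C) z0 a b : a <= b ->
  (forall p, a <= p <= b ->
    @continuous (CxR) Cu
      (fun q => f (fst q) (snd q)) (z0, p)) ->
  (forall z, ex_CInt (f z) a b) ->
  forall eps, 0 < eps -> exists delta, 0 < delta /\
    forall z, Cmod (z - z0) < delta -> Cmod (CInt (f z) a b - CInt (f z0) a b) <= eps.
Proof.
intros Hab Hc Hex eps He.
assert (He1 : 0 < eps / (b - a + 1) / 2) by (apply Rdiv_lt_0_compat; [apply Rdiv_lt_0_compat|]; lra).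
assert (K : forall p, exists d : posreal, a <= p <= b -> forall z p',
   Cmod (z - z0) < d -> Rabs (p' - p) < d -> Cmod (f z p' - f z0 p) < eps / (b - a + 1) / 2).
{ intros p; destruct (classic (a <= p <= b)) as [Hp|Hp]; [|now exists (mkposreal 1 Rlt_0_1)].
  assert (L : limC (locally ((z0, p) : CxR))
     (fun q => f (fst q) (snd q)) (f z0 p))
    by (apply limC_filterlim; [apply locally_filter|exact (Hc p Hp)]).
  destruct (L _ He1) as [d Hd]; exists d; intros _ z p' Hz Hp'.
  apply (Hd (z, p')); split; [|exact Hp'].
  split; simpl; unfold_ball.
  - exact (Rle_lt_trans _ _ _ (re_le_Cmod (z - z0)) Hz).
  - exact (Rle_lt_trans _ _ _ (im_le_Cmod (z - z0)) Hz). }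
set (delta := fun p => proj1_sig (constructive_indefinite_description _ (K p))).
assert (Hdelta : forall p, a <= p <= b -> forall z p',
   Cmod (z - z0) < delta p -> Rabs (p' - p) < delta p -> Cmod (f z p' - f z0 p) < eps / (b - a + 1) / 2).
{ intros p; unfold delta; destruct constructive_indefinite_description; assumption. }
destruct (compactness_value_1d a b delta) as [d Hd].
exists d; split; [apply cond_pos|]; intros z Hz.
rewrite <- CInt_minus by apply Hex.
eapply Rle_trans; [apply (Cmod_CInt_le_const _ (eps / (b - a + 1)))|].
- exact Hab.
- intros p Hp; destruct (NNPP _ (Hd p Hp)) as [t [Ht [D1 D2]]].
  assert (A1 := Hdelta t Ht z p ltac:(lra) D1).
  assert (Z0 : Cmod (z0 - z0) < delta t).
  { replace (z0 - z0)%C with (RtoC 0) by ring; rewrite Cmod_0; apply cond_pos. }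
  assert (A2 := Hdelta t Ht z0 p Z0 D1).
  replace (f z p - f z0 p)%C with ((f z p - f z0 t) - (f z0 p - f z0 t))%C by ring.
  le_triangle; rewrite Cmod_opp; lra.
- apply (ex_RInt_minus (V := CN)); apply Hex.
- apply (Rmult_le_reg_r (b - a + 1)); [lra|].
  replace ((b - a) * (eps / (b - a + 1)) * (b - a + 1)) with ((b - a) * eps) by (field; lra).
  nra.
Qed.

(** * Recentred integrals and the Poisson bound *)

Section Boundary.
Variable v : R -> R.
Hypothesis Hv : forall t, continuous v t.
Hypothesis Hper : forall t, v (t + PI) = v t.

Lemma continuous_shift_pm a t : continuous (fun p => v (a + p)) t /\ continuous (fun p => v (a - p)) t.
Proof.
split.
- apply (continuous_comp (fun p => a + p) v); [|apply Hv].
  apply continuous_add_l.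
- apply (continuous_comp (fun p => a - p) v); [|apply Hv].
  apply continuous_sub_l.
Qed.

Lemma contC_shift (g : R -> C) a t : (forall t, contC g t) -> contC (fun p => g (a + p)) t.
Proof.
intros Hg; apply (continuous_comp (V := R_UniformSpace) (fun p => a + p) g); [|apply Hg].
apply continuous_add_l.
Qed.

(** Periodicity allows the window of integration to be moved to the angle [a]; the total mass [m] of
    the kernel is what the subtracted value [v a] contributes. *)
Lemma half_turn_centered (ker : R -> C) m a : (forall t, contC ker t) ->
  (forall t, ker (t + PI) = ker t) -> half_turn_int ker = m ->
  half_turn_int (fun p => RtoC (v (a + p) - v a) * ker (a + p)%R)%C
  = (half_turn_int (fun p => RtoC (v p) * ker p) - RtoC (v a) * m)%C.
Proof.
intros Hk Hkp Hm.
assert (HPI := PI_RGT_0).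
assert (Cvk : forall t, contC (fun p => RtoC (v p) * ker p)%C t).
{ intros t; apply continuous_Cmult; [apply continuous_RtoC, Hv|apply Hk]. }
rewrite <- (half_turn_shift (fun p => RtoC (v p) * ker p)%C a Cvk)
  by (intros; now rewrite Hper, Hkp).
rewrite <- Hm, <- (half_turn_shift ker a Hk Hkp).
unfold half_turn_int.
assert (Ex : forall g, (forall t, contC g t) -> ex_CInt g (- hpi) hpi)
  by (intros g Hg; apply ex_CInt_cont; [lra|intros; apply Hg]).
rewrite <- CInt_mult, <- CInt_minus.
- apply CInt_ext; [lra|]; intros; rewrite RtoC_minus; ring.
- apply Ex; intros; apply (contC_shift (fun p => RtoC (v p) * ker p)%C), Cvk.
- apply Ex; intros; apply continuous_Cmult; [apply continuous_const|now apply contC_shift].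
- apply Ex; intros; now apply contC_shift.
Qed.

(** The base angle moves with [z], so estimates in terms of [osc] do not depend on the direction of
    approach. *)
Definition osc (z : C) (p : R) : R := v (atan (Re z) + p) - v (atan (Re z)).

Lemma Fint_centered z : 0 < Im z ->
  half_turn_int (fun p => RtoC (osc z p) * kker (atan (Re z) + p) z)%C
  = (pi_i * (Fint v z - RtoC (v (atan (Re z)))))%C.
Proof.
intros Hz; unfold osc.
rewrite (half_turn_centered (fun p => kker p z) pi_i).
- unfold Fint; field; apply pi_i_neq_0.
- intros; now apply contC_kker.
- intros; now apply kker_periodic.
- now apply half_turn_kker.
Qed.

Lemma F1int_centered z : 0 < Im z ->
  half_turn_int (fun p => RtoC (osc z p) * / (dker (atan (Re z) + p) z * dker (atan (Re z) + p) z))%C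
  = (pi_i * F1int v z)%C.
Proof.
intros Hz; unfold osc.
rewrite (half_turn_centered (fun p => / (dker p z * dker p z))%C 0).
- unfold F1int; field; apply pi_i_neq_0.
- intros; now apply contC_inv_dker2.
- intros; rewrite dker_periodic; f_equal; ring.
- now apply int_inv_dker2.
Qed.

Definition poisson_osc (z : C) : R :=
  RInt (fun p => Rabs (osc z p) * Im (kker (atan (Re z) + p) z)) (- hpi) hpi.

Lemma continuous_osc z t : continuous (osc z) t.
Proof.
apply (continuous_minus (V := RN)); [apply continuous_shift_pm|apply continuous_const].
Qed.

Lemma continuous_Im_kker a z t : 0 < Im z -> continuous (fun p => Im (kker (a + p) z)) t.
Proof.
intros Hz; apply (proj1 (continuous_C_iff (fun p => kker (a + p) z) t)).
apply (contC_shift (fun p => kker p z)); intros; now apply contC_kker.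
Qed.

Lemma ex_poisson_osc z : 0 < Im z ->
  ex_RInt (fun p => Rabs (osc z p) * Im (kker (atan (Re z) + p) z)) (- hpi) hpi.
Proof.
intros Hz; apply (ex_RInt_continuous (V := RCN)); intros t _.
apply (continuous_mult (K := R_AbsRing)); [|now apply continuous_Im_kker].
apply (continuous_comp (osc z) Rabs); [apply continuous_osc|apply continuous_Rabs].
Qed.

Lemma Cmod_pi_i : Cmod pi_i = PI.
Proof.
unfold pi_i; rewrite Cmod_mult, Cmod_R, Cmod_Ci, Rabs_pos_eq; generalize PI_RGT_0; lra.
Qed.

Lemma F1int_le_poisson z : 0 < Im z -> PI * Cmod (RtoC (Im z) * F1int v z) <= poisson_osc z.
Proof.
intros Hz.
assert (HPI := PI_RGT_0).
assert (N : forall p, dker p z <> 0%C) by (intros; now apply dker_neq_0).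
rewrite <- Cmod_pi_i, <- Cmod_mult.
replace (pi_i * (RtoC (Im z) * F1int v z))%C with (RtoC (Im z) * (pi_i * F1int v z))%C by ring.
rewrite <- F1int_centered by exact Hz.
assert (Cg : forall t, contC (fun p => RtoC (osc z p) * / (dker (atan (Re z) + p) z * dker (atan (Re z) + p) z))%C t).
{ intros t; apply continuous_Cmult; [apply continuous_RtoC, continuous_osc|].
  apply (contC_shift (fun p => / (dker p z * dker p z))%C); intros; now apply contC_inv_dker2. }
unfold half_turn_int; rewrite <- CInt_mult by (apply ex_CInt_cont; [lra|intros; apply Cg]).
apply Cmod_CInt_le; [lra| | |now apply ex_poisson_osc].
- intros t _; rewrite Im_kker by exact Hz.
  rewrite !Cmod_mult, !Cmod_R, Cmod_inv by (apply Cmult_neq_0; apply N).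
  rewrite Cmod_mult, (Rabs_pos_eq (Im z)) by lra.
  right; field.
  generalize (Cmod_dker_pos (atan (Re z) + t) z Hz); lra.
- apply ex_CInt_cont; [lra|]; intros; apply continuous_Cmult; [apply continuous_const|apply Cg].
Qed.

Lemma Re_Fint_le_poisson z : 0 < Im z ->
  PI * Rabs (Re (Fint v z) - v (atan (Re z))) <= poisson_osc z.
Proof.
intros Hz.
assert (HPI := PI_RGT_0).
assert (E : PI * (Re (Fint v z) - v (atan (Re z))) =
  Im (half_turn_int (fun p => RtoC (osc z p) * kker (atan (Re z) + p) z)%C)).
{ rewrite Fint_centered by exact Hz; unfold pi_i, Re; simpl; ring. }
rewrite <- (Rabs_pos_eq PI) at 1 by lra.
rewrite <- Rabs_mult, E; unfold half_turn_int.
assert (Cg : forall t, contC (fun p => RtoC (osc z p) * kker (atan (Re z) + p) z)%C t).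
{ intros t; apply continuous_Cmult; [apply continuous_RtoC, continuous_osc|].
  apply (contC_shift (fun p => kker p z)); intros; now apply contC_kker. }
rewrite Im_CInt by (apply ex_CInt_cont; [lra|intros; apply Cg]).
assert (Ex : ex_RInt (fun p => Im (RtoC (osc z p) * kker (atan (Re z) + p) z)%C) (- hpi) hpi).
{ apply (ex_RInt_continuous (V := RCN)); intros t _.
  apply (proj1 (continuous_C_iff _ t) (Cg t)). }
eapply Rle_trans; [apply abs_RInt_le; [lra|exact Ex]|].
apply RInt_le; [lra| |now apply ex_poisson_osc|].
- apply (ex_RInt_continuous (V := RCN)); intros t _.
  apply (continuous_comp (fun p => Im (RtoC (osc z p) * kker (atan (Re z) + p) z)%C) Rabs);
    [apply (proj1 (continuous_C_iff _ t) (Cg t))|apply continuous_Rabs].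
- intros p _; right.
  assert (P := Im_kker_pos (atan (Re z) + p) z Hz).
  rewrite <- (Rabs_pos_eq (Im (kker _ z))) by lra.
  rewrite <- Rabs_mult; f_equal; simpl; unfold Im; ring.
Qed.

(** The usual approximate-identity argument: near the base angle the oscillation is small and the
    kernel has mass [PI]; away from it the oscillation is bounded and the kernel is at most
    [Im z / sin d ^ 2]. *)
Lemma poisson_osc_small x0 eps : 0 < eps -> near_real x0 (fun z => poisson_osc z <= eps).
Proof.
intros He; apply near_real_iff.
assert (HPI := PI_RGT_0); assert (HPI4 := PI_4); assert (HPI3 := PI2_3_2).
(* Both [atan (Re z)] and [p] lie in [[- PI / 2, PI / 2]], so their sum has modulus at most
   [PI <= 4]. *)
destruct (continuous_bounded v (-4) 4) as [M [PM HM]]; [lra|intros; apply Hv|].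
(* The near part contributes [2 * e * PI], half of [eps]; the bound on [Im z] chosen below leaves
   the other half to the far part. *)
set (e := eps / (4 * PI)).
assert (Pe : 0 < e) by (apply Rdiv_lt_0_compat; lra).
destruct (proj1 (filterlim_locally _ _) (Hv (atan x0)) (mkposreal e Pe)) as [d1 K1].
simpl in K1; unfold_ball in K1.
assert (Pd1 := cond_pos d1).
set (d := Rmin (d1 / 2) 1).
assert (Pd : 0 < d) by (apply Rmin_pos; lra).
assert (D1 : d <= d1 / 2) by apply Rmin_l.
assert (D2 : d <= 1) by apply Rmin_r.
assert (Ca : continuous atan x0).
{ apply (ex_derive_continuous (V := RN)); eexists; apply is_derive_atan. }
destruct (proj1 (filterlim_locally _ _) Ca (mkposreal d Pd)) as [d2 K2].
simpl in K2; unfold_ball in K2.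
assert (Sd : 0 < sin d) by (apply sin_gt_0; lra).
set (k := 2 * M / (sin d * sin d)).
assert (Pk : 0 <= k) by (apply Rdiv_le_0_compat; [lra|now apply Rmult_lt_0_compat]).
assert (Q : 0 < eps / (2 * PI * (k + 1))) by (apply Rdiv_lt_0_compat; [lra|apply Rmult_lt_0_compat; lra]).
exists (Rmin d2 (eps / (2 * PI * (k + 1)))); split; [apply Rmin_pos; [apply cond_pos|exact Q]|].
intros z Hz Hzd.
assert (Hz2 := Rlt_le_trans _ _ _ Hzd (Rmin_l _ _)); assert (Hz3 := Rlt_le_trans _ _ _ Hzd (Rmin_r _ _)).
assert (Hx := Rle_lt_trans _ _ _ (re_le_Cmod _) Hz2).
assert (Hy := Rle_lt_trans _ _ _ (im_le_Cmod _) Hz3).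
assert (Hy' : Im z <= eps / (2 * PI * (k + 1))).
{ assert (T := Rle_abs (Im (z - RtoC x0)%C)); simpl in T, Hy; unfold Im in *; lra. }
specialize (K2 (Re z) Hx).
set (a := atan (Re z)) in *.
assert (Ba := atan_bound (Re z)); fold a in Ba.
assert (Bd : forall p, - hpi <= p <= hpi ->
  Rabs (osc z p) * Im (kker (a + p) z) <= 2 * e * Im (kker (a + p) z) + k * Im z).
{ intros p Hp; assert (P := Im_kker_pos (a + p) z Hz).
  assert (Rp : 0 <= k * Im z) by (apply Rmult_le_pos; lra).
  destruct (Rlt_le_dec (Rabs p) d) as [Hpd|Hpd].
  - assert (A1 := K1 (a + p)); assert (A2 := K1 a).
    assert (T1 : Rabs (a + p + - atan x0) < d1).
    { replace (a + p + - atan x0) with ((a + - atan x0) + p) by ring.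
      lt_triangle; lra. }
    specialize (A1 T1); specialize (A2 ltac:(lra)).
    assert (Rabs (osc z p) <= 2 * e); [|nra].
    unfold osc; fold a.
    replace (v (a + p) - v a) with ((v (a + p) + - v (atan x0)) - (v a + - v (atan x0))) by ring.
    unfold Rminus at 1; le_triangle; rewrite Rabs_Ropp; lra.
  - assert (O : Rabs (osc z p) <= 2 * M).
    { unfold osc; fold a; unfold Rminus; le_triangle; rewrite Rabs_Ropp.
      assert (Rabs (v (a + p)) <= M) by (apply HM; lra).
      assert (Rabs (v a) <= M) by (apply HM; lra). lra. }
    assert (Sp : sin d <= Rabs (sin p)).
    { apply Rle_trans with (sin (Rabs p)).
      - apply sin_incr_1; try lra; apply Rabs_le; lra.
      - unfold Rabs at 1; destruct Rcase_abs; [rewrite sin_neg, <- Rabs_Ropp|]; apply Rle_abs. }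
    assert (Sq := abs_sin_le_dker p z); fold a in Sq.
    assert (Ik : Im (kker (a + p) z) <= Im z * / (sin d * sin d)).
    { rewrite Im_kker by exact Hz; apply Rmult_le_compat_l; [lra|].
      apply Rinv_le_contravar; [nra|]; simpl; rewrite Rmult_1_r; apply Rmult_le_compat; lra. }
    apply Rle_trans with (k * Im z).
    + replace (k * Im z) with (2 * M * (Im z * / (sin d * sin d))) by (unfold k; field; lra).
      apply Rmult_le_compat; [apply Rabs_pos|lra|exact O|exact Ik].
    + assert (0 <= e * Im (kker (a + p) z)) by (apply Rmult_le_pos; lra); lra. }
assert (I1 : is_RInt (fun p => Im (kker (a + p) z)) (- hpi) hpi PI).
{ assert (Cs : forall t, contC (fun p => kker (a + p) z) t)
    by (intros; apply (contC_shift (fun p => kker p z)); intros; now apply contC_kker).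
  assert (Ex : ex_CInt (fun p => kker (a + p) z) (- hpi) hpi)
    by (apply ex_CInt_cont; [lra|intros; apply Cs]).
  assert (J := proj2 (proj1 (is_CInt_comp _ _ _ _) (CInt_correct _ _ _ Ex))).
  assert (EI : Im (CInt (fun p => kker (a + p) z) (- hpi) hpi) = PI).
  { change (Im (half_turn_int (fun p => kker (a + p) z)) = PI).
    rewrite (half_turn_shift (fun p => kker p z) a), half_turn_kker.
    - unfold pi_i; simpl; ring.
    - exact Hz.
    - intros; now apply contC_kker.
    - intros; now apply kker_periodic. }
  rewrite EI in J; exact J. }
assert (I2 : is_RInt (fun p => 2 * e * Im (kker (a + p) z) + k * Im z) (- hpi) hpi
   (2 * e * PI + (hpi - - hpi) * (k * Im z))).
{ apply (is_RInt_plus (V := RN)).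
  - apply (is_RInt_scal (V := RN)), I1.
  - apply (is_RInt_const (V := RN)). }
unfold poisson_osc; fold a.
eapply Rle_trans; [apply (RInt_le _ (fun p => 2 * e * Im (kker (a + p) z) + k * Im z))|].
- lra.
- now apply ex_poisson_osc.
- eexists; exact I2.
- intros p Hp; apply Bd; lra.
- rewrite (is_RInt_unique _ _ _ _ I2).
  replace (2 * e * PI) with (eps / 2) by (unfold e; field; lra).
  replace (hpi - - hpi) with PI by field.
  apply (Rmult_le_compat_r (2 * PI * (k + 1))) in Hy'; [|apply Rmult_le_pos; lra].
  replace (eps / (2 * PI * (k + 1)) * (2 * PI * (k + 1))) with eps in Hy' by (field; lra).
  assert (0 <= Im z * PI) by (apply Rmult_le_pos; lra).
  nra.
Qed.
End Boundary.

Lemma continuous_atan x : continuous atan x.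
Proof. apply (ex_derive_continuous (V := RN)); eexists; apply is_derive_atan. Qed.

Lemma near_real_atan x0 eps : 0 < eps ->
  near_real x0 (fun z => Rabs (atan (Re z) - atan x0) < eps).
Proof.
intros He; apply near_real_iff.
destruct (proj1 (filterlim_locally _ _) (continuous_atan x0) (mkposreal eps He)) as [d K].
exists d; split; [apply cond_pos|]; intros z _ Hz.
exact (K (Re z) (Rle_lt_trans _ _ _ (re_le_Cmod _) Hz)).
Qed.

Lemma near_real_comp_atan v x0 eps : (forall t, continuous v t) -> 0 < eps ->
  near_real x0 (fun z => Rabs (v (atan (Re z)) - v (atan x0)) < eps).
Proof.
intros Hv He.
destruct (proj1 (filterlim_locally _ _) (Hv (atan x0)) (mkposreal eps He)) as [d K].
generalize (near_real_atan x0 d (cond_pos d)); apply filter_imp.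
intros z Hz; exact (K _ Hz).
Qed.

Lemma near_real_pos x0 : near_real x0 (fun z : C => 0 < Im z).
Proof. apply near_real_iff; exists 1; split; [lra|auto]. Qed.

Lemma near_infty_pos : near_infty (fun z : C => 0 < Im z).
Proof. apply near_infty_iff; exists 0; auto. Qed.

(** * Limits at finite boundary points *)

Section Limits.
Variable v : R -> R.
Hypothesis Hv : forall t, continuous v t.
Hypothesis Hper : forall t, v (t + PI) = v t.

(** Pairing [p] with [- p] moves the singular angle to the endpoint 0, where it can be split off as
    [[0, d]], and matches the two-sided integrand of [uniform_dini]. *)
Definition folded (z : C) (p : R) : C :=
  (RtoC (osc v z p) * kker (atan (Re z) + p) z
   + RtoC (osc v z (- p)) * kker (atan (Re z) + - p) z)%C.

Lemma continuous_osc_joint z p (s : R) :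
  continuous (fun q : CxR => osc v (fst q) (s * snd q)) (z, p).
Proof.
assert (Ca : continuous (fun q : CxR => atan (Re (fst q))) (z, p)).
{ apply (continuous_comp re_fst atan);
    [|apply continuous_atan].
  apply (proj1 (continuous_C_iff (fun q : CxR => fst q) (z, p))).
  apply continuous_fst. }
apply (continuous_minus (V := RN)).
- apply (continuous_comp (fun q : CxR => atan (Re (fst q)) + s * snd q) v); [|apply Hv].
  apply (continuous_plus (V := RN)); [exact Ca|].
  apply (continuous_mult (K := R_AbsRing)); [apply continuous_const|apply continuous_snd].
- apply (continuous_comp (fun q : CxR => atan (Re (fst q))) v); [exact Ca|apply Hv].
Qed.

(** Real [z] is included: the lower bound by [|sin|] replaces positivity of [Im z], so away from the
    singular angle the kernel is continuous up to the boundary. *)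
Lemma continuous_kker_joint z p (s : R) : sin (s * p) <> 0 ->
  @continuous (CxR) Cu
    (fun q => kker (atan (Re (fst q)) + s * snd q) (fst q)) (z, p).
Proof.
intros N.
apply (continuous_kker (fun q : CxR => atan (Re (fst q)) + s * snd q) (fun q => fst q)).
- apply (continuous_plus (V := RN)).
  + apply (continuous_comp re_fst atan);
      [|apply continuous_atan].
    apply (proj1 (continuous_C_iff (fun q : CxR => fst q) (z, p))).
    apply continuous_fst.
  + apply (continuous_mult (K := R_AbsRing)); [apply continuous_const|apply continuous_snd].
- apply continuous_fst.
- apply (neq_0_of_Cmod (Rabs (sin (s * p)))); [now apply Rabs_pos_lt|]; apply abs_sin_le_dker.
Qed.

Lemma continuous_folded_joint z p : sin p <> 0 ->
  @continuous (CxR) Cu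
    (fun q => folded (fst q) (snd q)) (z, p).
Proof.
intros N.
apply (continuous_ext (T := CxR) (U := Cu)
 (fun q => RtoC (osc v (fst q) (1 * snd q)) * kker (atan (Re (fst q)) + 1 * snd q) (fst q)
   + RtoC (osc v (fst q) (-1 * snd q)) * kker (atan (Re (fst q)) + -1 * snd q) (fst q))%C).
{ intros q; unfold folded.
  replace (1 * snd q) with (snd q : R) by (simpl; ring).
  replace (-1 * snd q) with (- snd q : R) by (simpl; ring). reflexivity. }
assert (N' : sin (-1 * p) <> 0).
{ replace (-1 * p) with (- p) by ring; rewrite sin_neg; lra. }
apply continuous_Cplus; apply continuous_Cmult.
- apply continuous_RtoC, continuous_osc_joint.
- apply continuous_kker_joint; now rewrite Rmult_1_l.
- apply continuous_RtoC, continuous_osc_joint.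
- now apply continuous_kker_joint.
Qed.

Lemma contC_folded_pos z p : 0 < Im z -> contC (folded z) p.
Proof.
intros Hz.
assert (Ck : forall t, contC (fun p => RtoC (osc v z p) * kker (atan (Re z) + p) z)%C t).
{ intros t; apply continuous_Cmult; [apply continuous_RtoC, continuous_osc, Hv|].
  apply (contC_shift (fun p => kker p z)); intros; now apply contC_kker. }
apply continuous_Cplus; [apply Ck|].
apply (continuous_comp (V := R_UniformSpace) Ropp (fun p => RtoC (osc v z p) * kker (atan (Re z) + p) z)%C); [|apply Ck].
apply (continuous_opp (V := RN)), continuous_id.
Qed.

Lemma ex_folded_far z a b : 0 < a -> a <= b -> b < PI -> ex_CInt (folded z) a b.
Proof.
intros Ha Hab Hb; apply ex_CInt_cont; [exact Hab|]; intros t Ht.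
assert (N : sin t <> 0) by (apply Rgt_not_eq, sin_gt_0; lra).
apply (continuous_comp_2 (U := R_UniformSpace) (V := Cu) (W := R_UniformSpace)
   (X := Cu) (fun _ => z) (fun t => t) folded).
- apply continuous_const.
- apply continuous_id.
- now apply continuous_folded_joint.
Qed.

Lemma Fint_folded z : 0 < Im z ->
  (pi_i * (Fint v z - RtoC (v (atan (Re z)))))%C = CInt (folded z) 0 hpi.
Proof.
intros Hz; rewrite <- Fint_centered by assumption.
unfold half_turn_int; rewrite CInt_fold; [reflexivity|].
intros t; apply continuous_Cmult; [apply continuous_RtoC, continuous_osc, Hv|].
apply (contC_shift (fun p => kker p z)); intros; now apply contC_kker.
Qed.

Lemma Cmod_folded_le z p : 0 < p <= 1 ->
  Cmod (folded z p) <= 2 * (1 + Cmod z) * ((Rabs (osc v z p) + Rabs (osc v z (- p))) / p).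
Proof.
intros Hp.
assert (B : forall q, Rabs q = p -> Cmod (kker (atan (Re z) + q) z) <= (1 + Cmod z) * / (p / 2)).
{ intros q Hq; apply Cmod_kker_le; [lra|].
  eapply Rle_trans; [|apply abs_sin_le_dker].
  rewrite <- Hq; apply sin_ge_half; lra. }
assert (B1 := B p (Rabs_pos_eq p ltac:(lra))).
assert (B2 := B (- p)); rewrite Rabs_Ropp, (Rabs_pos_eq p) in B2 by lra; specialize (B2 eq_refl).
le_triangle; rewrite !Cmod_mult, !Cmod_R.
replace (2 * (1 + Cmod z) * ((Rabs (osc v z p) + Rabs (osc v z (- p))) / p)) with
  (Rabs (osc v z p) * ((1 + Cmod z) * / (p / 2)) + Rabs (osc v z (- p)) * ((1 + Cmod z) * / (p / 2)))
  by (field; lra).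
apply Rplus_le_compat; apply Rmult_le_compat_l; try apply Rabs_pos; assumption.
Qed.

(** The kernel is at most [2 * (1 + Cmod z) / p], so the Dini integral of the oscillation dominates;
    uniformity in the base angle gives one [d] for all [z] near [x0]. *)
Lemma folded_near_small x0 eps : uniform_dini v (atan x0) -> 0 < eps ->
  exists d, 0 < d <= 1 /\ near_real x0 (fun z => Cmod (CInt (folded z) 0 d) <= eps).
Proof.
intros HU He.
assert (Px := Cmod_ge_0 (RtoC x0)).
(* As [Cmod z <= 1 + Cmod (RtoC x0)], the Dini part [2 * (1 + Cmod z) * e] is at most [eps / 2]. *)
set (e := eps / (4 * (2 + Cmod (RtoC x0)))).
assert (Pe : 0 < e) by (apply Rdiv_lt_0_compat; lra).
destruct (HU e Pe) as [d [Hd K]].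
exists d; split; [exact Hd|].
assert (N1 : near_real x0 (fun z : C => Cmod (z - RtoC x0) < 1))
  by (apply near_real_iff; exists 1; split; [lra|auto]).
generalize (filter_and _ _ (near_real_pos x0) (filter_and _ _ N1 (near_real_atan x0 d (proj1 Hd)))).
apply filter_imp; intros z [Hz [Hz1 Ha]].
assert (Cz : Cmod z <= 1 + Cmod (RtoC x0)).
{ replace z with ((z - RtoC x0) + RtoC x0)%C at 1 by ring.
  le_triangle; lra. }
assert (Pz := Cmod_ge_0 z).
destruct (continuous_bounded (fun p => Cmod (folded z p)) 0 d) as [M [PM HM]]; [lra| |].
{ intros; apply continuous_Cmod, contC_folded_pos, Hz. }
assert (Pq : 0 < eps / 2 / (M + 1)) by (apply Rdiv_lt_0_compat; lra).
(* [M] and [rho] depend on [z]: for fixed [z] the integrand is bounded, which settles [[0, rho]],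
   and the Dini bound on [[rho, d]] does not depend on [rho]. *)
set (rho := Rmin d (eps / 2 / (M + 1))).
assert (Pr : 0 < rho) by (apply Rmin_pos; [lra|exact Pq]).
assert (R1 : rho <= d) by apply Rmin_l.
assert (R2 : rho * M <= eps / 2).
{ apply Rle_trans with (eps / 2 / (M + 1) * (M + 1)); [|right; field; lra].
  apply Rmult_le_compat; try lra; apply Rmin_r. }
assert (Ex : forall a b, 0 <= a -> a <= b -> ex_CInt (folded z) a b).
{ intros a b ? ?; apply ex_CInt_cont; [assumption|]; intros; now apply contC_folded_pos. }
rewrite <- (CInt_Chasles _ 0 rho d) by (apply Ex; lra).
le_triangle.
assert (B1 : Cmod (CInt (folded z) 0 rho) <= (rho - 0) * M).
{ apply Cmod_CInt_le_const; [lra| |apply Ex; lra].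
  intros t Ht; eapply Rle_trans; [apply Rle_abs|]; apply HM; lra. }
assert (Eo := ex_dini_integral v (atan (Re z)) rho d Hv Pr R1).
assert (Io := is_RInt_scal (V := RN) _ _ _ (2 * (1 + Cmod z)) _ (RInt_correct (V := RCN) _ _ _ Eo)).
assert (B2 : Cmod (CInt (folded z) rho d) <= 2 * (1 + Cmod z) * e).
{ eapply Rle_trans; [apply Cmod_CInt_le with (g := fun p => scal (2 * (1 + Cmod z))
     ((Rabs (v (atan (Re z) + p) - v (atan (Re z))) + Rabs (v (atan (Re z) - p) - v (atan (Re z)))) / p))|].
  - exact R1.
  - intros p Hp; apply (Cmod_folded_le z p); lra.
  - apply Ex; lra.
  - eexists; exact Io.
  - eapply Rle_trans; [right; exact (is_RInt_unique (V := RCN) _ _ _ _ Io)|].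
    apply Rmult_le_compat_l; [lra|]; apply K; [exact Ha|exact Pr|exact R1]. }
assert (B3 : 2 * (1 + Cmod z) * e <= eps / 2).
{ apply Rle_trans with (2 * (2 + Cmod (RtoC x0)) * e); [|right; unfold e; field; lra].
  apply Rmult_le_compat_r; lra. }
lra.
Qed.

(** Three pieces, each within [eps / 3]: the value of [v] at the base angle, the integral over
    [[0, d]], which is uniformly small, and the rest, which is continuous in [z] up to [x0]. The
    factor [PI] in the bounds offsets the division by [pi_i]. *)
Lemma Fint_limit x0 : uniform_dini v (atan x0) -> exists L, limC (near_real x0) (Fint v) L.
Proof.
intros HU; apply cauchy_limC; [apply near_real_filter|]; intros eps He.
assert (HPI := PI_RGT_0); assert (HPI3 := PI2_3_2).
assert (Pe : 0 < eps * PI / 3) by nra.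
destruct (folded_near_small x0 _ HU Pe) as [d [Hd Nd]].
destruct (CInt_param_continuous folded (RtoC x0) d hpi) with (eps := eps * PI / 3) as [d' [Hd' K']].
- lra.
- intros p Hp; apply continuous_folded_joint, Rgt_not_eq, sin_gt_0; lra.
- intros z; apply ex_folded_far; lra.
- exact Pe.
- exists (RtoC (v (atan x0)) + / pi_i * CInt (folded (RtoC x0)) d hpi)%C.
  assert (Pe3 : 0 < eps / 3) by lra.
  assert (N1 : near_real x0 (fun z : C => Cmod (z - RtoC x0) < d'))
    by (apply near_real_iff; exists d'; auto).
  generalize (filter_and _ _ (near_real_pos x0) (filter_and _ _ N1
    (filter_and _ _ Nd (near_real_comp_atan v x0 _ Hv Pe3)))).
  apply filter_imp; intros z [Hz [Hz1 [Hz2 Hz3]]].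
  specialize (K' z Hz1).
  assert (E : Fint v z = (RtoC (v (atan (Re z))) + / pi_i * CInt (folded z) 0 hpi)%C).
  { rewrite <- Fint_folded by exact Hz; field; apply pi_i_neq_0. }
  rewrite <- (CInt_Chasles (folded z) 0 d hpi) in E.
  2,3: apply ex_CInt_cont; [lra|intros; now apply contC_folded_pos].
  rewrite E.
  set (A := CInt (folded z) 0 d) in *; set (B1 := CInt (folded z) d hpi) in *.
  set (B0 := CInt (folded (RtoC x0)) d hpi) in *.
  replace (_ - _)%C with (RtoC (v (atan (Re z)) - v (atan x0)) + / pi_i * (A + (B1 - B0)))%C
    by (rewrite RtoC_minus; ring).
  le_triangle; rewrite Cmod_R, Cmod_mult.
  rewrite Cmod_inv, Cmod_pi_i by apply pi_i_neq_0.
  assert (T := Cmod_triangle A (B1 - B0)).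
  assert (T2 : / PI * Cmod (A + (B1 - B0)) <= eps / 3 + eps / 3).
  { apply (Rmult_le_reg_l PI); [lra|].
    rewrite <- Rmult_assoc, Rinv_r, Rmult_1_l by lra; lra. }
  lra.
Qed.

Lemma limC_le_unique {T} (F : (T -> Prop) -> Prop) {PF : ProperFilter F} f L c :
  limC F f L -> (forall eps, 0 < eps -> F (fun p => Rabs (Re (f p) - c) <= eps)) -> Re L = c.
Proof.
intros HL H.
apply Rminus_diag_uniq, zero_of_small; intros eps He.
assert (He2 : 0 < eps / 2) by lra.
destruct (filter_ex _ (filter_and _ _ (HL _ He2) (H _ He2))) as [p [P1 P2]].
assert (R := Rle_lt_trans _ _ _ (re_le_Cmod _) P1).
replace (Re (f p - L)%C) with (Re (f p) - Re L) in R by (simpl; unfold Re; ring).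
replace (Re L - c) with ((Re (f p) - c) - (Re (f p) - Re L)) by ring.
unfold Rminus at 1; le_triangle; rewrite Rabs_Ropp; lra.
Qed.

Lemma Re_Fint_limit x0 L : limC (near_real x0) (Fint v) L -> Re L = v (atan x0).
Proof.
intros HL; apply (limC_le_unique _ _ _ _ HL); intros eps He.
assert (HPI := PI_RGT_0).
assert (Pe : 0 < PI * (eps / 2)) by nra.
assert (Pe2 : 0 < eps / 2) by lra.
generalize (filter_and _ _ (near_real_pos x0) (filter_and _ _ (poisson_osc_small v Hv x0 _ Pe)
  (near_real_comp_atan v x0 _ Hv Pe2))).
apply filter_imp; intros z [Hz [H1 H2]].
assert (H3 := Re_Fint_le_poisson v Hv Hper z Hz).
assert (H4 : Rabs (Re (Fint v z) - v (atan (Re z))) <= eps / 2)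
  by (apply (Rmult_le_reg_l PI); lra).
replace (Re (Fint v z) - v (atan x0)) with
  ((Re (Fint v z) - v (atan (Re z))) + (v (atan (Re z)) - v (atan x0))) by ring.
le_triangle; lra.
Qed.

Lemma F1int_limit x0 : limC (near_real x0) (fun z : C => RtoC (Im z) * F1int v z)%C 0.
Proof.
intros eps He.
assert (HPI := PI_RGT_0).
assert (Pe : 0 < PI * (eps / 2)) by nra.
generalize (filter_and _ _ (near_real_pos x0) (poisson_osc_small v Hv x0 _ Pe)).
apply filter_imp; intros z [Hz H1].
assert (H3 := F1int_le_poisson v Hv Hper z Hz).
rewrite Cminus_0_r.
apply Rle_lt_trans with (eps / 2); [apply (Rmult_le_reg_l PI)|]; lra.
Qed.
End Limits.

(** * Inversion and the limit at infinity *)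

Definition inversion (z : C) : C := (- / z)%C.

Lemma Im_inversion (z : C) : z <> 0%C -> Im (inversion z) = Im z / Cmod z ^ 2.
Proof. intros N; rewrite Cmod2_alt; destruct z as [x y]; simpl; unfold Rdiv; ring. Qed.

Lemma Im_pos_neq_0 (z : C) : 0 < Im z -> z <> 0%C.
Proof. intros H E; rewrite E in H; simpl in H; lra. Qed.

Lemma near_infty_inversion (P : C -> Prop) :
  near_real 0 P -> near_infty (fun z => P (inversion z)).
Proof.
intros H; destruct (proj1 (near_real_iff _ _) H) as [d [Hd K]].
apply near_infty_iff; exists (/ d); intros z Hz Hm.
assert (N := Im_pos_neq_0 z Hz).
assert (P1 : 0 < Cmod z) by now apply Cmod_gt_0.
apply K.
- rewrite Im_inversion by exact N; apply Rdiv_lt_0_compat; [exact Hz|now apply pow_lt].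
- replace (inversion z - RtoC 0)%C with (- / z)%C by (unfold inversion; ring).
  rewrite Cmod_opp, Cmod_inv by exact N.
  rewrite <- (Rinv_inv d); apply Rinv_lt_contravar; [|exact Hm].
  apply Rmult_lt_0_compat; [now apply Rinv_0_lt_compat|exact P1].
Qed.

(** Since [tan (p + PI / 2) = - 1 / tan p], inversion is a quarter turn of the angle. The factor [z]
    cancels in [kker] and leaves [/ (z * z)] in the kernel of [F1int]. *)
Lemma dker_inversion p (z : C) : z <> 0%C -> dker (p + hpi) z = (z * dker p (inversion z))%C.
Proof.
intros N; unfold dker, inversion.
rewrite sin_plus, cos_plus, cos_PI2, sin_PI2.
replace (sin p * 0 + cos p * 1) with (cos p) by ring.
replace (cos p * 0 - sin p * 1) with (- sin p) by ring.
rewrite RtoC_opp; field; exact N.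
Qed.

Lemma nker_inversion p (z : C) : z <> 0%C -> nker (p + hpi) z = (z * nker p (inversion z))%C.
Proof.
intros N; unfold nker, inversion.
rewrite sin_plus, cos_plus, cos_PI2, sin_PI2.
replace (sin p * 0 + cos p * 1) with (cos p) by ring.
replace (cos p * 0 - sin p * 1) with (- sin p) by ring.
rewrite RtoC_opp; field; exact N.
Qed.

Section Infinity.
Variable v : R -> R.
Hypothesis Hv : forall t, continuous v t.
Hypothesis Hper : forall t, v (t + PI) = v t.
Let v' (b : R) : R := v (b + hpi).

Lemma continuous_quarter_turn t : continuous v' t.
Proof.
apply (continuous_comp (fun b => b + hpi) v); [|apply Hv].
apply continuous_add_r.
Qed.

Lemma periodic_quarter_turn t : v' (t + PI) = v' t.
Proof. unfold v'; rewrite <- (Hper (t + hpi)); f_equal; ring. Qed.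

Lemma Im_inversion_pos z : 0 < Im z -> 0 < Im (inversion z).
Proof.
intros Hz; assert (N := Im_pos_neq_0 z Hz).
rewrite Im_inversion by exact N; apply Rdiv_lt_0_compat; [exact Hz|].
now apply pow_lt, Cmod_gt_0.
Qed.

Lemma Fint_inversion z : 0 < Im z -> Fint v z = Fint v' (inversion z).
Proof.
intros Hz; assert (N := Im_pos_neq_0 z Hz); assert (Hw := Im_inversion_pos z Hz).
unfold Fint; f_equal.
rewrite <- (half_turn_shift (fun p => RtoC (v p) * kker p z)%C hpi).
- apply half_turn_ext; intros t; unfold v'; rewrite (Rplus_comm hpi t); f_equal.
  unfold kker; rewrite dker_inversion, nker_inversion by exact N.
  field; split; [now apply dker_neq_0|exact N].
- intros t; apply continuous_Cmult; [apply continuous_RtoC, Hv|now apply contC_kker].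
- intros t; now rewrite Hper, kker_periodic.
Qed.

(** The factor [/ (z * z)] from the kernel has just the modulus by which inversion changes the
    imaginary part, [Im (inversion z) = Im z / Cmod z ^ 2]. *)
Lemma F1int_inversion z : 0 < Im z ->
  Cmod (RtoC (Im z) * F1int v z) = Cmod (RtoC (Im (inversion z)) * F1int v' (inversion z)).
Proof.
intros Hz; assert (N := Im_pos_neq_0 z Hz); assert (Hw := Im_inversion_pos z Hz).
assert (HPI := PI_RGT_0).
assert (E : F1int v z = (/ (z * z) * F1int v' (inversion z))%C).
{ unfold F1int.
  rewrite <- (half_turn_shift (fun p => RtoC (v p) * / (dker p z * dker p z))%C hpi).
  - transitivity (/ pi_i * (/ (z * z) * half_turn_int (fun p => RtoC (v' p) * / (dker p (inversion z) * dker p (inversion z)))))%C;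
      [f_equal|ring].
    unfold half_turn_int at 2; rewrite <- CInt_mult.
    + apply half_turn_ext; intros t; unfold v'; rewrite (Rplus_comm hpi t).
      rewrite dker_inversion by exact N.
      field; split; [now apply dker_neq_0|exact N].
    + apply ex_CInt_cont; [lra|]; intros t _; apply continuous_Cmult;
        [apply continuous_RtoC, continuous_quarter_turn|now apply contC_inv_dker2].
  - intros t; apply continuous_Cmult; [apply continuous_RtoC, Hv|now apply contC_inv_dker2].
  - intros t; rewrite Hper, dker_periodic; do 2 f_equal; ring. }
rewrite E, !Cmod_mult, Cmod_inv, Cmod_mult, !Cmod_R by (now apply Cmult_neq_0).
rewrite Im_inversion, !Rabs_pos_eq.
- field; apply Rgt_not_eq, Cmod_gt_0, N.
- rewrite <- Im_inversion by exact N; lra.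
- lra.
- exact N.
Qed.

Lemma Fint_limit_infty : uniform_dini v' 0 -> exists L, limC near_infty (Fint v) L.
Proof.
intros HU; rewrite <- atan_0 in HU.
destruct (Fint_limit v' continuous_quarter_turn periodic_quarter_turn 0 HU) as [L HL].
exists L; intros eps He.
generalize (filter_and _ _ near_infty_pos (near_infty_inversion _ (HL eps He))).
apply filter_imp; intros z [Hz H]; now rewrite Fint_inversion.
Qed.

Lemma F1int_limit_infty : limC near_infty (fun z : C => RtoC (Im z) * F1int v z)%C 0.
Proof.
intros eps He.
generalize (filter_and _ _ near_infty_pos (near_infty_inversion _
  (F1int_limit v' continuous_quarter_turn periodic_quarter_turn 0 eps He))).
apply filter_imp; intros z [Hz H].
rewrite Cminus_0_r.
rewrite F1int_inversion by exact Hz.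
rewrite Cminus_0_r in H; exact H.
Qed.
End Infinity.

(** * The Schwarz integral of the biharmonic plane *)

Lemma filterlim_B_iff {T} (F : (T -> Prop) -> Prop) {FF : Filter F} (Phi : T -> B) (l : B) :
  filterlim Phi F (locally l) <->
  limC F (fun p => fst (Phi p)) (fst l) /\ limC F (fun p => snd (Phi p)) (snd l).
Proof.
rewrite 2!limC_filterlim by exact FF.
split.
- intros H; split.
  + apply (filterlim_comp _ _ _ Phi (fun b : B => fst b) F (locally l)); [exact H|].
    apply (continuous_fst (U := Cu) (V := Cu)).
  + apply (filterlim_comp _ _ _ Phi (fun b : B => snd b) F (locally l)); [exact H|].
    apply (continuous_snd (U := Cu) (V := Cu)).
- intros [H1 H2]; apply filterlim_locally; intros eps.
  exact (filter_and _ _ (proj1 (filterlim_locally _ _) H1 eps) (proj1 (filterlim_locally _ _) H2 eps)).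
Qed.

Lemma of_mu_pair x y : of_mu (x, y) = (RtoC x, RtoC y).
Proof.
unfold of_mu, Badd, Bscal, e1, e2.
pair_ext; pair_ext;
  cbv -[Rplus Rmult Ropp IZR]; ring.
Qed.

Lemma Ci_sqr : (Ci * Ci = - (1))%C.
Proof. pair_ext; simpl; ring. Qed.

Definition schwarz0 (u : R -> R) (z : C) (t : R) : C :=
  (RtoC (u t / (t ^ 2 + 1)) * ((1 + RtoC t * z) / (RtoC t - z)))%C.
(** [Im z] times the [z]-derivative of [schwarz0]: differentiating [(1 + t z) / (t - z)] gives
    [(t ^ 2 + 1) / (t - z) ^ 2], and the weight cancels. *)
Definition schwarz1 (u : R -> R) (z : C) (t : R) : C :=
  (RtoC (u t) * (RtoC (Im z) / ((RtoC t - z) * (RtoC t - z))))%C.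

Lemma t_minus_z_neq_0 t (z : C) : 0 < Im z -> (RtoC t - z)%C <> 0%C.
Proof. intros Hz E; apply (f_equal Im) in E; simpl in E; unfold Im in Hz; lra. Qed.

(* Since [n ^ 2 = 0], [(t - zeta)^-1 = (t - z)^-1 + y (t - z)^-2 n]. *)
Lemma schwarz_integrand_eq u (x y t : R) : 0 < y ->
  schwarz_integrand u (x, y) t =
  ((schwarz0 u (x, y) t - Ci * schwarz1 u (x, y) t)%C, schwarz1 u (x, y) t).
Proof.
intros Hz; unfold schwarz_integrand; rewrite of_mu_pair.
assert (N := t_minus_z_neq_0 t (x, y) Hz).
assert (Ht : RtoC (t ^ 2 + 1) <> 0%C) by (intros E; apply RtoC_inj in E; nra).
unfold schwarz0, schwarz1.
replace (RtoC (u t / (t ^ 2 + 1))) with (RtoC (u t) / RtoC (t ^ 2 + 1))%C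
  by (rewrite RtoC_div; [reflexivity|nra]).
assert (Et : RtoC (t ^ 2 + 1) = (RtoC t * RtoC t + 1)%C)
  by (rewrite RtoC_plus, RtoC_pow; simpl; ring).
assert (Ez : ((x, y) : C) = (RtoC x + Ci * RtoC y)%C)
  by (pair_ext; simpl; ring).
change (Im (x, y)) with y.
rewrite Ez in *.
set (c := RtoC (u t)); rewrite Et in *; clear Et Ez Hz.
set (T := RtoC t) in *; set (X := RtoC x) in *; set (Y := RtoC y) in *.
assert (E : Bmul (Bscal (c / (T * T + 1))%C (Badd e1 (Bscal T (X, Y)))) (Binv (Bsub (Bscal T e1) (X, Y)))
  = let p := (c / (T * T + 1) * (1 + T * X))%C in let q := (c / (T * T + 1) * (T * Y))%C in
    let d := (T - X + Ci * - Y)%C in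
    let r := ((T - X + 2 * Ci * - Y) / (d * d))%C in let s := (- - Y / (d * d))%C in
    ((p * r + q * s)%C, (p * s + q * r + 2 * Ci * (q * s))%C)).
{ cbv zeta.
  replace (Badd e1 (Bscal T (X, Y))) with ((1 + T * X, T * Y)%C : B).
  2:{ unfold Badd, e1, Bscal; pair_ext; [reflexivity|].
      change (T * Y = 0 + T * Y)%C; ring. }
  replace (Bsub (Bscal T e1) (X, Y)) with ((T - X, - Y)%C : B).
  2:{ unfold Bsub, e1, Bscal; pair_ext; [change (T - X = T * 1 - X)%C|change (- Y = T * 0 - Y)%C]; ring. }
  reflexivity. }
rewrite E; clear E; cbv zeta.
assert (N' : (T - X + Ci * - Y)%C <> 0%C) by (intros E; apply N; rewrite <- E; ring).
assert (I := Ci_sqr).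
replace (T - (X + Ci * Y))%C with (T - X + Ci * - Y)%C by ring.
set (D := (T - X + Ci * - Y)%C) in *.
assert (EX : (X = T - D - Ci * Y)%C) by (unfold D; ring).
clearbody D; rewrite EX.
pair_ext; cbn [fst snd];
  eq_in_C.
(* [Ci] is an atom for [field], so the terms that vanish by [Ci * Ci = - 1] are first collected in
   the factor [Ci * Ci + 1]. *)
- transitivity (c / (T * T + 1) * ((1 + T * (T - D)) * D
     - Ci * (1 + T * T) * Y
     + (Ci * Ci + 1) * T * Y * Y) / (D * D))%C.
  + field; tauto.
  + rewrite I; field; tauto.
- transitivity (c / (T * T + 1) * (Y * (1 + T * T)) / (D * D))%C; field; tauto.
Qed.

Lemma contC_schwarz0 u z t : (forall t, continuous u t) -> 0 < Im z -> contC (schwarz0 u z) t.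
Proof.
intros Hu Hz.
assert (Ct : contC RtoC t) by apply (continuous_RtoC (fun t : R => t)), continuous_id.
apply continuous_Cmult.
- apply (continuous_RtoC (fun t => u t / (t ^ 2 + 1))).
  apply (continuous_mult (K := R_AbsRing)); [apply Hu|].
  apply (ex_derive_continuous (V := RN)); auto_derive; nra.
- apply continuous_Cdiv; [| |now apply t_minus_z_neq_0].
  + apply continuous_Cplus; [apply continuous_const|].
    apply continuous_Cmult; [exact Ct|apply continuous_const].
  + apply continuous_Cminus; [exact Ct|apply continuous_const].
Qed.

Lemma contC_schwarz1 u z t : (forall t, continuous u t) -> 0 < Im z -> contC (schwarz1 u z) t.
Proof.
intros Hu Hz.
assert (Cd : contC (fun t => RtoC t - z)%C t).
{ apply continuous_Cminus; [apply (continuous_RtoC (fun t : R => t)), continuous_id|apply continuous_const]. }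
apply continuous_Cmult; [apply continuous_RtoC, Hu|].
apply continuous_Cdiv; [apply continuous_const|now apply continuous_Cmult|].
apply Cmult_neq_0; now apply t_minus_z_neq_0.
Qed.

Lemma is_CInt_tan (g G : R -> C) N : 0 < N -> (forall t, contC g t) ->
  (forall p, cos p <> 0 -> (RtoC (tan p ^ 2 + 1) * g (tan p))%C = G p) ->
  is_CInt g (- N) N (CInt G (- atan N) (atan N)).
Proof.
intros HN Hg HG.
assert (Ba := atan_bound N).
assert (Pa : 0 < atan N) by (rewrite <- atan_0; now apply atan_increasing).
assert (Pc : forall x, - atan N <= x <= atan N -> cos x <> 0)
  by (intros; apply Rgt_not_eq, cos_gt_0; lra).
assert (I := is_RInt_comp (V := CCN) g tan (fun x => tan x ^ 2 + 1) (- atan N) (atan N)).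
rewrite Rmin_left, Rmax_right in I by lra.
assert (J : is_CInt (fun y => RtoC (tan y ^ 2 + 1) * g (tan y))%C (- atan N) (atan N) (CInt g (- N) N)).
{ replace (CInt g (- N) N) with (CInt g (tan (- atan N)) (tan (atan N))).
  - eapply is_RInt_ext; [|apply I].
    + intros x _; pair_ext; simpl; unfold scal; simpl; unfold mult; simpl; ring.
    + intros x _; apply Hg.
    + intros x Hx; split; [now apply is_derive_tan, Pc|].
      apply (ex_derive_continuous (V := RN)); auto_derive.
      eexists; now apply is_derive_tan, Pc.
  - rewrite <- atan_opp, !tan_atan; reflexivity. }
apply CInt_unique in J.
assert (E : CInt g (- N) N = CInt G (- atan N) (atan N)).
{ rewrite <- J; apply CInt_ext; [lra|]; intros t Ht; now apply HG, Pc. }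
rewrite <- E; apply CInt_correct, ex_CInt_cont; [lra|auto].
Qed.

Lemma C_tan p : cos p <> 0 -> RtoC (tan p) = (RtoC (sin p) / RtoC (cos p))%C.
Proof. intros H; unfold tan; now rewrite RtoC_div. Qed.

Lemma C_sec2 p : cos p <> 0 -> RtoC (tan p ^ 2 + 1) = (/ (RtoC (cos p) * RtoC (cos p)))%C.
Proof.
intros H; rewrite <- RtoC_mult, <- RtoC_inv by (now apply Rmult_integral_contrapositive).
f_equal; unfold tan; assert (S := sin2_cos2 p); unfold Rsqr in S.
apply (Rmult_eq_reg_r (cos p * cos p)); [|now apply Rmult_integral_contrapositive].
rewrite Rinv_l by (now apply Rmult_integral_contrapositive).
transitivity (sin p * sin p + cos p * cos p); [field; exact H|exact S].
Qed.

Lemma RtoC_neq_0 x : x <> 0 -> RtoC x <> 0%C.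
Proof. intros H E; now apply RtoC_inj in E. Qed.

Lemma schwarz0_tan u L z p : 0 < Im z -> cos p <> 0 ->
  (RtoC (tan p ^ 2 + 1) * schwarz0 u z (tan p))%C = (RtoC (circle_data u L p) * kker p z)%C.
Proof.
intros Hz H; rewrite circle_data_tan by exact H.
assert (N := t_minus_z_neq_0 (tan p) z Hz); assert (N' := dker_neq_0 p z Hz).
assert (Nc := RtoC_neq_0 _ H).
assert (P : tan p ^ 2 + 1 <> 0) by (generalize (pow2_ge_0 (tan p)); lra).
unfold schwarz0; rewrite RtoC_div by exact P.
transitivity (RtoC (u (tan p)) * ((1 + RtoC (tan p) * z) / (RtoC (tan p) - z)))%C.
- field; split; [exact N|now apply RtoC_neq_0].
- f_equal; unfold kker, nker, dker in *; rewrite C_tan in * by exact H.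
  field; repeat split; auto.
Qed.

Lemma schwarz1_tan u L z p : 0 < Im z -> cos p <> 0 ->
  (RtoC (tan p ^ 2 + 1) * schwarz1 u z (tan p))%C =
  (RtoC (Im z) * (RtoC (circle_data u L p) * / (dker p z * dker p z)))%C.
Proof.
intros Hz H; rewrite circle_data_tan by exact H.
assert (N := t_minus_z_neq_0 (tan p) z Hz); assert (N' := dker_neq_0 p z Hz).
assert (Nc := RtoC_neq_0 _ H).
unfold schwarz1; rewrite C_sec2 by exact H.
unfold dker in *; rewrite C_tan in N |- * by exact H.
field; repeat split; auto.
Qed.

(** Here the principal value turns into a proper integral: [G] is bounded on the half turn and the
    two omitted arcs shrink as [atan N] tends to [PI / 2]. *)
Lemma CInt_atan_lim (G : R -> C) : (forall t, contC G t) ->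
  limC (Rbar_locally p_infty) (fun N => CInt G (- atan N) (atan N)) (half_turn_int G).
Proof.
intros HG eps He.
assert (HPI := PI_RGT_0).
destruct (continuous_bounded (fun t => Cmod (G t)) (- hpi) hpi) as [M [PM HM]];
  [lra|intros; apply continuous_Cmod, HG|].
set (d := Rmin (hpi / 2) (eps / (2 * (M + 1)) / 2)).
assert (Pq : 0 < eps / (2 * (M + 1)) / 2) by (apply Rdiv_lt_0_compat; [apply Rdiv_lt_0_compat|]; lra).
assert (Pd : 0 < d) by (apply Rmin_pos; lra).
assert (D1 : d <= hpi / 2) by apply Rmin_l.
assert (D2 : 2 * (d * M) < eps).
{ assert (d <= eps / (2 * (M + 1)) / 2) by apply Rmin_r.
  apply Rle_lt_trans with (2 * (eps / (2 * (M + 1)) / 2 * (M + 1))).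
  - apply Rmult_le_compat_l; [lra|]; apply Rmult_le_compat; lra.
  - replace (2 * (eps / (2 * (M + 1)) / 2 * (M + 1))) with (eps / 2) by (field; lra); lra. }
exists (tan (hpi - d)); intros N HN.
assert (Ba := atan_bound N).
assert (A : hpi - d < atan N).
{ rewrite <- (atan_tan (hpi - d)) by lra; now apply atan_increasing. }
assert (Ex : forall a b, a <= b -> ex_CInt G a b) by (intros; apply ex_CInt_cont; auto).
unfold half_turn_int.
rewrite <- (CInt_Chasles G (- hpi) (- atan N) hpi), <- (CInt_Chasles G (- atan N) (atan N) hpi) by (apply Ex; lra).
replace (_ - _)%C with (- (CInt G (- hpi) (- atan N) + CInt G (atan N) hpi))%C by ring.
rewrite Cmod_opp; lt_triangle.
assert (B : forall a b, - hpi <= a -> a <= b -> b <= hpi -> b - a <= d -> Cmod (CInt G a b) <= d * M).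
{ intros a b ? ? ? ?; apply Rle_trans with ((b - a) * M); [|now apply Rmult_le_compat_r].
  apply Cmod_CInt_le_const; [assumption| |now apply Ex].
  intros t Ht; eapply Rle_trans; [apply Rle_abs|]; apply HM; lra. }
assert (B1 := B (- hpi) (- atan N) ltac:(lra) ltac:(lra) ltac:(lra) ltac:(lra)).
assert (B2 := B (atan N) hpi ltac:(lra) ltac:(lra) ltac:(lra) ltac:(lra)).
lra.
Qed.

Section SchwarzValue.
Variables (u : R -> R) (L : R).
Hypothesis Hu : forall t, continuous u t.
Hypothesis HL : filterlim u at_infty (locally L).
Let v := circle_data u L.

Definition Wint (v : R -> R) (z : C) : C := (RtoC (Im z) * F1int v z)%C.

(** The components are those of [F + W n] with [n = e2 - i e1], multiplied by [pi_i]. *)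
Lemma is_pv_schwarz (x y : R) : 0 < y ->
  is_pv (schwarz_integrand u (x, y))
    ((pi_i * (Fint v (x, y) - Ci * Wint v (x, y)))%C, (pi_i * Wint v (x, y))%C).
Proof.
intros Hy.
assert (Hz : 0 < Im (x, y)) by exact Hy.
assert (HPI := PI_RGT_0).
assert (Hv : forall t, continuous v t) by now apply circle_data_continuous.
set (G0 := fun p => (RtoC (v p) * kker p (x, y))%C).
set (G1 := fun p => (RtoC (Im (x, y)) * (RtoC (v p) * / (dker p (x, y) * dker p (x, y))))%C).
assert (C0 : forall t, contC G0 t).
{ intros t; apply continuous_Cmult; [apply continuous_RtoC, Hv|now apply contC_kker]. }
assert (C1' : forall t, contC (fun p => RtoC (v p) * / (dker p (x, y) * dker p (x, y)))%C t).
{ intros t; apply continuous_Cmult; [apply continuous_RtoC, Hv|now apply contC_inv_dker2]. }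
assert (C1 : forall t, contC G1 t).
{ intros t; apply continuous_Cmult; [apply continuous_const|apply C1']. }
assert (E0 : (pi_i * Fint v (x, y))%C = half_turn_int G0)
  by (unfold Fint, G0; field; apply pi_i_neq_0).
assert (E1 : (pi_i * Wint v (x, y))%C = half_turn_int G1).
{ unfold G1, half_turn_int; rewrite CInt_mult by (apply ex_CInt_cont; [lra|intros; apply C1']).
  unfold Wint, F1int, half_turn_int; field; apply pi_i_neq_0. }
set (J := fun N => (CInt G0 (- atan N) (atan N) - Ci * CInt G1 (- atan N) (atan N), CInt G1 (- atan N) (atan N))%C : B).
assert (HI : forall N, 0 < N -> is_RInt (V := B) (schwarz_integrand u (x, y)) (- N) N (J N)).
{ intros N HN.
  assert (I0 := is_CInt_tan _ G0 N HN (fun t => contC_schwarz0 u (x, y) t Hu Hz)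
    (fun p Hp => schwarz0_tan u L (x, y) p Hz Hp)).
  assert (I1 := is_CInt_tan _ G1 N HN (fun t => contC_schwarz1 u (x, y) t Hu Hz)
    (fun p Hp => schwarz1_tan u L (x, y) p Hz Hp)).
  apply (is_RInt_ext (V := B) (fun t => ((schwarz0 u (x, y) t - Ci * schwarz1 u (x, y) t)%C, schwarz1 u (x, y) t) : B)).
  { intros t _; symmetry; now apply schwarz_integrand_eq. }
  apply (is_RInt_fct_extend_pair (U := CN) (V := CN)); cbn [fst snd].
  - apply (is_RInt_minus (V := CN)); [exact I0|now apply is_CInt_mult].
  - exact I1. }
assert (HJ : filterlim J (Rbar_locally p_infty)
  (locally (((pi_i * (Fint v (x, y) - Ci * Wint v (x, y)))%C, (pi_i * Wint v (x, y))%C) : B))).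
{ assert (L0 := CInt_atan_lim G0 C0); assert (L1 := CInt_atan_lim G1 C1).
  apply filterlim_B_iff; [apply Rbar_locally_filter|split; cbn [fst snd J]].
  - intros eps He.
    assert (He2 : 0 < eps / 2) by lra.
    generalize (filter_and _ _ (L0 _ He2) (L1 _ He2)); apply filter_imp; intros N [H0 H1].
    rewrite <- E0 in H0; rewrite <- E1 in H1.
    replace (_ - _)%C with ((CInt G0 (- atan N) (atan N) - pi_i * Fint v (x, y))
      - Ci * (CInt G1 (- atan N) (atan N) - pi_i * Wint v (x, y)))%C by ring.
    unfold Cminus at 1; lt_triangle.
    rewrite Cmod_opp, Cmod_mult, Cmod_Ci; lra.
  - rewrite E1; exact L1. }
intros P HP; specialize (HJ P HP).
assert (Hpos : Rbar_locally p_infty (fun N => 0 < N)) by (exists 0; auto).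
unfold filtermapi; generalize (filter_and _ _ Hpos HJ); apply filter_imp; intros N [HN HPJ].
exists (J N); split; [now apply HI|exact HPJ].
Qed.

Lemma schwarz_eq (x y : R) : 0 < y ->
  schwarz u (x, y) = ((Fint v (x, y) - Ci * Wint v (x, y))%C, Wint v (x, y)).
Proof.
intros Hy; unfold schwarz.
rewrite (is_pv_unique _ _ (is_pv_schwarz x y Hy)).
unfold Bscal; fold pi_i; cbn [fst snd].
assert (N := pi_i_neq_0).
pair_ext; cbn [fst snd]; 
  eq_in_C; field; exact N.
Qed.
End SchwarzValue.

Lemma sol_formula_eq u1 u4 L1 L4 a1 a2 (x y : R) :
  (forall t, continuous u1 t) -> (forall t, continuous u4 t) ->
  filterlim u1 at_infty (locally L1) -> filterlim u4 at_infty (locally L4) -> 0 < y ->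
  let v1 := circle_data u1 L1 in let v4 := circle_data u4 L4 in let z := (x, y) : C in
  sol_formula u1 u4 a1 a2 (x, y) =
  ((Fint v1 z - Ci * Wint v1 z + Ci * Wint v4 z + Ci * RtoC a1)%C,
   (Wint v1 z - Wint v4 z + Ci * Fint v4 z + RtoC a2)%C).
Proof.
intros Hu1 Hu4 HL1 HL4 Hy v1 v4 z.
unfold sol_formula.
rewrite (schwarz_eq u1 L1 Hu1 HL1 x y Hy), (schwarz_eq u4 L4 Hu4 HL4 x y Hy).
fold v1 v4; change ((x, y) : C) with z.
assert (I := Ci_sqr).
unfold Badd, Bmul, Bscal, e1, e2.
set (f1 := Fint v1 z); set (w1 := Wint v1 z); set (f4 := Fint v4 z); set (w4 := Wint v4 z).
pair_ext; cbn [fst snd].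
- change ((f1 - Ci * w1) * 1 + w1 * 0 + ((f4 - Ci * w4) * (Ci * 0) + w4 * (Ci * 1))
    + RtoC a1 * Ci * 1 + RtoC a2 * 0 = f1 - Ci * w1 + Ci * w4 + Ci * RtoC a1)%C.
  ring.
- change ((f1 - Ci * w1) * 0 + w1 * 1 + 2 * Ci * (w1 * 0) 
    + ((f4 - Ci * w4) * (Ci * 1) + w4 * (Ci * 0) + 2 * Ci * (w4 * (Ci * 1)))
    + RtoC a1 * Ci * 0 + RtoC a2 * 1 = w1 - w4 + Ci * f4 + RtoC a2)%C.
  transitivity (w1 + Ci * f4 + (Ci * Ci) * w4 + RtoC a2)%C; [ring|rewrite I; ring].
Qed.

(* The coordinates of [b] in the basis [1, n] are [dual0 b] and [snd b]. *)
Definition dual0 (b : B) : C := (fst b + Ci * snd b)%C.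

(** With [k = X + i Y] the increment is [k + Y n], and [n ^ 2 = 0] makes its inverse
    [/ k - Y / (k * k) n]. *)
Lemma mquotient_eq (a b : C) (X Y : R) : ((X, Y) : C) <> 0%C ->
  let k := (X, Y) : C in let q := Bmul (a, b) (Binv (of_mu (X, Y))) in
  dual0 q = ((a + Ci * b) / k)%C /\
  snd q = (b / k - (a + Ci * b) * RtoC Y / (k * k))%C.
Proof.
intros N k q.
assert (Ek : k = (RtoC X + Ci * RtoC Y)%C) by (pair_ext; simpl; ring).
assert (I := Ci_sqr).
assert (Eq : q = ((a * ((RtoC X + 2 * Ci * RtoC Y) / (k * k)) + b * (- RtoC Y / (k * k)))%C,
   (a * (- RtoC Y / (k * k)) + b * ((RtoC X + 2 * Ci * RtoC Y) / (k * k)) + 2 * Ci * (b * (- RtoC Y / (k * k))))%C)).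
{ unfold q; rewrite of_mu_pair, Ek; reflexivity. }
unfold dual0; rewrite Eq; cbn [fst snd]; clear Eq q.
fold k in N.
assert (EX : RtoC X = (k - Ci * RtoC Y)%C) by (rewrite Ek; ring).
rewrite EX; set (y := RtoC Y); clearbody k; split.
- transitivity ((a + Ci * b) / k + (Ci * Ci + 1) * (- (b * y)) / (k * k))%C; [field; exact N|].
  rewrite I; field; exact N.
- eq_in_C; field; exact N.
Qed.

(** The [1]-coordinate of the quotient is an ordinary complex quotient. The [n]-coordinate carries
    the correction [df h * Im h / (h * h)], so [snd] of a monogenic function need not be
    holomorphic. *)
Lemma is_mderive_iff (Phi : mu -> B) (z : C) (l : B) :
  let df := fun h : C => (dual0 (Phi (z + h)%C) - dual0 (Phi z))%C in
  let dw := fun h : C => (snd (Phi (z + h)%C) - snd (Phi z))%C in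
  is_mderive Phi z l <->
  limC punctured (fun h => df h / h)%C (dual0 l) /\
  limC punctured (fun h => dw h / h - df h * RtoC (Im h) / (h * h))%C (snd l).
Proof.
intros df dw; unfold is_mderive; fold punctured.
rewrite filterlim_B_iff by apply punctured_filter.
set (q := fun h : mu => Bmul (Bsub (Phi (plus (z : mu) h)) (Phi z)) (Binv (of_mu h))).
assert (Eq : forall h : C, h <> 0%C -> dual0 (q h) = (df h / h)%C /\
   snd (q h) = (dw h / h - df h * RtoC (Im h) / (h * h))%C).
{ intros [X Y] Hh.
  assert (E := mquotient_eq (fst (Phi (z + (X, Y))%C) - fst (Phi z))%C (dw (X, Y)) X Y Hh).
  cbv zeta in E; destruct E as [E1 E2].
  assert (Ed : (fst (Phi (z + (X, Y))%C) - fst (Phi z) + Ci * dw (X, Y))%C = df (X, Y))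
    by (unfold df, dw, dual0; ring).
  rewrite Ed in E1, E2; split; [exact E1|exact E2]. }
assert (E0 : punctured (fun h : C => dual0 (q h) = (df h / h)%C)).
{ apply punctured_iff; exists 1; split; [lra|]; intros h Hh _; now apply Eq. }
assert (E1 : punctured (fun h : C => snd (q h) = (dw h / h - df h * RtoC (Im h) / (h * h))%C)).
{ apply punctured_iff; exists 1; split; [lra|]; intros h Hh _; now apply Eq. }
split.
- intros [H0 H1]; split.
  + apply (limC_ext _ _ _ _ E0); apply limC_plus; [apply punctured_filter|exact H0|].
    apply limC_scal; [apply punctured_filter|exact H1].
  + exact (limC_ext _ _ _ _ E1 H1).
- intros [H0 H1].
  assert (H1' : limC punctured (fun h => snd (q h)) (snd l)).
  { apply (limC_ext _ (fun h : C => dw h / h - df h * RtoC (Im h) / (h * h))%C); [|exact H1].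
    revert E1; apply filter_imp; intros h E; symmetry; exact E. }
  split; [|exact H1'].
  apply (limC_ext _ (fun h : C => df h / h - Ci * snd (q h))%C).
  + revert E0; apply filter_imp; intros h E; rewrite <- E; unfold dual0.
    change (fst (q h) + Ci * snd (q h) - Ci * snd (q h) = fst (q h))%C; ring.
  + replace (fst l : C) with (dual0 l - Ci * snd l)%C by (unfold dual0; ring).
    apply limC_minus; [apply punctured_filter|exact H0|].
    apply limC_scal; [apply punctured_filter|exact H1'].
Qed.

Lemma punctured_translate z : 0 < Im z -> punctured (fun h : C => 0 < Im (z + h)%C).
Proof.
intros Hz; apply punctured_iff; exists (Im z); split; [exact Hz|]; intros h _ Hm.
assert (A := im_le_Cmod h); apply Rabs_le_between in A; simpl; unfold Im in *; lra.
Qed.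

(** Covers functions [f + (y f' + G) n]. The increment of [y f'] produces [Im h / h * f1 (z + h)],
    and subtracting the correction leaves [Im h / h * (f1 (z + h) - df h / h)]: a factor of modulus
    at most 1 times a difference tending to 0. *)
Lemma monogenic_of_hol (Phi : mu -> B) (f f1 G : C -> C) z m g : 0 < Im z ->
  cdiff f z (f1 z) -> cdiff f1 z m -> cdiff G z g ->
  (forall p : C, 0 < Im p -> dual0 (Phi p) = f p) ->
  (forall p : C, 0 < Im p -> snd (Phi p) = (RtoC (Im p) * f1 p + G p)%C) ->
  exists l, is_mderive Phi z l.
Proof.
intros Hz Hf Hf1 HG E0 E1.
set (l1 := (RtoC (Im z) * m + g)%C).
exists ((f1 z - Ci * l1)%C, l1).
apply is_mderive_iff; cbv zeta; unfold dual0 at 3; cbn [fst snd].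
replace (f1 z - Ci * l1 + Ci * l1)%C with (f1 z) by ring.
apply cdiff_iff_quotient in Hf; apply cdiff_iff_quotient in HG.
assert (Hc : limC punctured (fun h : C => f1 (z + h)%C) (f1 z)).
{ assert (L := cdiff_limC _ _ _ Hf1).
  intros eps He; destruct (proj1 (locally_Cmod _ _) (L eps He)) as [d [Hd K]].
  apply punctured_iff; exists d; split; [exact Hd|]; intros h _ Hm; apply K.
  replace (z + h - z)%C with h by ring; exact Hm. }
apply cdiff_iff_quotient in Hf1.
split.
- refine (limC_ext _ _ _ _ _ Hf).
  generalize (punctured_translate z Hz); apply filter_imp; intros h Hh.
  now rewrite !E0.
- assert (Small : limC punctured (fun h : C => RtoC (Im h) / h * (f1 (z + h)%C - (f (z + h) - f z) / h))%C 0).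
  { assert (D := limC_minus _ _ _ _ _ Hc Hf).
    replace (f1 z - f1 z)%C with (RtoC 0) in D by ring.
    intros eps He; destruct (proj1 (punctured_iff _) (D eps He)) as [d [Hd K]].
    apply punctured_iff; exists d; split; [exact Hd|]; intros h Hh Hm.
    specialize (K h Hh Hm).
    rewrite Cminus_0_r in K.
    set (r := (f1 (z + h) - (f (z + h) - f z) / h)%C) in *.
    replace (RtoC (Im h) / h * r - 0)%C with (RtoC (Im h) * / h * r)%C by (field; exact Hh).
    rewrite !Cmod_mult, Cmod_inv, Cmod_R by exact Hh.
    assert (Ph := proj1 (Cmod_gt_0 h) Hh).
    assert (Q : Rabs (Im h) * / Cmod h <= 1).
    { apply (Rmult_le_reg_r (Cmod h)); [exact Ph|].
      rewrite Rmult_assoc, Rinv_l, Rmult_1_r, Rmult_1_l by lra; apply im_le_Cmod. }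
    assert (0 <= Rabs (Im h) * / Cmod h)
      by (apply Rmult_le_pos; [apply Rabs_pos|left; now apply Rinv_0_lt_compat]).
    generalize (Cmod_ge_0 r); nra. }
  assert (Lim := limC_plus _ _ _ _ _ (limC_plus _ _ _ _ _ (limC_scal _ (RtoC (Im z)) _ _ Hf1) HG) Small).
  rewrite Cplus_0_r in Lim; refine (limC_ext _ _ _ _ _ Lim).
  assert (N : punctured (fun h : C => h <> 0%C)) by (apply punctured_iff; exists 1; split; [lra|auto]).
  generalize (filter_and _ _ N (punctured_translate z Hz)); apply filter_imp; intros h [Hh Hp].
  rewrite !E0, !E1 by assumption.
  replace (RtoC (Im (z + h)%C)) with (RtoC (Im z) + RtoC (Im h))%C
    by (rewrite <- RtoC_plus; reflexivity).
  field; exact Hh.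
Qed.

Lemma monogenic_dual0 Phi z l : is_mderive Phi z l -> cdiff (fun p => dual0 (Phi p)) z (dual0 l).
Proof. intros H; apply cdiff_iff_quotient; exact (proj1 (proj1 (is_mderive_iff _ _ _) H)). Qed.

(** * Boundary behaviour of the solution formula *)

Lemma within_bar_iff x (P : mu -> Prop) : within Pi_plus_bar (locally ((x, 0) : mu)) P <->
  exists d, 0 < d /\ forall z : C, 0 <= Im z -> Cmod (z - RtoC x) < d -> P z.
Proof.
unfold within; rewrite (locally_Cmod (x, 0)); split; intros [d [Hd K]]; exists d; split; try exact Hd.
- intros z Hz Hm; apply K; [exact Hm|exact Hz].
- intros z Hm Hz; apply K; [exact Hz|exact Hm].
Qed.

(** A boundary point near [x] is itself approached by interior points still near [x], so its value
    is within [eps / 2 + eps / 2] of [g (x, 0)]. Limits from inside thus give continuity along the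
    boundary as well. *)
Lemma limC_closure (g h : C -> C) :
  (forall p, 0 < Im p -> g p = h p) -> (forall x : R, limC (near_real x) h (g (x, 0))) ->
  forall x : R, limC (within Pi_plus_bar (locally ((x, 0) : mu))) g (g (x, 0)).
Proof.
intros E H x eps He.
assert (He2 : 0 < eps / 2) by lra.
destruct (proj1 (near_real_iff x _) (H x _ He2)) as [d [Hd K]].
apply within_bar_iff; exists d; split; [exact Hd|]; intros z Hz Hm.
destruct (Rle_lt_or_eq_dec _ _ Hz) as [L|E0].
{ rewrite E by exact L; generalize (K z L Hm); lra. }
destruct z as [x' y']; simpl in E0; subst y'.
assert (Nd : near_real x' (fun p : C => 0 < Im p /\ Cmod (p - RtoC x) < d)).
{ apply near_real_iff; exists (d - Cmod ((x', 0) - RtoC x)); split; [lra|]; intros p Hp Hp'.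
  split; [exact Hp|].
  replace (p - RtoC x)%C with ((p - RtoC x') + ((x', 0) - RtoC x))%C
    by (unfold RtoC; ring_simplify; pair_ext; simpl; ring).
  lt_triangle; lra. }
destruct (filter_ex _ (filter_and _ _ Nd (H x' _ He2))) as [p [[P1 P2] P3]].
specialize (K p P1 P2).
replace (g (x', 0) - g (x, 0))%C with ((h p - g (x, 0)) - (h p - g (x', 0)))%C by ring.
unfold Cminus at 1; lt_triangle; rewrite Cmod_opp; lra.
Qed.

Lemma near_real_within_bar x P : within Pi_plus_bar (locally ((x, 0) : mu)) P -> near_real x P.
Proof.
intros H; destruct (proj1 (within_bar_iff _ _) H) as [d [Hd K]].
apply near_real_iff; exists d; split; [exact Hd|]; intros z Hz; apply K; lra.
Qed.

Lemma data_limits u L : dini (omega u) -> dini (omega_infty u L) ->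
  filterlim u at_infty (locally L) -> let v := circle_data u L in
  (forall t, continuous v t) /\
  (forall x, exists l, limC (near_real x) (Fint v) l /\ Re l = u x) /\
  (forall x, limC (near_real x) (Wint v) 0) /\
  (exists l, limC near_infty (Fint v) l) /\ limC near_infty (Wint v) 0.
Proof.
intros H H' HL v.
assert (Hv : forall t, continuous v t)
  by (apply circle_data_continuous; [now apply omega_continuous|exact HL]).
assert (Hp : forall t, v (t + PI) = v t) by apply circle_data_periodic.
split; [exact Hv|]; split; [|split; [|split]].
- intros x.
  assert (Pc : 0 < cos (atan x)) by (generalize (atan_bound x); intros; apply cos_gt_0; lra).
  destruct (Fint_limit v Hv Hp x) as [l Hl]; [now apply uniform_dini_finite|].
  exists l; split; [exact Hl|].
  rewrite (Re_Fint_limit v Hv Hp x l Hl); unfold v.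
  rewrite circle_data_tan by lra; now rewrite tan_atan.
- intros x; now apply F1int_limit.
- apply Fint_limit_infty; [exact Hv|exact Hp|now apply uniform_dini_infty].
- now apply F1int_limit_infty.
Qed.

Definition sol0 (v1 v4 : R -> R) (a1 : R) (z : C) : C :=
  (Fint v1 z - Ci * Wint v1 z + Ci * Wint v4 z + Ci * RtoC a1)%C.
Definition sol1 (v1 v4 : R -> R) (a2 : R) (z : C) : C :=
  (Wint v1 z - Wint v4 z + Ci * Fint v4 z + RtoC a2)%C.

Lemma sol_limit (F : (mu -> Prop) -> Prop) {FF : Filter F} v1 v4 a1 a2 l1 l4 :
  limC F (Fint v1) l1 -> limC F (Fint v4) l4 -> limC F (Wint v1) 0 -> limC F (Wint v4) 0 ->
  limC F (sol0 v1 v4 a1) (l1 + Ci * RtoC a1)%C /\ limC F (sol1 v1 v4 a2) (Ci * l4 + RtoC a2)%C.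
Proof.
intros H1 H4 W1 W4; split.
- replace (l1 + Ci * RtoC a1)%C with (l1 - Ci * 0 + Ci * 0 + Ci * RtoC a1)%C by ring.
  apply limC_plus; [exact FF| |now apply limC_const].
  apply limC_plus; [exact FF| |now apply limC_scal].
  apply limC_minus; [exact FF|exact H1|now apply limC_scal].
- replace (Ci * l4 + RtoC a2)%C with (0 - 0 + Ci * l4 + RtoC a2)%C by ring.
  apply limC_plus; [exact FF| |now apply limC_const].
  apply limC_plus; [exact FF| |now apply limC_scal].
  now apply limC_minus.
Qed.

Lemma continuous_sol v1 v4 a1 a2 z : (forall t, continuous v1 t) -> (forall t, continuous v4 t) ->
  0 < Im z -> contCC (sol0 v1 v4 a1) z /\
  contCC (sol1 v1 v4 a2) z.
Proof.
intros H1 H4 Hz.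
assert (CF : forall v, (forall t, continuous v t) -> contCC (Fint v) z)
  by (intros v Hv; exact (cdiff_continuous _ _ _ (cdiff_Fint v z Hz Hv))).
assert (CW : forall v, (forall t, continuous v t) -> contCC (Wint v) z).
{ intros v Hv; apply continuous_Cmult; [|exact (cdiff_continuous _ _ _ (cdiff_F1int v z Hz Hv))].
  apply (continuous_RtoC (fun z : C => Im z)).
  apply (proj1 (continuous_C_iff (fun z : C => z) z)), continuous_id. }
assert (CI : forall f, contCC f z ->
  contCC (fun z => Ci * f z)%C z)
  by (intros f Hf; apply continuous_Cmult; [apply continuous_const|exact Hf]).
split.
- apply continuous_Cplus; [|apply continuous_const].
  apply continuous_Cplus; [|apply CI, CW, H4].
  apply continuous_Cminus; [apply CF, H1|apply CI, CW, H1].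
- apply continuous_Cplus; [|apply continuous_const].
  apply continuous_Cplus; [|apply CI, CF, H4].
  apply continuous_Cminus; [apply CW, H1|apply CW, H4].
Qed.

(** Since [e2 = i + n], the formula is [f + (y f' + G) n] with [f] equal to [Fint v1 - Fint v4] plus
    a constant and [G = Ci * Fint v4 + a2]. *)
Lemma monogenic_sol v1 v4 a1 a2 (Phi : mu -> B) : (forall t, continuous v1 t) -> (forall t, continuous v4 t) ->
  (forall p : C, 0 < Im p -> Phi p = (sol0 v1 v4 a1 p, sol1 v1 v4 a2 p)) -> monogenic Pi_plus Phi.
Proof.
intros H1 H4 E z Hz.
apply (monogenic_of_hol Phi (fun p => Fint v1 p - Fint v4 p + (Ci * RtoC a1 + Ci * RtoC a2))%C
  (fun p => F1int v1 p - F1int v4 p)%C (fun p => Ci * Fint v4 p + RtoC a2)%C z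
  (F2int v1 z - F2int v4 z)%C (Ci * F1int v4 z)%C Hz).
- rewrite <- Cplus_0_r; apply cdiff_plus; [|apply cdiff_const].
  apply cdiff_minus; now apply cdiff_Fint.
- apply cdiff_minus; now apply cdiff_F1int.
- rewrite <- Cplus_0_r; apply cdiff_plus; [|apply cdiff_const].
  now apply cdiff_scal, cdiff_Fint.
- intros p Hp; rewrite E by exact Hp; unfold dual0, sol0, sol1; cbn [fst snd].
  transitivity (Fint v1 p + (Ci * Ci) * Fint v4 p + (Ci * RtoC a1 + Ci * RtoC a2))%C; [ring|].
  rewrite Ci_sqr; ring.
- intros p Hp; rewrite E by exact Hp; unfold sol1, Wint; cbn [fst snd].
  eq_in_C; ring.
Qed.

(** * Uniqueness *)

Lemma solutions_differ_by_constant u1 u4 (Phi Psi : mu -> B) :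
  solves_14 u1 u4 Phi -> solves_14 u1 u4 Psi ->
  exists a1 a2 : R, forall z : C, 0 < Im z ->
    fst (Phi z) = (fst (Psi z) + Ci * RtoC a1)%C /\ snd (Phi z) = (snd (Psi z) + RtoC a2)%C.
Proof.
intros [CP [MP [[lP IP] BP]]] [CQ [MQ [[lQ IQ] BQ]]].
set (D0 := fun z : C => (fst (Phi z) - fst (Psi z))%C).
set (D1 := fun z : C => (snd (Phi z) - snd (Psi z))%C).
assert (LB : forall x : R, limC (near_real x) D0 (D0 (x, 0)) /\ limC (near_real x) D1 (D1 (x, 0))).
{ intros x.
  assert (Hb : Pi_plus_bar (x, 0)) by (unfold Pi_plus_bar; simpl; lra).
  destruct (proj1 (filterlim_B_iff _ _ _) (CP (x, 0) Hb)) as [P0 P1].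
  destruct (proj1 (filterlim_B_iff _ _ _) (CQ (x, 0) Hb)) as [Q0 Q1].
  split; intros eps He; apply near_real_within_bar; [revert eps He|revert eps He].
  - apply (limC_minus _ _ _ _ _ P0 Q0).
  - apply (limC_minus _ _ _ _ _ P1 Q1). }
assert (LI : limC near_infty D0 (fst lP - fst lQ) /\ limC near_infty D1 (snd lP - snd lQ)).
{ destruct (proj1 (filterlim_B_iff near_infty _ _) IP) as [P0 P1].
  destruct (proj1 (filterlim_B_iff near_infty _ _) IQ) as [Q0 Q1].
  split; apply limC_minus; try apply near_infty_filter; assumption. }
assert (R0 : forall x : R, Re (D0 (x, 0)) = 0).
{ intros x; generalize (proj1 (BP x)) (proj1 (BQ x)); unfold D0, U1; simpl; unfold Re; intros; lra. }
assert (R1 : forall x : R, Im (D1 (x, 0)) = 0).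
{ intros x; generalize (proj2 (BP x)) (proj2 (BQ x)); unfold D1, U4; simpl; unfold Im; intros; lra. }
(* On the real line [Re f = Re D0 - Im D1], the difference of the [U1]-components minus that of the
   [U4]-components, hence 0. *)
set (f := fun z : C => (D0 z + Ci * D1 z)%C).
assert (Ef : forall z, f z = (dual0 (Phi z) - dual0 (Psi z))%C)
  by (intros z; unfold f, D0, D1, dual0; ring).
assert (Cf : forall z w, 0 < Im z -> 0 < Im w -> f z = f w).
{ apply half_plane_rigidity.
  - intros z Hz; destruct (MP z Hz) as [l Hl]; destruct (MQ z Hz) as [m Hm].
    exists (dual0 l - dual0 m)%C.
    apply cdiff_iff_quotient.
    apply (limC_ext _ (fun h : C => ((dual0 (Phi (z + h)%C) - dual0 (Psi (z + h)%C))
      - (dual0 (Phi z) - dual0 (Psi z))) / h)%C).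
    + apply filter_forall; intros h; now rewrite !Ef.
    + apply (cdiff_iff_quotient (fun p => dual0 (Phi p) - dual0 (Psi p))%C).
      apply cdiff_minus; now apply monogenic_dual0.
  - intros x; destruct (LB x) as [A0 A1]; exists (f (x, 0)); split.
    + apply limC_plus; [apply near_real_filter|exact A0|].
      apply limC_scal; [apply near_real_filter|exact A1].
    + replace (Re (f (x, 0))) with (Re (D0 (x, 0)) - Im (D1 (x, 0)))
        by (unfold f; simpl; unfold Re, Im; ring).
      rewrite R0, R1; ring.
  - destruct LI as [A0 A1]; eexists; apply limC_plus; [apply near_infty_filter|exact A0|].
    apply limC_scal; [apply near_infty_filter|exact A1]. }
assert (CD1 : forall z w, 0 < Im z -> 0 < Im w -> (Ci * D1 z)%C = (Ci * D1 w)%C).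
{ apply (half_plane_rigidity (fun z => Ci * D1 z)%C).
  - intros z Hz; destruct (MP z Hz) as [l Hl]; destruct (MQ z Hz) as [m Hm].
    exists (Ci * (snd l - snd m))%C; apply cdiff_scal, cdiff_iff_quotient.
    apply is_mderive_iff in Hl; apply is_mderive_iff in Hm.
    refine (limC_ext _ _ _ _ _ (limC_minus _ _ _ _ _ (proj2 Hl) (proj2 Hm))).
    assert (N : punctured (fun h : C => h <> 0%C)) by (apply punctured_iff; exists 1; split; [lra|auto]).
    generalize (filter_and _ _ N (punctured_translate z Hz)); apply filter_imp; intros h [Hh Hp].
    assert (E := Cf _ _ Hp Hz); rewrite !Ef in E.
    (* Both solutions have the same increment of [dual0], so their correction terms cancel and the
       plain quotient of [D1] has a limit. *)
    assert (E' : dual0 (Phi (z + h)%C) = (dual0 (Psi (z + h)%C) + (dual0 (Phi z) - dual0 (Psi z)))%C)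
      by (rewrite <- E; ring).
    rewrite E'; unfold D1; field; exact Hh.
  - intros x; exists (Ci * D1 (x, 0))%C; split.
    + apply limC_scal; [apply near_real_filter|apply LB].
    + replace (Re (Ci * D1 (x, 0))%C) with (- Im (D1 (x, 0))) by (simpl; unfold Im; ring).
      rewrite R1; ring.
  - eexists; apply limC_scal; [apply near_infty_filter|apply LI]. }
assert (Hi : 0 < Im Ci) by (simpl; lra).
assert (K1 : forall z, 0 < Im z -> D1 z = D1 Ci).
{ intros z Hz; transitivity (- Ci * (Ci * D1 z))%C.
  - transitivity (- (Ci * Ci) * D1 z)%C; [rewrite Ci_sqr; ring|ring].
  - rewrite (CD1 z Ci Hz Hi).
    transitivity (- (Ci * Ci) * D1 Ci)%C; [ring|rewrite Ci_sqr; ring]. }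
assert (K0 : forall z, 0 < Im z -> D0 z = D0 Ci).
{ intros z Hz; assert (E := Cf z Ci Hz Hi); unfold f in E; rewrite (K1 z Hz) in E.
  transitivity (D0 z + Ci * D1 Ci - Ci * D1 Ci)%C; [ring|rewrite E; ring]. }
assert (Z0 : D0 Ci = D0 (0, 0) /\ D1 Ci = D1 (0, 0)).
{ split; [apply (limC_unique (near_real 0) D0)|apply (limC_unique (near_real 0) D1)]; try apply LB.
  - apply (limC_ext _ (fun _ => D0 Ci)); [|apply limC_const, near_real_filter].
    generalize (near_real_pos 0); apply filter_imp; intros z Hz; symmetry; now apply K0.
  - apply (limC_ext _ (fun _ => D1 Ci)); [|apply limC_const, near_real_filter].
    generalize (near_real_pos 0); apply filter_imp; intros z Hz; symmetry; now apply K1. }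
destruct Z0 as [Z0 Z1].
(* The constants agree with the boundary values, where [Re D0] and [Im D1] vanish; the two remaining
   real parameters are [a1] and [a2]. *)
exists (Im (D0 Ci)), (Re (D1 Ci)); intros z Hz.
assert (T0 : D0 z = (Ci * RtoC (Im (D0 Ci)))%C).
{ rewrite (K0 z Hz), Z0; assert (Q := R0 0); unfold Re in Q.
  pair_ext; [rewrite Q|]; simpl; ring. }
assert (T1 : D1 z = RtoC (Re (D1 Ci))).
{ rewrite (K1 z Hz), Z1; assert (Q := R1 0); unfold Im in Q.
  pair_ext; [|rewrite Q]; reflexivity. }
assert (A : forall a b : C, a = (b + (a - b))%C) by (intros; ring).
split; [rewrite <- T0|rewrite <- T1]; apply A.
Qed.

(** * The formula yields all solutions and nothing else *)

Section MainTheorem.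
Variables (u1 u4 : R -> R) (L1 L4 : R).
Hypothesis (H1 : filterlim u1 at_infty (locally L1)) (H4 : filterlim u4 at_infty (locally L4)).
Hypothesis (D1 : dini (omega u1)) (D1' : dini (omega_infty u1 L1)).
Hypothesis (D4 : dini (omega u4)) (D4' : dini (omega_infty u4 L4)).
Let v1 := circle_data u1 L1.
Let v4 := circle_data u4 L4.

Lemma sol_formula_half_plane a1 a2 (z : C) : 0 < Im z ->
  sol_formula u1 u4 a1 a2 z = (sol0 v1 v4 a1 z, sol1 v1 v4 a2 z).
Proof.
destruct z as [x y]; intros Hz.
apply sol_formula_eq; auto; now apply omega_continuous.
Qed.

Lemma sol_formula_limit (F : (mu -> Prop) -> Prop) {FF : Filter F} a1 a2 l :
  F (fun z : C => 0 < Im z) -> limC F (sol0 v1 v4 a1) (fst l) -> limC F (sol1 v1 v4 a2) (snd l) ->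
  filterlim (sol_formula u1 u4 a1 a2) F (locally l).
Proof.
intros HF L0 L1'; apply filterlim_B_iff; [exact FF|split].
- refine (limC_ext _ _ _ _ _ L0); revert HF; apply filter_imp; intros z Hz.
  now rewrite sol_formula_half_plane.
- refine (limC_ext _ _ _ _ _ L1'); revert HF; apply filter_imp; intros z Hz.
  now rewrite sol_formula_half_plane.
Qed.

(** On the boundary the [Wint] terms vanish and leave [Fint v1 + i a1] and [i Fint v4 + a2]; the
    constants touch only [U2] and [U3]. *)
Lemma sol_formula_boundary a1 a2 x : exists l : B,
  filterlim (sol_formula u1 u4 a1 a2) (near_real x) (locally l) /\ U1 l = u1 x /\ U4 l = u4 x.
Proof.
destruct (data_limits u1 L1 D1 D1' H1) as [_ [B1 [W1 _]]].
destruct (data_limits u4 L4 D4 D4' H4) as [_ [B4 [W4 _]]].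
destruct (B1 x) as [l1 [Hl1 E1]]; destruct (B4 x) as [l4 [Hl4 E4]].
destruct (sol_limit (near_real x) v1 v4 a1 a2 l1 l4 Hl1 Hl4 (W1 x) (W4 x)) as [S0 S1].
exists ((l1 + Ci * RtoC a1)%C, (Ci * l4 + RtoC a2)%C); split.
- apply sol_formula_limit; [apply near_real_filter|apply near_real_pos|exact S0|exact S1].
- unfold U1, U4; rewrite <- E1, <- E4; simpl; unfold Re; split; ring.
Qed.

Lemma sol_formula_solves a1 a2 Phi :
  extends_from_Pi_plus (sol_formula u1 u4 a1 a2) Phi -> solves_14 u1 u4 Phi.
Proof.
intros [EP BP].
destruct (data_limits u1 L1 D1 D1' H1) as [C1 [_ [_ [[i1 I1] W1]]]].
destruct (data_limits u4 L4 D4 D4' H4) as [C4 [_ [_ [[i4 I4] W4]]]].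
fold v1 in C1, I1, W1; fold v4 in C4, I4, W4.
assert (E : forall z : C, 0 < Im z -> Phi z = (sol0 v1 v4 a1 z, sol1 v1 v4 a2 z)).
{ intros z Hz; rewrite EP by exact Hz; now apply sol_formula_half_plane. }
assert (BL : forall x : R, filterlim (sol_formula u1 u4 a1 a2) (near_real x) (locally (Phi (x, 0))))
  by (intros x; now apply BP).
split; [|split; [|split]].
- intros [x y] Hz; unfold Pi_plus_bar in Hz; simpl in Hz.
  destruct (Rle_lt_or_eq_dec _ _ Hz) as [Hy|Hy].
  + apply (filterlim_filter_le_1 (F := locally ((x, y) : mu))); [apply filter_le_within|].
    apply filterlim_B_iff; [apply locally_filter|].
    destruct (continuous_sol v1 v4 a1 a2 (x, y) C1 C4 Hy) as [K0 K1].
    assert (N : locally ((x, y) : mu) (fun z : C => 0 < Im z)).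
    { apply (locally_Cmod (x, y)); exists y; split; [exact Hy|]; intros w Hw.
      assert (A := im_le_Cmod (w - (x, y))%C); apply Rabs_le_between in A.
      change (Im (w - (x, y))%C) with (Im w - y) in A; lra. }
    rewrite (E (x, y) Hy); cbn [fst snd]; split.
    * apply (limC_ext _ (sol0 v1 v4 a1)).
      { revert N; apply filter_imp; intros z Hz'; now rewrite E. }
      apply limC_filterlim; [apply locally_filter|exact K0].
    * apply (limC_ext _ (sol1 v1 v4 a2)).
      { revert N; apply filter_imp; intros z Hz'; now rewrite E. }
      apply limC_filterlim; [apply locally_filter|exact K1].
  + subst y; apply filterlim_B_iff; [apply within_filter, locally_filter|].
    split.
    * apply (limC_closure (fun z => fst (Phi z)) (fun z => fst (sol_formula u1 u4 a1 a2 z))).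
      { intros p Hp; now rewrite EP. }
      intros x'; now apply (proj1 (filterlim_B_iff (near_real x') _ _) (BL x')).
    * apply (limC_closure (fun z => snd (Phi z)) (fun z => snd (sol_formula u1 u4 a1 a2 z))).
      { intros p Hp; now rewrite EP. }
      intros x'; now apply (proj1 (filterlim_B_iff (near_real x') _ _) (BL x')).
- now apply (monogenic_sol v1 v4 a1 a2).
- destruct (sol_limit near_infty v1 v4 a1 a2 i1 i4 I1 I4 W1 W4) as [S0 S1].
  exists ((i1 + Ci * RtoC a1)%C, (Ci * i4 + RtoC a2)%C).
  apply (filterlim_ext_loc (F := near_infty) (sol_formula u1 u4 a1 a2)).
  { generalize near_infty_pos; apply filter_imp; intros z Hz; symmetry; now apply EP. }
  apply sol_formula_limit; [apply near_infty_filter|apply near_infty_pos|exact S0|exact S1].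
- intros x; destruct (sol_formula_boundary a1 a2 x) as [l [Hl [E1 E4]]].
  assert (El : Phi (x, 0) = l).
  { apply (filterlim_B_iff (near_real x)) in Hl; destruct Hl as [M0 M1].
    destruct (proj1 (filterlim_B_iff (near_real x) _ _) (BL x)) as [N0 N1].
    pair_ext.
    - exact (limC_unique _ _ _ _ N0 M0).
    - exact (limC_unique _ _ _ _ N1 M1). }
  rewrite El; now split.
Qed.

Lemma sol_formula_extends a1 a2 : exists Phi, extends_from_Pi_plus (sol_formula u1 u4 a1 a2) Phi.
Proof.
set (bdry := fun x => proj1_sig (constructive_indefinite_description _ (sol_formula_boundary a1 a2 x))).
assert (Hb : forall x, filterlim (sol_formula u1 u4 a1 a2) (near_real x) (locally (bdry x))).
{ intros x; unfold bdry; destruct constructive_indefinite_description as [l [Hl Hl']]; exact Hl. }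
exists (fun z => if Rlt_dec 0 (snd z) then sol_formula u1 u4 a1 a2 z else bdry (fst z)).
split.
- intros z Hz; unfold Pi_plus in Hz; now destruct Rlt_dec.
- intros [x y] Hz; unfold Pi_plus_boundary in Hz; simpl in Hz; subst y; cbn [fst snd].
  destruct Rlt_dec as [H|_]; [lra|apply Hb].
Qed.

(** The comparison solution has both constants 0. The difference from it has the shape of the two
    constant terms of the formula, and continuity on the closure settles the boundary values. *)
Lemma solution_is_formula Phi : solves_14 u1 u4 Phi ->
  exists a1 a2, extends_from_Pi_plus (sol_formula u1 u4 a1 a2) Phi.
Proof.
intros HP.
destruct (sol_formula_extends 0 0) as [Psi HPsi].
destruct (solutions_differ_by_constant u1 u4 Phi Psi HP (sol_formula_solves 0 0 Psi HPsi)) as [a1 [a2 K]].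
exists a1, a2.
assert (E : forall z : C, 0 < Im z -> Phi z = sol_formula u1 u4 a1 a2 z).
{ intros z Hz; rewrite sol_formula_half_plane by exact Hz.
  destruct (K z Hz) as [K0 K1].
  rewrite (proj1 HPsi z Hz), sol_formula_half_plane in K0, K1 by exact Hz; cbn [fst snd] in K0, K1.
  pair_ext; cbn [fst snd]; [rewrite K0; unfold sol0|rewrite K1; unfold sol1];
    eq_in_C; ring. }
split; [intros z Hz; now apply E|].
intros [x y] Hz; unfold Pi_plus_boundary in Hz; simpl in Hz; subst y.
assert (Hb : Pi_plus_bar (x, 0)) by (unfold Pi_plus_bar; simpl; lra).
apply (filterlim_ext_loc (F := near_real x) Phi).
{ generalize (near_real_pos x); apply filter_imp; intros z Hz; now apply E. }
intros P HPP; exact (near_real_within_bar x _ (proj1 HP (x, 0) Hb P HPP)).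
Qed.
End MainTheorem.

Theorem theorem3 (u1 u4 : R -> R) (u1_inf u4_inf : R)
  (Hu1 : filterlim u1 at_infty (locally u1_inf))
  (Hu4 : filterlim u4 at_infty (locally u4_inf))
  (Hd1 : dini (omega u1)) (Hd1' : dini (omega_infty u1 u1_inf))
  (Hd4 : dini (omega u4)) (Hd4' : dini (omega_infty u4 u4_inf)) :
  (forall zeta : mu, Pi_plus zeta ->
     ex_pv (schwarz_integrand u1 zeta) /\ ex_pv (schwarz_integrand u4 zeta)) /\
  (forall a1 a2 : R, exists Phi : mu -> B,
     extends_from_Pi_plus (sol_formula u1 u4 a1 a2) Phi) /\
  (forall Phi : mu -> B,
     solves_14 u1 u4 Phi <->
     exists a1 a2 : R, extends_from_Pi_plus (sol_formula u1 u4 a1 a2) Phi).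
Proof.
split; [|split].
- intros [x y] Hz; split; eexists; [apply (is_pv_schwarz u1 u1_inf)|apply (is_pv_schwarz u4 u4_inf)];
    auto; now apply omega_continuous.
- now apply (sol_formula_extends u1 u4 u1_inf u4_inf).
- intros Phi; split.
  + now apply (solution_is_formula u1 u4 u1_inf u4_inf).
  + intros [a1 [a2 H]]; now apply (sol_formula_solves u1 u4 u1_inf u4_inf) with a1 a2.
Qed.
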